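(* For all $g\in\{0,8,12,16,24\}$, the line of $\mathrm{O}(\mathrm{Leech})$-invariants in $\Lambda^g\,\mathrm{Leech}\otimes\mathbb{Q}$ is generated by $\sigma_C$, where $C$ is any element of $\mathcal{G}$ with $|C|=g$.
   Context: Let $\Omega$ be a set with $24$ elements and $\mathcal{G}$ an extended binary Golay code on $\Omega$, i.e. a $12$-dimensional subspace of $(\mathbb{Z}/2\mathbb{Z})\,\Omega$ (identified with the set of subsets of $\Omega$) all of whose elements $C$ satisfy $|C|\in\{0,8,12,16,24\}$. An octad is an $8$-element subset of $\Omega$ belonging to $\mathcal{G}$. $\mathrm{M}_{24}\subset\mathfrak{S}_\Omega$ is the stabilizer of $\mathcal{G}$. Let $\mathbb{R}\,\Omega$ be the Euclidean space with orthonormal basis $(\nu_i)_{i\in\Omega}$; put $\nu_S=\sum_{i\in S}\nu_i$ for $S\subset\Omega$. $\mathrm{Leech}\subset\mathbb{R}\,\Omega$ is the subgroup generated by the $\frac{1}{\sqrt8}2\nu_O$ ($O$ an octad) and the $\frac1{\sqrt8}(\nu_\Omega-4\nu_i)$ ($i\in\Omega$). For $C\in\mathcal{G}$ with $|C|=g\geq 1$, the stabilizer $G_C$ of $C$ in $\mathrm{M}_{24}$ acts on $C$ by even permutations. Choosing a numbering $c:\{1,\dots,g\}\to C$, set $\beta_C=\nu_{c(1)}\wedge\dots\wedge\nu_{c(g)}\in\Lambda^g\,\mathbb{Q}\,\Omega$ and $\sigma_C=\sum_{\gamma\in\mathrm{M}_{24}/G_C}\gamma\,\beta_C$, well defined up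 to sign; set $\sigma_\emptyset=1$. As $\mathrm{Leech}\otimes\mathbb{Q}=\sqrt2\,\mathbb{Q}\,\Omega$ inside $\mathbb{R}\,\Omega$ and $g$ is even, one has $\Lambda^g\,\mathrm{Leech}\otimes\mathbb{Q}=\Lambda^g\,\mathbb{Q}\,\Omega$ inside $\Lambda^g\,\mathbb{R}\,\Omega$. *)

(* Defs.v *)
From HB Require Import structures.
From mathcomp Require Import all_boot all_order all_algebra all_fingroup.
From mathcomp Require Import all_classical all_reals.
Set Implicit Arguments.
Unset Strict Implicit.
Unset Printing Implicit Defensive.
Import Order.TTheory GRing.Theory Num.Theory.
Local Open Scope classical_set_scope.
Local Open Scope ring_scope.

Definition charvec (Omega : finType) (C : {set Omega}) :
  {ffun Omega -> ('F_2)^o} := [ffun i => (i \in C)%:R].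

Definition codeword (Omega : finType) (G : {vspace {ffun Omega -> ('F_2)^o}})
  (C : {set Omega}) : bool := charvec C \in G.

Definition extended_golay (Omega : finType)
    (G : {vspace {ffun Omega -> ('F_2)^o}}) : Prop :=
  \dim G = 12%N /\
  forall C : {set Omega}, codeword G C -> #|C| \in [:: 0; 8; 12; 16; 24]%N.

Definition octad (Omega : finType) (G : {vspace {ffun Omega -> ('F_2)^o}})
  (O : {set Omega}) : bool := codeword G O && (#|O| == 8)%N.

Definition M24 (Omega : finType) (G : {vspace {ffun Omega -> ('F_2)^o}}) :
  {set {perm Omega}} := 'N([set C : {set Omega} | codeword G C]%SET | 'P^*)%g.

Definition stabM24 (Omega : finType) (G : {vspace {ffun Omega -> ('F_2)^o}})
  (C : {set Omega}) : {set {perm Omega}} := (M24 G :&: 'N(C | 'P))%g.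

(* In {perm Omega}, s * t is s followed by t, so the right coset H :* s is the
   set of the maps s \o h for h in H: a left coset for the composition of maps.
   T below is thus a system of representatives of M24 / G_C. *)
Definition coset_representatives (Omega : finType)
    (G : {vspace {ffun Omega -> ('F_2)^o}}) (C : {set Omega})
    (T : {set {perm Omega}}) : bool :=
  is_transversal T (rcosets (stabM24 G C) (M24 G)) (M24 G).

Notation euclid R Omega := {ffun Omega -> R^o} (only parsing).

Section Euclid.
Context {R : realType} {Omega : finType}.
Local Notation V := (euclid R Omega).

Definition dotp (x y : V) : R := \sum_i (x i : R) * (y i : R).

Definition nu (i : Omega) : V := [ffun j => (j == i)%:R].

Definition nuS (S : {set Omega}) : V := \sum_(i in S) nu i.

Definition perm_euclid (s : {perm Omega}) (x : V) : V := [ffun i => x (s^-1%g i)].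

Lemma perm_euclid_is_linear s : linear (perm_euclid s).
Proof. by move=> a x y; apply/ffunP => i; rewrite !ffunE. Qed.

HB.instance Definition _ s :=
  GRing.isLinear.Build R V V _ (perm_euclid s) (perm_euclid_is_linear s).

Lemma perm_euclid_nu s i : perm_euclid s (nu i) = nu (s i).
Proof. by apply/ffunP => j; rewrite !ffunE (canF_eq (permKV s)). Qed.

Lemma euclid_sum_nu (x : V) : x = \sum_i (x i : R) *: nu i.
Proof.
apply/ffunP => j; rewrite sum_ffunE (bigD1 j) //= big1 ?addr0.
  by rewrite !ffunE eqxx; rewrite /GRing.scale /= mulr1.
move=> i /negPf ij; rewrite !ffunE eq_sym ij.
exact: mulr0.
Qed.

End Euclid.

Definition additive_subgroup (U : zmodType) (H : set U) : Prop :=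
  H 0 /\ forall x y, H x -> H y -> H (x - y).

Definition leech (R : realType) (Omega : finType)
    (G : {vspace {ffun Omega -> ('F_2)^o}}) : set (euclid R Omega) :=
  smallest (@additive_subgroup (euclid R Omega))
    ([set (Num.sqrt 8)^-1 *: (2 *: nuS O) | O in [set O | octad G O]] `|`
     [set (Num.sqrt 8)^-1 *: (nuS [set: Omega]%SET - 4 *: nu i) | i in [set: Omega]]).
Arguments leech R {Omega} G.

(* As L = leech spans R Omega, its isometries are the restrictions to L of the
   linear isometries of R Omega mapping L onto L; a linear isometry is
   automatically bijective. *)
Definition O_Leech (R : realType) (Omega : finType)
    (G : {vspace {ffun Omega -> ('F_2)^o}}) :
    set {linear euclid R Omega -> euclid R Omega} :=
  [set f | (forall x y, dotp (f x) (f y) = dotp x y) /\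
           [set f x | x in leech R G] = leech R G].
Arguments O_Leech R {Omega} G.

(* The g-th exterior power of R Omega is realised by alternating g-tensors:
   a g-tensor is given by its coordinates in the basis
   nu_(i 0) (x) ... (x) nu_(i (g-1)), and v_0 /\ ... /\ v_(g-1) is
   \sum_s sgn(s) v_(s 0) (x) ... (x) v_(s (g-1)).  See
   wedge_alternating_multilinear and wedge_universal. *)
Notation tensors R Omega g := {ffun {ffun 'I_g -> Omega} -> R^o} (only parsing).

Section Exterior.
Context {R : realType} {Omega : finType} {g : nat}.
Local Notation V := (euclid R Omega).
Local Notation tens := (tensors R Omega g).

Definition wedge (v : 'I_g -> V) : tens :=
  [ffun i : {ffun 'I_g -> Omega} => \det (\matrix_(a, b) (v a (i b) : R))].

(* f (x) ... (x) f; on wedges it is the map induced by f on the exterior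
   power, see extmap_wedge. *)
Definition extmap (f : {linear V -> V}) (t : tens) : tens :=
  [ffun i : {ffun 'I_g -> Omega} =>
    \sum_(j : {ffun 'I_g -> Omega})
       (\prod_a (f (nu (j a)) (i a) : R)) * (t j : R)].

Definition upd (U : Type) (v : 'I_g -> U) (k : 'I_g) (x : U) : 'I_g -> U :=
  fun l => if l == k then x else v l.

Definition multilinear (W : lmodType R) (F : ('I_g -> V) -> W) : Prop :=
  forall v k (a : R) x y,
    F (upd v k (a *: x + y)) = a *: F (upd v k x) + F (upd v k y).

Definition alternating_multilinear (W : lmodType R) (F : ('I_g -> V) -> W) :=
  multilinear F /\ forall v k l, k != l -> v k = v l -> F v = 0.

Lemma upd_id (U : Type) (v : 'I_g -> U) k : upd v k (v k) = v.
Proof. by apply/funext => l; rewrite /upd; case: eqP => // ->. Qed.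

Lemma multilinear_sum (W : lmodType R) (F : ('I_g -> V) -> W) v k
    (I : finType) (a : I -> R) (x : I -> V) : multilinear F ->
  F (upd v k (\sum_i a i *: x i)) = \sum_i a i *: F (upd v k (x i)).
Proof.
move=> mF.
have F0 : F (upd v k 0) = 0.
  have := mF v k 1 0 0; rewrite scaler0 addr0 scale1r => /eqP.
  by rewrite -subr_eq subrr eq_sym => /eqP.
elim/big_rec2: _ => // i y z _ <-; exact: mF.
Qed.

Lemma multilinear_eq (W : lmodType R) (F F' : ('I_g -> V) -> W) :
  multilinear F -> multilinear F' ->
  (forall i : {ffun 'I_g -> Omega}, F (nu \o i) = F' (nu \o i)) -> F =1 F'.
Proof.
move=> mF mF' FF' v.
suff H (s : seq 'I_g) : forall v, (forall a, a \notin s -> exists i, v a = nu i) ->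
    F v = F' v by apply: (H (enum 'I_g)) => a; rewrite mem_enum.
elim: s => [w wP|k s IH w wP].
  have [i iP] := choice (fun a => wP a isT).
  suff -> : w = nu \o [ffun a => i a] by [].
  by apply/funext => a; rewrite /= ffunE iP.
rewrite -(upd_id w k) (euclid_sum_nu (w k)) !multilinear_sum //.
apply: eq_bigr => j _; congr (_ *: _); apply: IH => a as_.
rewrite /upd; case: eqVneq => [_|ak]; first by exists j.
by apply: wP; rewrite inE negb_or ak.
Qed.

Lemma wedge_alternating_multilinear : alternating_multilinear wedge.
Proof.
split=> [v k a x y|v k l kl vkl].
  apply/ffunP => i; rewrite !ffunE.
  rewrite (determinant_multilinear
    (B := \matrix_(a0, b) (upd v k x a0 (i b) : R))
    (C := \matrix_(a0, b) (upd v k y a0 (i b) : R)) (i0 := k) (b := a) (c := 1)).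
  - by rewrite mul1r.
  - by apply/rowP => b; rewrite !mxE /upd eqxx !ffunE mul1r.
  - by apply/matrixP => c b; rewrite !mxE /upd eq_sym (negPf (neq_lift _ _)).
  - by apply/matrixP => c b; rewrite !mxE /upd eq_sym (negPf (neq_lift _ _)).
apply/ffunP => i; rewrite !ffunE.
by apply: (determinant_alternate kl) => b; rewrite !mxE vkl.
Qed.

Lemma alternating_tperm (W : lmodType R) (F : ('I_g -> V) -> W) v k l :
  alternating_multilinear F -> k != l -> F (v \o tperm k l) = - F v.
Proof.
move=> [mF aF] kl.
pose w x y := upd (upd v k x) l y.
have wlin x y z : F (w (x + y) z) = F (w x z) + F (w y z).
  have E u : w u z = upd (upd v l z) k u.
    apply/funext => c; rewrite /w /upd; case: (eqVneq c l) => [->|//].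
    by rewrite eq_sym (negPf kl).
  by rewrite !E -{1}[x]scale1r mF scale1r.
have wlin' x y z : F (w z (x + y)) = F (w z x) + F (w z y).
  by rewrite /w -{1}[x]scale1r mF scale1r.
have w0 x : F (w x x) = 0.
  by apply: (aF _ k l kl); rewrite /w /upd eqxx (negPf kl) eqxx.
have : F (w (v k + v l) (v k + v l)) = 0 by exact: w0.
rewrite wlin !wlin' !w0 add0r addr0 => /eqP; rewrite addr_eq0 => /eqP Fw.
have wv : w (v k) (v l) = v.
  by apply/funext => c; rewrite /w /upd; do 2?case: eqP => [->|_].
rewrite -{2}wv Fw opprK; congr F; apply/funext => c; rewrite /w /upd /=.
case: tpermP => [->|->|/eqP/negPf ck /eqP/negPf cl].
- by rewrite (negPf kl) eqxx.
- by rewrite eqxx.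
- by rewrite ck cl.
Qed.

Lemma alternating_perm (W : lmodType R) (F : ('I_g -> V) -> W) v (s : 'S_g) :
  alternating_multilinear F -> F (v \o s) = (-1) ^+ s *: F v.
Proof.
move=> aF; have [ts -> /=] := prod_tpermP s.
elim: ts v => [|t ts IH] v /=.
  rewrite big_nil odd_perm1 scale1r => _; congr F.
  by apply/funext => c /=; rewrite perm1.
case/andP=> dt dts; rewrite big_cons odd_permM odd_tperm dt signr_addb.
rewrite expr1 mulN1r scaleNr -IH // -(alternating_tperm _ aF dt).
by congr F; apply/funext => c /=; rewrite permM.
Qed.

Definition reindex_idx (s : 'S_g) (i : {ffun 'I_g -> Omega}) :
  {ffun 'I_g -> Omega} := [ffun a => i (s a)].

Lemma reindex_idxK s : cancel (reindex_idx s) (reindex_idx s^-1%g).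
Proof. by move=> i; apply/ffunP => a; rewrite !ffunE permKV. Qed.

Lemma reindex_idxKV s : cancel (reindex_idx s^-1%g) (reindex_idx s).
Proof. by move=> i; apply/ffunP => a; rewrite !ffunE permK. Qed.

Lemma multilinear_expand (W : lmodType R) (F : ('I_g -> V) -> W) v :
  multilinear F ->
  F v = \sum_(i : {ffun 'I_g -> Omega})
          (\prod_a (v a (i a) : R)) *: F (nu \o i).
Proof.
move=> mF.
pose F' w := \sum_(i : {ffun 'I_g -> Omega})
  (\prod_a (w a (i a) : R)) *: F (nu \o i).
suff : F =1 F' by move=> ->.
apply: multilinear_eq => // [w k a x y|i].
  rewrite /F' scaler_sumr -big_split /=; apply: eq_bigr => i _.
  rewrite scalerA -scalerDl; congr (_ *: _).
  have E z : \prod_b (upd w k z b (i b) : R) =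
      (z (i k) : R) * \prod_(b | b != k) (w b (i b) : R).
    rewrite (bigD1 k) //= /upd eqxx; congr (_ * _).
    by apply: eq_bigr => b /negPf ->.
  by rewrite !E !ffunE mulrA -mulrDl.
rewrite /F' (bigD1 i) //= big1 ?scale1r => [|a _]; last by rewrite ffunE eqxx.
rewrite big1 ?addr0 // => j ji.
have [a ja] : exists a, j a != i a.
  apply/existsP; apply: contraNT ji; rewrite negb_exists => /forallP ji.
  by apply/eqP/ffunP => a; apply/eqP; have := ji a; rewrite negbK.
by rewrite (bigD1 a) //= ffunE (negPf ja) mul0r scale0r.
Qed.

Theorem wedge_universal (W : lmodType R) (F : ('I_g -> V) -> W) :
  alternating_multilinear F ->
  exists h : {linear tens -> W}, forall v, h (wedge v) = F v.
Proof.
move=> aF; have [mF _] := aF.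
pose h (t : tens) : W := (g`!%:R)^-1 *:
  \sum_(i : {ffun 'I_g -> Omega}) (t i : R) *: F (nu \o i).
have hlin : linear h.
  move=> a x y; rewrite /h scalerA mulrC -scalerA -scalerDr; congr (_ *: _).
  rewrite scaler_sumr -big_split /=; apply: eq_bigr => i _.
  by rewrite !ffunE scalerA -scalerDl.
exists (HB.pack_for {linear tens -> W} h (GRing.isLinear.Build R tens W _ h hlin)).
move=> v /=.
suff H (s : 'S_g) : \sum_(i : {ffun 'I_g -> Omega})
    ((-1) ^+ s * \prod_a (v a (i (s a)) : R)) *: F (nu \o i) = F v.
  rewrite /h (eq_bigr (fun i : {ffun 'I_g -> Omega} => \sum_(s : 'S_g)
    ((-1) ^+ s * \prod_a (v a (i (s a)) : R)) *: F (nu \o i))) => [|i _].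
    rewrite exchange_big /= (eq_bigr (fun=> F v)) // sumr_const.
    rewrite card_Sn -scaler_nat scalerA mulVf ?scale1r //.
    by rewrite pnatr_eq0 -lt0n fact_gt0.
  rewrite ffunE /determinant scaler_suml; apply: eq_bigr => s _.
  by congr (_ * _ *: _); apply: eq_bigr => a _; rewrite mxE.
rewrite (reindex (reindex_idx s^-1%g)) /=; last first.
  exact/onW_bij/(Bijective (reindex_idxKV s))/reindex_idxK.
rewrite [RHS](multilinear_expand _ mF); apply: eq_bigr => i _.
have -> : (nu : Omega -> V) \o reindex_idx s^-1%g i = ((nu : Omega -> V) \o i) \o s^-1%g.
  by apply: funext => a /=; rewrite ffunE.
rewrite (alternating_perm _ _ aF) odd_permV scalerA mulrAC -signr_addb addbb.
rewrite mul1r; congr (_ *: _); apply: eq_bigr => a _.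
by rewrite ffunE permK.
Qed.

Theorem extmap_wedge (f : {linear V -> V}) v :
  extmap f (wedge v) = wedge (f \o v).
Proof.
apply/ffunP => l; rewrite !ffunE /determinant.
under eq_bigr => j _ do rewrite ffunE /determinant mulr_sumr.
rewrite exchange_big /=; apply: eq_bigr => s _.
rewrite (reindex (reindex_idx s^-1%g)) /=; last first.
  exact/onW_bij/(Bijective (reindex_idxKV s))/reindex_idxK.
transitivity ((-1) ^+ s * \sum_(j : {ffun 'I_g -> Omega})
    \prod_a ((v a (j a) : R) * (f (nu (j a)) (l (s a)) : R))).
  rewrite mulr_sumr; apply: eq_bigr => j _.
  rewrite mulrCA; congr (_ * _).
  rewrite (reindex_inj (@perm_inj _ s)) /= -big_split /=; apply: eq_bigr => a _.
  by rewrite mxE !ffunE permK mulrC.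
rewrite -(bigA_distr_bigA
  (fun a x => (v a x : R) * (f (nu x) (l (s a)) : R))) /=; congr (_ * _); apply: eq_bigr => a _.
rewrite mxE /= {2}[v a]euclid_sum_nu linear_sum sum_ffunE.
by apply: eq_bigr => x _; rewrite linearZ /= ffunE.
Qed.

End Exterior.

Definition rat_subspace (R : realType) (U : lmodType R) (H : set U) : Prop :=
  H 0 /\ forall (q : rat) x y, H x -> H y -> H (ratr q *: x + y).

Definition rat_span (R : realType) (U : lmodType R) (A : set U) : set U :=
  smallest (@rat_subspace R U) A.

Definition rat_line (R : realType) (U : lmodType R) (H : set U) : Prop :=
  exists2 x, x != 0 & H = rat_span [set x].

(* Lambda^g Leech (x) Q, as the Q-span in Lambda^g (R Omega) of the wedges of
   g lattice vectors. *)
Definition ext_leech (R : realType) (Omega : finType)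
    (G : {vspace {ffun Omega -> ('F_2)^o}}) (g : nat) : set (tensors R Omega g) :=
  rat_span [set wedge v | v in [set v | forall k : 'I_g, leech R G (v k)]].
Arguments ext_leech R {Omega} G g.

Definition ext_leech_invariants (R : realType) (Omega : finType)
    (G : {vspace {ffun Omega -> ('F_2)^o}}) (g : nat) : set (tensors R Omega g) :=
  [set x | ext_leech R G g x /\ forall f, O_Leech R G f -> extmap f x = x].
Arguments ext_leech_invariants R {Omega} G g.

Definition numbering (Omega : finType) (g : nat) (C : {set Omega})
    (c : 'I_g -> Omega) : Prop :=
  injective c /\ [set c k | k : 'I_g]%SET = C.

Definition beta (R : realType) (Omega : finType) (g : nat) (c : 'I_g -> Omega) :
  tensors R Omega g := wedge (nu \o c).
Arguments beta R {Omega g} c.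

(* sigma_C, for the numbering c of C and the system T of representatives of
   M24 / G_C. *)
Definition sigma (R : realType) (Omega : finType) (g : nat)
    (c : 'I_g -> Omega) (T : {set {perm Omega}}) : tensors R Omega g :=
  \sum_(s in T) extmap (perm_euclid s) (beta R c).
Arguments sigma R {Omega g} c T.

Lemma sigma_set0 (R : realType) (Omega : finType)
    (G : {vspace {ffun Omega -> ('F_2)^o}}) (c : 'I_0 -> Omega)
    (T : {set {perm Omega}}) :
  coset_representatives G (finset.set0 : {set Omega}) T -> sigma R c T = [ffun => 1].
Proof.
move=> /card_transversal cT.
have stab0 : stabM24 G (finset.set0 : {set Omega}) = M24 G.
  rewrite /stabM24; apply/finset.setIidPl/fintype.subsetP => s _.
  by rewrite !inE finset.sub0set.
have T1 : #|T| = 1%N.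
  by rewrite cT stab0; exact: (indexgg 'N(_ | 'P^*)%G).
apply/ffunP => i; rewrite /sigma sum_ffunE.
rewrite (eq_bigr (fun=> 1)) ?sumr_const ?T1 ?ffunE // => s _.
by rewrite extmap_wedge ffunE det_mx00.
Qed.

(* Main.v *)
From HB Require Import structures.
From Stdlib Require Import ZArith.
Require Import Defs.
From mathcomp Require Import all_boot all_order all_algebra all_fingroup.
From mathcomp Require Import all_classical all_reals.
From mathcomp Require Import ssrZ zify ring.
Set Implicit Arguments.
Unset Strict Implicit.
Unset Printing Implicit Defensive.
Import Order.TTheory GRing.Theory Num.Theory.
Local Open Scope classical_set_scope.
Local Open Scope ring_scope.

(** The line is spanned by one multivector.  The Golay code lifts to the Clifford
    algebra of R Omega: as its words have weights divisible by 4 and meet evenly,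
    the products of basis vectors along the codewords commute and can be given
    signs making C |-> e_C multiplicative.  Let t be the sum of these signed
    wedges beta_C over the codewords of weight g (golay_tensor).  The isometries
    of the Leech lattice fix t, invariants are determined by a single coordinate,
    and sigma_C is t up to sign.

    Invariance of t.  Sign changes on codewords fix t because the code is
    isotropic (sign_tensor).  Elements of M24 fix t because M24 is generated,
    as a sifting argument shows, by ten permutations that do (M24_tensor).
    Conway's further isometry xi, a sign change on a tetrad followed by the
    reflections in the six tetrads of a sextet, also fixes t (xi_tensor).  The
    last two facts are finite computations on multivectors, made in fixed
    coordinates; they apply to an arbitrary Golay code because such a code is
    unique up to relabelling (golay_labelling_exists), which follows from the
    uniqueness of the biplane on eleven points.

    Instead of quoting that these isometries generate O(Leech), a descent
    is used: an isometry f sends sqrt 8 nu_0 to a lattice vector of norm 8,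
    and among its images under the maps above one of largest coordinate must
    lie on a coordinate axis (reach_axis).  An isometry preserving the lattice
    and sending one axis to an axis permutes all of them up to signs, and the
    congruences defining the lattice then show that it is a sign change on a
    codeword composed with an element of M24 (leech_signed_perm).  Hence f
    fixes t (O_Leech_tensor).

    Conversely, an invariant under sign changes is supported on codewords, as
    the code is its own dual; as M24 is transitive on the codewords of weight g
    (M24_transitive), it is a multiple of t, and the factor is rational because
    coordinates of wedges of an even number of lattice vectors are rational
    (invariants_line).  The same comparison of coordinates identifies sigma_C
    with t up to sign (sigma_tensor). *)

(** * Wedges of lists of vectors *)

Section WedgeSeq.
Context {R : realType} {Omega : finType}.
Local Notation V := (euclid R Omega).
Local Notation tens g := (tensors R Omega g).

(** Lists let the factors of a wedge be spliced by concatenation.  The value 0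
    on lists of another length lets one sum over words of all weights stand for
    its part of degree g. *)
Definition wedge_seq g (l : seq V) : tens g :=
  if size l == g then wedge (fun a : 'I_g => nth 0 l a) else 0.

Lemma wedge_seq_lin g (a : R) (x y : V) (l1 l2 : seq V) :
  wedge_seq g (l1 ++ (a *: x + y) :: l2) =
  a *: wedge_seq g (l1 ++ x :: l2) + wedge_seq g (l1 ++ y :: l2).
Proof.
rewrite /wedge_seq !size_cat /=; case: eqP => [sg|]; last by rewrite scaler0 addr0.
have lg : (size l1 < g)%N by rewrite -sg addnS ltnS leq_addr.
have E z : (fun a : 'I_g => nth 0 (l1 ++ z :: l2) a)
    = upd (fun a : 'I_g => nth 0 (l1 ++ (0 : V) :: l2) a) (Ordinal lg) z.
  apply: funext => b; rewrite /upd !nth_cat; case: eqP => [->/=|bk].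
    by rewrite ltnn subnn.
  case: ltnP => // lb; have : (b : nat) <> size l1 by move=> e; apply: bk; apply: val_inj.
  by move/eqP; rewrite eqn_leq lb andbT -ltnNge -subn_gt0; case: (b - _)%N.
have [mW _] := @wedge_alternating_multilinear R Omega g.
rewrite (E (a *: x + y)) (E x) (E y); exact: (mW _ (Ordinal lg) a x y).
Qed.

Lemma wedge_seqD g (x y : V) (l1 l2 : seq V) :
  wedge_seq g (l1 ++ (x + y) :: l2) =
  wedge_seq g (l1 ++ x :: l2) + wedge_seq g (l1 ++ y :: l2).
Proof. by rewrite -[x in LHS]scale1r wedge_seq_lin scale1r. Qed.

Lemma wedge_seq0 g (l1 l2 : seq V) : wedge_seq g (l1 ++ 0 :: l2) = 0.
Proof.
have := wedge_seqD g 0 0 l1 l2; rewrite addr0 => /eqP.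
by rewrite -subr_eq subrr eq_sym => /eqP.
Qed.

Lemma wedge_seqZ g (a : R) (x : V) (l1 l2 : seq V) :
  wedge_seq g (l1 ++ (a *: x) :: l2) = a *: wedge_seq g (l1 ++ x :: l2).
Proof. by rewrite -[a *: x]addr0 wedge_seq_lin wedge_seq0 addr0. Qed.

Lemma wedge_seq_sum g I (r : seq I) (x : I -> V) (l1 l2 : seq V) :
  wedge_seq g (l1 ++ (\sum_(i <- r) x i) :: l2) =
  \sum_(i <- r) wedge_seq g (l1 ++ x i :: l2).
Proof.
elim: r => [|i r IH]; first by rewrite !big_nil wedge_seq0.
by rewrite !big_cons wedge_seqD IH.
Qed.

Lemma wedge_seq_dup g (x : V) (l1 l2 l3 : seq V) :
  wedge_seq g (l1 ++ x :: l2 ++ x :: l3) = 0.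
Proof.
rewrite /wedge_seq !size_cat /= size_cat /=; case: eqP => // sg.
have kg : (size l1 < g)%N by lia.
have lg : (size l1 + (size l2).+1 < g)%N by lia.
have [_ aW] := @wedge_alternating_multilinear R Omega g.
apply: (aW _ (Ordinal kg) (Ordinal lg)); first by apply/eqP => -[]; lia.
rewrite [LHS]nth_cat /= ltnn subnn [RHS]nth_cat /= ltnNge leq_addr /= addKn.
by rewrite /= nth_cat ltnn subnn.
Qed.

Lemma wedge_seq_swap g (x y : V) (l1 l2 : seq V) :
  wedge_seq g (l1 ++ x :: y :: l2) = - wedge_seq g (l1 ++ y :: x :: l2).
Proof.
have := wedge_seq_dup g (x + y) l1 [::] l2.
rewrite /= wedge_seqD -(cat_rcons x) -(cat_rcons y) !wedge_seqD !cat_rcons.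
have dup z := wedge_seq_dup g z l1 [::] l2.
by rewrite !dup add0r addr0 => /eqP; rewrite addr_eq0 => /eqP.
Qed.

Lemma extmap_wedge_seq g (f : {linear V -> V}) (l : seq V) :
  extmap f (wedge_seq g l) = wedge_seq g (map f l).
Proof.
rewrite /wedge_seq size_map; case: eqP => [sl|_]; last first.
  by apply/ffunP => i; rewrite !ffunE big1 // => j _; rewrite ffunE mulr0.
rewrite extmap_wedge; congr wedge; apply: funext => a /=.
by rewrite (nth_map 0) ?sl.
Qed.

Lemma extmap_is_linear g (f : {linear V -> V}) : linear (@extmap R Omega g f).
Proof.
move=> a x y; apply/ffunP => i; rewrite !ffunE.
rewrite (big_morph _ (scalerDr a) (scaler0 _ a)) -big_split /=.
apply: eq_bigr => j _; rewrite !ffunE mulrDr; congr (_ + _).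
by rewrite /GRing.scale /= mulrCA.
Qed.
HB.instance Definition _ g f := GRing.isLinear.Build R (tens g) (tens g) _
  (@extmap R Omega g f) (extmap_is_linear f).

End WedgeSeq.

(** * Multivectors as binary tries *)

(** A set of positions is coded by its indicator list, a key.  Wedging the i-th
    basis vector in front of an increasing wedge gives 0 if i is present, and
    otherwise the increasing wedge up to the parity of the number of present
    positions below i. *)
Fixpoint ins_key (i : nat) (k : bitseq) : option (bool * bitseq) :=
  match k, i with
  | [::], _ => None
  | b :: k', 0 => if b then None else Some (false, true :: k')
  | b :: k', i'.+1 =>
      if ins_key i' k' is Some (s, r) then Some (b (+) s, b :: r) else None
  end.

Fixpoint norm_key (n : nat) (l : seq nat) : option (bool * bitseq) :=
  if l is i :: l' then
    if norm_key n l' is Some (s, k) then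
      if ins_key i k is Some (s', k') then Some (s' (+) s, k') else None
    else None
  else Some (false, nseq n false).

(** A multivector on n basis vectors is a trie of depth n: branching right at
    level i means that the i-th vector is present, and the leaves are the
    coefficients.  A map that only involves the vectors of a few consecutive
    positions acts on the corresponding levels, whatever lies above and below.
    The empty subtrie keeps sparse multivectors small. *)
Inductive node (A : Type) := Void | Fork of A & A.
Arguments Void {A}.

Fixpoint trie (n : nat) : Type := if n is m.+1 then node (trie m) else Z.

Definition trie0 n : trie n := match n with 0 => Z0 | _ => Void end.

Fixpoint trie_add n : trie n -> trie n -> trie n :=
  match n with
  | 0 => Z.add
  | m.+1 => fun t u => match t, u with
      | Void, _ => u
      | _, Void => t
      | Fork l r, Fork l' r' => Fork (trie_add l l') (trie_add r r')
      end
  end.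

Fixpoint trie_scale n (c : Z) : trie n -> trie n :=
  match n with
  | 0 => Z.mul c
  | m.+1 => fun t => if t is Fork l r then Fork (trie_scale c l) (trie_scale c r)
                     else Void
  end.

Fixpoint trie_all0 n : trie n -> bool :=
  match n with
  | 0 => Z.eqb 0
  | m.+1 => fun t => if t is Fork l r then trie_all0 l && trie_all0 r else true
  end.

Definition trie_void n : trie n -> bool :=
  match n with 0 => Z.eqb 0 | m.+1 => fun t => if t is Void then true else false end.

Fixpoint trie_single n (k : bitseq) (c : Z) : trie n :=
  match n with
  | 0 => c
  | m.+1 => let u := trie_single m (behead k) c in
            if head false k then Fork (trie0 m) u else Fork u (trie0 m)
  end.

Fixpoint trie_put d n (k : bitseq) (t : trie n) : trie (d + n) :=
  match d with
  | 0 => t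
  | d'.+1 => let u := trie_put d' (behead k) t in
             if head false k then Fork (trie0 _) u else Fork u (trie0 _)
  end.

Fixpoint trie_get d n (k : bitseq) : trie (d + n) -> trie n :=
  match d with
  | 0 => id
  | d'.+1 => fun t => if t is Fork l r
      then trie_get (behead k) (if head false k then r else l) else trie0 n
  end.

Fixpoint trie_at d n (f : trie n -> trie n) : trie (d + n) -> trie (d + n) :=
  match d with
  | 0 => f
  | d'.+1 => fun t =>
      if t is Fork l r then Fork (trie_at f l) (trie_at f r) else Void
  end.

Fixpoint trie_sign d n : trie (d + n) -> trie (d + n) :=
  match d return trie (d + n) -> trie (d + n) with
  | 0 => id
  | d'.+1 => fun t => if t is Fork l r
      then Fork (trie_sign l) (trie_scale (Zneg xH) (trie_sign r)) else Void
  end.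

Fixpoint all_keys d : seq bitseq :=
  if d is d'.+1 then map (cons false) (all_keys d') ++ map (cons true) (all_keys d')
  else [:: [::]].

Definition sgz (b : bool) : Z := if b then Zneg xH else Zpos xH.

(** Twice the reflection in the vector u = nu_0 + nu_1 + nu_2 + nu_3 of norm 4,
    applied to the wedge of the nu_i for i in k.  It replaces nu_i by nu_i - u/2
    in each factor, and the products with two factors u vanish.  The terms
    where u is replaced by the removed vector itself give back k, whence the
    coefficient 2 - size l in front; doubling makes everything integral. *)
Definition refl_terms (k : bitseq) : seq (Z * bitseq) :=
  let l := mask k [:: 0; 1; 2; 3]%N in
  (Z.sub (Zpos (xO xH)) (Z.of_nat (size l)), k) :: flatten [seq pmap (fun y =>
     omap (fun p => (sgz (~~ p.1), p.2)) (norm_key 4 (take j l ++ y :: drop j.+1 l)))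
     [seq y <- [:: 0; 1; 2; 3]%N | y != nth 0%N l j] | j <- iota 0 (size l)].

Definition trie_sum n (T : Type) (f : T -> trie n) (s : seq T) : trie n :=
  foldr (fun x acc => trie_add (f x) acc) (trie0 n) s.

(** The reflection inside a block is tabulated once, on its 16 keys, and
    then applied to whole subtries. *)
Definition refl_table : seq (bitseq * seq (Z * bitseq)) := Eval vm_compute in
  [seq (k, [seq q <- refl_terms k | ~~ Z.eqb q.1 Z0]) | k <- all_keys 4].

Definition trie_refl n (t : trie (4 + n)) : trie (4 + n) :=
  trie_sum (fun p : bitseq * seq (Z * bitseq) =>
      let u := trie_get p.1 t in
      if trie_void u then trie0 _
      else trie_sum (fun q : Z * bitseq => trie_put 4 q.2 (trie_scale q.1 u)) p.2)
    refl_table.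

Section Eval.
Context {R : realType}.

Definition zr (z : Z) : R := (int_of_Z z)%:~R.

Lemma zrD a b : zr (Z.add a b) = zr a + zr b.
Proof. by rewrite /zr -intrD -rmorphD. Qed.
Lemma zrM a b : zr (Z.mul a b) = zr a * zr b.
Proof. by rewrite /zr -intrM -rmorphM. Qed.
Lemma zr_sgz b : zr (sgz b) = (-1) ^+ b.
Proof. by case: b. Qed.

Context {W : lmodType R}.
Implicit Type F : bitseq -> W.

(** The linear map from tries sending the key k to F k.  All computations are
    made on tries and transported by this map. *)
Fixpoint ev n F : trie n -> W :=
  match n with
  | 0 => fun z => zr z *: F [::]
  | m.+1 => fun t => if t is Fork l r
      then ev (F \o cons false) l + ev (F \o cons true) r else 0
  end.

Lemma ev0 n F : ev F (trie0 n) = 0.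
Proof. by case: n => //=; rewrite scale0r. Qed.

Lemma ev_add n F (t u : trie n) : ev F (trie_add t u) = ev F t + ev F u.
Proof.
elim: n F t u => [|n IH] F /=; first by move=> t u; rewrite zrD scalerDl.
by move=> [|l r] [|l' r'] /=; rewrite ?add0r ?addr0 // !IH addrACA.
Qed.

Lemma ev_scale n F c (t : trie n) : ev F (trie_scale c t) = zr c *: ev F t.
Proof.
elim: n F t => [|n IH] F /=; first by move=> t; rewrite zrM scalerA.
by move=> [|l r] /=; rewrite ?scaler0 // !IH scalerDr.
Qed.

Lemma ev_all0 n F (t : trie n) : trie_all0 t -> ev F t = 0.
Proof.
elim: n F t => [|n IH] F /=; first by case=> //=; rewrite scale0r.
by move=> [|l r] //= /andP[/IH-> /IH->]; rewrite addr0.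
Qed.

Lemma ev_void n F (t : trie n) : trie_void t -> ev F t = 0.
Proof. by case: n t => [|n] /=; case=> //=; rewrite scale0r. Qed.

Lemma ev_sum n F (T : Type) (f : T -> trie n) s :
  ev F (trie_sum f s) = \sum_(x <- s) ev F (f x).
Proof.
elim: s => [|x s IH] /=; first by rewrite ev0 big_nil.
by rewrite ev_add IH big_cons.
Qed.

Lemma ev_single n F k c : size k = n -> ev F (trie_single n k c) = zr c *: F k.
Proof.
elim: n F k => [|n IH] F [|b k] //= [sk].
by case: b => /=; rewrite ev0 ?add0r ?addr0 IH.
Qed.

Lemma ev_put d n F k (t : trie n) : size k = d ->
  ev F (trie_put d k t) = ev (fun r => F (k ++ r)) t.
Proof.
elim: d F k => [|d IH] F [|b k] //= [sk].
by case: b => /=; rewrite ev0 ?add0r ?addr0 IH.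
Qed.

Lemma ev_get d n F (t : trie (d + n)) :
  ev F t = \sum_(k <- all_keys d) ev (fun r => F (k ++ r)) (trie_get k t).
Proof.
elim: d F t => [|d IH] F t /=; first by rewrite big_seq1.
rewrite big_cat !big_map /=; case: t => [|l r] /=.
  by rewrite !big1 ?addr0 // => k _; rewrite ev0.
by rewrite !IH.
Qed.

Lemma ev_at d n F (A : {linear W -> W}) (a : R) (f : trie n -> trie n) (t : trie (d + n)) :
  (forall k u, size k = d ->
     ev (fun r => F (k ++ r)) (f u) = a *: A (ev (fun r => F (k ++ r)) u)) ->
  ev F (trie_at f t) = a *: A (ev F t).
Proof.
elim: d F t => [|d IH] F t /= fA; first exact: (fA [::]).
case: t => [|l r] /=; first by rewrite linear0 scaler0.
rewrite linearD scalerDr; congr (_ + _); apply: IH => k u sk.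
  by apply: (fA (false :: k)); rewrite /= sk.
by apply: (fA (true :: k)); rewrite /= sk.
Qed.

Lemma ev_sign d n F (t : trie (d + n)) :
  ev F (trie_sign t) = ev (fun k => (-1) ^+ odd (count id (take d k)) *: F k) t.
Proof.
elim: d F t => [|d IH] F t /=.
  congr (ev _ t); apply: funext => k.
  by rewrite take0 scale1r.
case: t => [|l r] //=; rewrite ev_scale !IH; congr (_ + _).
rewrite -[Zneg xH]/(sgz true) zr_sgz expr1.
have scale_ev m (c : R) G (u : trie m) : c *: ev G u = ev (fun k => c *: G k) u.
  elim: m G u => [|m IHm] G /=; first by move=> u; rewrite !scalerA mulrC.
  by case=> [|x y]; rewrite ?scaler0 // scalerDr !IHm.
rewrite scale_ev; congr (ev _ r); apply: funext => k /=.
by rewrite /= add0n; case: (odd _); rewrite /= ?expr1 ?expr0 ?scaleN1r ?scale1r ?opprK.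
Qed.

(** An identity checked on every key extends to all tries by linearity. *)
Lemma ev_lin n (I : Type) (qs : seq I) (c : I -> R) (a : R) (A : {linear W -> W})
    (G : bitseq -> W) (H : I -> bitseq -> W) (u : trie n) :
  (forall r, size r = n -> a *: A (G r) = \sum_(q <- qs) c q *: H q r) ->
  a *: A (ev G u) = \sum_(q <- qs) c q *: ev (H q) u.
Proof.
elim: n G H u => [|n IH] G H /=.
  move=> z AG; rewrite linearZ /= scalerA mulrC -scalerA AG // scaler_sumr.
  by apply: eq_bigr => q _; rewrite !scalerA mulrC.
case=> [|l r] AG; first by rewrite linear0 scaler0 big1 // => q _; rewrite scaler0.
rewrite linearD scalerDr (IH _ (fun q => H q \o cons false)); last first.
  by move=> x sx; apply: AG; rewrite /= sx.
rewrite (IH _ (fun q => H q \o cons true)); last first.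
  by move=> x sx; apply: AG; rewrite /= sx.
by rewrite -big_split; apply: eq_bigr => q _; rewrite scalerDr.
Qed.

Lemma size_all_keys d k : k \in all_keys d -> size k = d.
Proof.
elim: d k => [|d IH] k /=; first by rewrite inE => /eqP->.
by rewrite mem_cat => /orP[] /mapP[k' /IH <- ->].
Qed.

Arguments ev : simpl never.
Arguments trie_get : simpl never.
Arguments trie_put : simpl never.
Arguments trie_sum : simpl never.

Lemma ev_refl n F (A : {linear W -> W}) (t : trie (4 + n)) :
  (forall k r, size k = 4%N -> size r = n ->
    2 *: A (F (k ++ r)) = \sum_(q <- refl_terms k) zr q.1 *: F (q.2 ++ r)) ->
  ev F (trie_refl t) = 2 *: A (ev F t).
Proof.
move=> FA; rewrite ev_sum.
have -> : refl_table = [seq (k, [seq q <- refl_terms k | ~~ Z.eqb q.1 Z0]) | k <- all_keys 4].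
  by vm_compute.
rewrite big_map (ev_get F t) linear_sum scaler_sumr big_seq [RHS]big_seq.
apply: eq_bigr => k k4; have sk := size_all_keys k4; cbn [fst snd].
case: ifP => [/ev_void-> | _]; first by rewrite linear0 scaler0 ?ev0.
rewrite (@ev_lin _ _ (refl_terms k) (fun q => zr q.1) _ _ _
  (fun q r => F (q.2 ++ r))) => [|r sr]; last exact: FA.
rewrite ev_sum big_filter big_mkcond big_seq [RHS]big_seq; apply: eq_bigr => q qk.
case: Z.eqb_spec => [-> | _] /=; first by rewrite scale0r.
rewrite ev_put ?ev_scale //.
have : all (fun k => all (fun q => size q.2 == 4) (refl_terms k)) (all_keys 4) by [].
by move=> /allP/(_ k k4)/allP/(_ q qk)/eqP.
Qed.
End Eval.

Section Normal.
Context {R : realType} {Omega : finType} (g : nat).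
Local Notation V := (euclid R Omega).
Implicit Type ps : seq V.

Lemma ins_key_size i k s k' : ins_key i k = Some (s, k') -> size k' = size k.
Proof.
elim: k i s k' => [|b k IH] [|i] //= s k'; first by case: b => // -[_ <-].
by case E: (ins_key i k) => [[s1 k1]|] // [_ <-] /=; rewrite (IH _ _ _ E).
Qed.

Lemma norm_key_size n l s k : norm_key n l = Some (s, k) -> size k = n.
Proof.
elim: l s k => [|i l IH] s k /=; first by case=> _ <-; rewrite size_nseq.
case E: (norm_key n l) => [[s1 k1]|] //.
by case E': (ins_key i k1) => [[s2 k2]|] // [_ <-]; rewrite (ins_key_size E') (IH _ _ E).
Qed.

(** Moving the new factor rightwards to its place costs one sign for each factor
    that it crosses. *)
Lemma wedge_seq_ins ps i k (l1 l2 : seq V) : size k = size ps -> (i < size ps)%N ->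
  wedge_seq g (l1 ++ nth 0 ps i :: mask k ps ++ l2) =
  if ins_key i k is Some (s, k') then (-1) ^+ s *: wedge_seq g (l1 ++ mask k' ps ++ l2)
  else 0.
Proof.
elim: k ps i l1 => [|b k IH] [|p ps] // i l1 [sk]; case: i => [_|i ip] /=.
  case: b => /=; last by rewrite scale1r.
  exact: (wedge_seq_dup g p l1 [::]).
have {IH} := IH ps i _ sk ip.
case: b => /= IH; last by rewrite IH; case: (ins_key i k) => [[]|].
rewrite wedge_seq_swap -cat_rcons IH.
case: (ins_key i k) => [[s k']|]; last by rewrite oppr0.
by rewrite cat_rcons -scaleNr; case: s; rewrite /= ?expr0 ?expr1 ?opprK.
Qed.

Lemma wedge_seq_norm ps l (l1 l2 : seq V) : all (gtn (size ps)) l ->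
  wedge_seq g (l1 ++ [seq nth 0 ps i | i <- l] ++ l2) =
  if norm_key (size ps) l is Some (s, k)
  then (-1) ^+ s *: wedge_seq g (l1 ++ mask k ps ++ l2) else 0.
Proof.
elim: l l1 => [|i l IH] l1 /=; first by rewrite mask_false scale1r.
move=> /andP[ip lp]; rewrite -cat_rcons IH //.
case E: (norm_key _ l) => [[s k]|] //; have sk := norm_key_size E.
rewrite cat_rcons wedge_seq_ins //; case: (ins_key i k) => [[s' k']|]; last by rewrite scaler0.
by rewrite scalerA -signr_addb addbC.
Qed.

(** Only the terms with at most one factor u survive, as u wedge u = 0. *)
Lemma wedge_seq_transvection (a : V -> R) (u : V) (l l1 l2 : seq V) :
  wedge_seq g (l1 ++ [seq x - a x *: u | x <- l] ++ l2) =
  wedge_seq g (l1 ++ l ++ l2) -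
  \sum_(j <- iota 0 (size l))
     a (nth 0 l j) *: wedge_seq g (l1 ++ (take j l ++ u :: drop j.+1 l) ++ l2).
Proof.
have absorb (l' m1 m2 : seq V) :
    wedge_seq g (m1 ++ u :: [seq x - a x *: u | x <- l'] ++ m2) =
    wedge_seq g (m1 ++ u :: l' ++ m2).
  elim: l' m1 => [|x l' IH] m1 //=.
  rewrite -cat_rcons addrC -scaleNr wedge_seq_lin !cat_rcons.
  rewrite (wedge_seq_dup g u m1 [::]) scaler0 add0r.
  by rewrite [LHS]wedge_seq_swap -[m1 ++ x :: _]cat_rcons IH cat_rcons -wedge_seq_swap.
elim: l l1 => [|x l IH] l1 /=; first by rewrite big_nil subr0.
rewrite addrC -scaleNr wedge_seq_lin absorb -[l1 ++ x :: map _ _ ++ _]cat_rcons IH.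
rewrite cat_rcons.
rewrite big_cons /= drop0 scaleNr opprD [RHS]addrCA; congr (_ + (_ - _)).
rewrite -[1%N]addn0 iotaDl big_map; apply: eq_bigr => j _ /=.
by rewrite cat_rcons.
Qed.
End Normal.

(** * A Golay code in coordinates *)

Section Coordinates.
Local Open Scope nat_scope.

Definition key_of (l : seq nat) : bitseq := [seq i \in l | i <- iota 0 24].

(** The blocks {4k, ..., 4k+3} form a sextet: the union of any two of them is a
    codeword, so the first five basis words are the unions of the first block
    with each of the others.  The sign in front of a word chooses one of the
    two orientations of its wedge, in such a way that the multivector below
    is fixed by M24 and by the map xi. *)
Definition golay_basis : seq (bool * bitseq) := Eval vm_compute in
  [seq (p.1, key_of p.2) | p <- [::
    (false, [:: 0; 1; 2; 3; 4; 5; 6; 7]);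
    (false, [:: 0; 1; 2; 3; 8; 9; 10; 11]);
    (false, [:: 0; 1; 2; 3; 12; 13; 14; 15]);
    (false, [:: 0; 1; 2; 3; 16; 17; 18; 19]);
    (true,  [:: 0; 1; 2; 3; 20; 21; 22; 23]);
    (true,  [:: 0; 1; 2; 4; 8; 12; 16; 20]);
    (true,  [:: 0; 1; 2; 4; 9; 14; 19; 21]);
    (true,  [:: 0; 1; 2; 4; 10; 15; 17; 23]);
    (true,  [:: 0; 1; 2; 5; 8; 13; 17; 21]);
    (true,  [:: 0; 1; 2; 6; 8; 14; 18; 23]);
    (false, [:: 0; 1; 3; 4; 8; 15; 18; 21]);
    (true,  [:: 0; 2; 3; 4; 8; 13; 19; 23])]].

Fixpoint xor_key (a b : bitseq) : bitseq :=
  match a, b with x :: a', y :: b' => x (+) y :: xor_key a' b' | _, _ => [::] end.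

(** The sign of e_a e_b = +- e_(a+b) in the Clifford algebra of an orthonormal
    basis with e_i e_i = 1: it counts the pairs i in a, j in b with j < i. *)
Fixpoint clifford_sign (odd_before : bool) (a b : bitseq) : bool :=
  match a, b with
  | x :: a', y :: b' =>
      (x && odd_before) (+) clifford_sign (y (+) odd_before) a' b'
  | _, _ => false
  end.

Definition overlap (a b : bitseq) : nat := count id [seq x.1 && x.2 | x <- zip a b].
Definition key_even (a b : bitseq) : bool := ~~ odd (overlap a b).

(** The expansion of the product of the 1 + (+-) e_b over the basis words b.  As
    the words have weights divisible by 4 and meet evenly, the factors commute,
    so this is a multiplicative choice of signs on the whole code. *)
Definition signed_words : seq (bool * bitseq) :=
  foldr (fun b L => L ++ [seq (b.1 (+) x.1 (+) clifford_sign false b.2 x.2,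
                              xor_key b.2 x.2) | x <- L])
    [:: (false, nseq 24 false)] golay_basis.

Definition golay_words : seq bitseq := [seq x.2 | x <- signed_words].
Definition golay_octads : seq bitseq := [seq k <- golay_words | count id k == 8].

(** Membership tested by orthogonality to the basis, the code being its own
    dual; this avoids a search among the 4096 words. *)
Definition golay_test (k : bitseq) : bool :=
  (size k == 24) && all (fun b => key_even k b.2) golay_basis.

Definition golay_trie : trie 24 :=
  trie_sum (fun x => trie_single 24 x.2 (sgz x.1)) signed_words.

(** For each k, the elements i |-> q_i listed here that fix the first k points of the
    base below generate a group that moves the next point to every position
    that the octads allow. *)
Definition golay_gens : seq (seq nat) := [::
  [:: 2; 23; 9; 19; 21; 3; 16; 11; 5; 7; 15; 4; 1; 17; 20; 8; 10; 0; 22; 18; 6; 14; 13; 12];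
  [:: 0; 21; 8; 4; 17; 20; 23; 14; 15; 1; 18; 3; 10; 22; 2; 6; 11; 16; 9; 13; 7; 5; 19; 12];
  [:: 0; 1; 5; 16; 7; 18; 11; 8; 17; 6; 23; 20; 9; 12; 3; 21; 10; 14; 22; 2; 19; 4; 13; 15];
  [:: 0; 1; 2; 10; 22; 16; 14; 5; 13; 6; 20; 19; 18; 7; 12; 21; 4; 23; 15; 17; 11; 9; 8; 3];
  [:: 0; 1; 2; 3; 8; 10; 11; 9; 18; 17; 19; 16; 14; 12; 13; 15; 6; 7; 4; 5; 23; 21; 20; 22];
  [:: 0; 1; 2; 3; 4; 6; 7; 5; 23; 21; 22; 20; 10; 8; 9; 11; 17; 18; 16; 19; 15; 14; 12; 13];
  [:: 0; 1; 2; 3; 4; 5; 6; 7; 12; 14; 15; 13; 8; 11; 9; 10; 20; 23; 22; 21; 16; 19; 18; 17];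
  [:: 0; 1; 2; 3; 4; 5; 6; 7; 9; 8; 11; 10; 14; 15; 12; 13; 19; 18; 17; 16; 21; 20; 23; 22];
  [:: 0; 1; 2; 3; 4; 5; 6; 7; 11; 10; 9; 8; 13; 12; 15; 14; 18; 19; 16; 17; 22; 23; 20; 21];
  [:: 0; 1; 2; 3; 4; 5; 6; 7; 23; 22; 20; 21; 17; 19; 18; 16; 15; 12; 14; 13; 10; 11; 9; 8]
  ].

Definition pull_key (q : seq nat) (k : bitseq) : bitseq := [seq nth false k i | i <- q].

(** The last condition says that q fixes the multivector of the signed words. *)
Definition gen_check (q : seq nat) : bool :=
  [&& perm_eq q (iota 0 24),
      all (fun b => golay_test (pull_key q b.2)) golay_basis &
      trie_all0 (trie_add
        (trie_sum (fun x => if norm_key 24 (mask x.2 q) is Some (s, k)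
                            then trie_single 24 k (sgz (s (+) x.1)) else trie0 24)
           signed_words)
        (trie_scale (Zneg xH) golay_trie))].

Definition refl_at d (t : trie 24) : trie 24 :=
  match d with
  | 0 => (trie_refl (t : trie (4 + 20)) : trie 24)
  | 1 => trie_at (d := 4) (n := 20) (trie_refl (n := 16)) t
  | 2 => trie_at (d := 8) (n := 16) (trie_refl (n := 12)) t
  | 3 => trie_at (d := 12) (n := 12) (trie_refl (n := 8)) t
  | 4 => trie_at (d := 16) (n := 8) (trie_refl (n := 4)) t
  | _ => trie_at (d := 20) (n := 4) (trie_refl (n := 0)) t
  end.

(** The points 0, ..., 4 determine the octad {0, ..., 7}.  Its points 6 and 7 come last
    because the points outside that octad pin down more octads. *)
Definition sift_base : seq nat := iota 0 6 ++ iota 8 16 ++ [:: 6; 7].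
Definition fixing (P : seq nat) : seq (seq nat) :=
  [seq q <- golay_gens | all (fun i => nth 0 q i == i) P].
(** Six rounds suffice for all the orbits that are needed. *)
Definition gen_orbit (Q : seq (seq nat)) (i : nat) : seq nat :=
  iter 6 (fun S => undup (S ++ [seq nth 0 q j | q <- Q, j <- S])) [:: i].
(** An element of M24 fixing the points of P fixes each octad that has five points
    in P, as two octads sharing five points are equal.  So it can only move i
    inside the atom of i cut out by those octads. *)
Definition sift_cand (P : seq nat) (i : nat) : seq nat :=
  let Os := [seq o <- golay_octads | 5 <= count (nth false o) P] in
  [seq j <- iota 0 24 | (j \notin P) && all (fun o => nth false o j == nth false o i) Os].
Definition sift_check : bool :=
  all (fun k => let P := take k sift_base in let i := nth 0 sift_base k in
         let S := gen_orbit (fixing P) i in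
         all (fun j => j \in S) (sift_cand P i)) (iota 0 24).
Definition transitive4_check : bool :=
  all (fun k => let P := iota 0 k in let S := gen_orbit (fixing P) k in
         all (fun j => (j \in P) || (j \in S)) (iota 0 24)) (iota 0 4).

Fixpoint lex_lt (a b : bitseq) : bool :=
  match a, b with
  | x :: a', y :: b' => if x == y then lex_lt a' b' else x
  | _, _ => false
  end.
Definition golay_reps : seq bitseq := [seq key_of l | l <- 
  [:: [::]; iota 0 8; [:: 0; 1; 2; 3; 4; 5; 8; 9; 12; 15; 17; 19]; iota 0 16; iota 0 24]].
(** Words in the generators; each codeword other than the five representatives is
    made lexicographically smaller by one of them. *)
Definition descent_words : seq (seq nat) :=
  [:: [:: 0]; [:: 3; 3; 2]; [:: 4; 7; 9]; [:: 6]; [:: 7]; [:: 5; 5; 9]; [:: 6; 1; 1];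
      [:: 3; 3; 8]; [:: 1; 7; 4]; [:: 0; 6; 3]; [:: 2; 8; 1]; [:: 0; 2; 4; 3];
      [:: 0; 5; 9; 0]].
Definition pull_word (a : seq nat) (k : bitseq) : bitseq :=
  foldl (fun k i => pull_key (nth [::] golay_gens i) k) k a.
Definition descends (k : bitseq) : bool :=
  (k \in golay_reps) || has (fun a => lex_lt (pull_word a k) k) descent_words.
Definition transitive_check := all descends golay_words.
End Coordinates.

(** * Self-duality of Golay codes *)

Section Codes.
Context {Omega : finType}.
Implicit Types C D u v : {set Omega}.

Definition sdiff C D : {set Omega} := [set x | (x \in C) (+) (x \in D)]%SET.

Lemma in_sdiff C D x : (x \in sdiff C D) = (x \in C) (+) (x \in D).
Proof. by rewrite inE. Qed.

Lemma charvec_sdiff C D : charvec (sdiff C D) = charvec C + charvec D.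
Proof.
apply/ffunP => x; rewrite !ffunE in_sdiff.
by case: (x \in C); case: (x \in D) => /=; rewrite ?addr0 ?add0r //; apply: val_inj.
Qed.

Lemma charvec0 : charvec (finset.set0 : {set Omega}) = 0.
Proof. by apply/ffunP => x; rewrite !ffunE inE. Qed.

Lemma card_sdiff C D : (#|sdiff C D| + (#|C :&: D|).*2 = #|C| + #|D|)%N.
Proof.
have -> : sdiff C D = ((C :\: D) :|: (D :\: C))%SET.
  by apply/setP => x; rewrite !inE; case: (x \in C); case: (x \in D).
have := cardsUI (C :\: D)%SET (D :\: C)%SET.
have -> : ((C :\: D) :&: (D :\: C) = finset.set0)%SET.
  by apply/setP => x; rewrite !inE; case: (x \in C); case: (x \in D).
rewrite cards0; have := cardsID D C; have := cardsID C D.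
rewrite [(D :&: C)%SET]finset.setIC; lia.
Qed.

Lemma odd_setI_sdiff u C D :
  odd #|u :&: sdiff C D| = odd #|u :&: C| (+) odd #|u :&: D|.
Proof.
have -> : (u :&: sdiff C D = sdiff (u :&: C) (u :&: D))%SET.
  by apply/setP => x; rewrite !inE; case: (x \in u).
by have := congr1 odd (card_sdiff (u :&: C) (u :&: D)); rewrite !oddD odd_double addbF.
Qed.

Lemma F2_nat_eq0 n : (n%:R == 0 :> 'F_2) = ~~ odd n.
Proof. by rewrite -(dvdn_pcharf (pchar_Fp (isT : prime 2))) dvdn2. Qed.

Definition rowvec C : 'rV['F_2]_#|Omega| := \row_j ((enum_val j \in C)%:R).

Lemma rowvec_dot C D : rowvec C *m (rowvec D)^T = (#|C :&: D|%:R)%:M.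
Proof.
apply/matrixP => i j; rewrite !ord1 !mxE /= mulr1n.
under eq_bigr => x _ do rewrite !mxE -natrM mulnb -finset.in_setI.
rewrite -natr_sum; congr (_%:R).
rewrite -[RHS]sum1_card [RHS]big_mkcond /=.
rewrite [RHS](reindex (enum_val : 'I_#|Omega| -> Omega)) /=; last exact/onW_bij/enum_val_bij.
by apply: eq_bigr => x _; case: (_ \in _).
Qed.

Lemma rowvec_dot_eq0 C D : (rowvec C *m (rowvec D)^T == 0) = ~~ odd #|C :&: D|.
Proof.
rewrite rowvec_dot -F2_nat_eq0; apply/eqP/eqP => [/matrixP/(_ 0 0)|->].
  by rewrite !mxE.
by apply/matrixP => i j; rewrite !ord1 !mxE.
Qed.

Lemma rowvec_sdiff C D : rowvec (sdiff C D) = rowvec C + rowvec D.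
Proof.
apply/rowP => j; rewrite !mxE in_sdiff.
by case: (_ \in C); case: (_ \in D) => /=; rewrite ?addr0 ?add0r //; apply: val_inj.
Qed.

Lemma rowvec0 : rowvec finset.set0 = 0.
Proof. by apply/rowP => j; rewrite !mxE inE. Qed.

Lemma rowvec_inj : injective rowvec.
Proof.
move=> C D /rowP E; apply/setP => x; have := E (enum_rank x); rewrite !mxE enum_rankK.
by case: (x \in C); case: (x \in D).
Qed.

Lemma rowvec_surj (r : 'rV['F_2]_#|Omega|) : r = rowvec [set x | r 0 (enum_rank x) != 0]%SET.
Proof.
apply/rowP => j; rewrite !mxE inE enum_valK.
by case: (r 0 j) => -[|[|m]] lm //=; apply: val_inj.
Qed.

Lemma F2_scale (V : lmodType 'F_2) (a : 'F_2) (v : V) : a *: v = if a == 0 then 0 else v.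
Proof.
case: eqP => [->|]; first by rewrite scale0r.
case: a => -[|[|m]] lm // nz; first by case: nz; apply: val_inj.
by rewrite -[RHS]scale1r; congr (_ *: _); apply: val_inj.
Qed.

(** A space S of subsets is its own bidual: the columns of a cokernel of the
    matrix of S are orthogonal to S and detect every vector outside S. *)
Lemma bidual (S : {set {set Omega}}) u :
  finset.set0 \in S -> (forall C D, C \in S -> D \in S -> sdiff C D \in S) ->
  (forall v, (forall C, C \in S -> ~~ odd #|C :&: v|) -> ~~ odd #|u :&: v|) ->
  u \in S.
Proof.
move=> S0 SD uv.
pose W := \matrix_(i < #|S|) rowvec (enum_val i).
have : (rowvec u <= W)%MS.
  rewrite submxE; apply/eqP.
  apply/matrixP => i j; rewrite [i]ord1.
  have Wv : W *m col j (cokermx W) = 0.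
    by rewrite colE mulmxA mulmx_coker mul0mx.
  pose v := [set x | (col j (cokermx W))^T 0 (enum_rank x) != 0]%SET.
  have vE : (col j (cokermx W))^T = rowvec v by exact: rowvec_surj.
  have /eqP : rowvec u *m (rowvec v)^T == 0.
    rewrite rowvec_dot_eq0; apply: uv => C CS.
    rewrite -rowvec_dot_eq0 -vE trmxK; apply/eqP.
    have -> : rowvec C = row (enum_rank_in CS C) W by rewrite rowK enum_rankK_in.
    by rewrite -row_mul Wv; apply/matrixP => a b; rewrite !mxE.
  rewrite -vE trmxK colE mulmxA -colE => /matrixP/(_ 0 0).
  by rewrite [LHS]mxE [in X in _ = X]mxE => ->; rewrite mxE.
case/submxP => X; rewrite mulmx_sum_row => uX.
suff [C CS CE] : exists2 C, C \in S & \sum_i X 0 i *: row i W = rowvec C.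
  by rewrite (rowvec_inj (etrans uX CE)).
elim/big_ind: _ => [|x y [C CS ->] [D DS ->]|i _].
- by exists finset.set0; rewrite ?rowvec0.
- by exists (sdiff C D); rewrite ?rowvec_sdiff ?SD.
rewrite F2_scale; case: eqP => _; first by exists finset.set0; rewrite ?rowvec0.
by exists (enum_val i); rewrite ?enum_valP // rowK.
Qed.

Section Golay.
Variable G : {vspace {ffun Omega -> ('F_2)^o}}.
Hypothesis Omega24 : #|Omega| = 24%N.
Hypothesis golayG : extended_golay G.

Lemma codeword0 : codeword G finset.set0.
Proof. by rewrite /codeword charvec0 mem0v. Qed.

Lemma codeword_sdiff C D : codeword G C -> codeword G D -> codeword G (sdiff C D).
Proof. by rewrite /codeword charvec_sdiff; apply: memvD. Qed.

Lemma codeword_card C : codeword G C -> #|C| \in [:: 0; 8; 12; 16; 24]%N.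
Proof. by case: golayG => _; apply. Qed.

(** All weights are divisible by 4, and |C + D| = |C| + |D| - 2 |C :&: D|. *)
Lemma codeword_even C D : codeword G C -> codeword G D -> ~~ odd #|C :&: D|.
Proof.
clear Omega24; move=> GC GD; have := card_sdiff C D.
have := codeword_card (codeword_sdiff GC GD).
move: (codeword_card GC) (codeword_card GD); rewrite !inE; lia.
Qed.

(** The code is isotropic of dimension 12 = 24/2, so it equals its orthogonal. *)
Lemma self_dual C : (forall D, codeword G D -> ~~ odd #|C :&: D|) -> codeword G C.
Proof.
move=> CG; have [dimG _] := golayG.
pose X := vbasis G.
pose S i := [set x | (X`_i : {ffun Omega -> ('F_2)^o}) x != 0]%SET.
have XS i : X`_i = charvec (S i).
  apply/ffunP => x; rewrite ffunE inE.
  by case: (X`_i x) => -[|[|m]] lm //=; apply: val_inj.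
pose B := \matrix_(i < \dim G) rowvec (S i).
have XG i : (i < \dim G)%N -> X`_i \in G.
  by move=> lti; apply: vbasis_mem; apply: mem_nth; rewrite size_tuple.
have free_B : row_free B.
  apply/inj_row_free => c cB; apply/rowP => i; rewrite mxE.
  have /freeP/(_ (fun i => c 0 i)) : free X by exact: basis_free (vbasisP G).
  apply; apply/ffunP => x; rewrite sum_ffunE [RHS]ffunE.
  move/rowP/(_ (enum_rank x)): cB; rewrite !mxE => cB; rewrite -[RHS]cB; apply: eq_bigr => l _.
  by rewrite XS !ffunE !mxE enum_rankK.
have BB : B *m B^T = 0.
  apply/row_matrixP => i; rewrite row_mul rowK row0.
  apply/trmx_inj/row_matrixP => j; rewrite trmx_mul trmxK row_mul rowK trmx0 row0.
  apply/eqP; rewrite rowvec_dot_eq0; apply: codeword_even; rewrite /codeword -XS; exact: XG.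
have BK : (kermx B^T <= B)%MS.
  have le : (B <= kermx B^T)%MS by apply/sub_kermxP.
  rewrite -(geq_leqif (mxrank_leqif_sup le)) mxrank_ker mxrank_tr.
  by move/eqP: free_B => ->; rewrite dimG Omega24.
have : (rowvec C <= B)%MS.
  apply: submx_trans BK; apply/sub_kermxP.
  apply/trmx_inj/row_matrixP => j; rewrite trmx_mul trmxK row_mul rowK trmx0 row0.
  apply/eqP; rewrite rowvec_dot_eq0 finset.setIC; apply: CG; rewrite /codeword -XS; exact: XG.
case/submxP => c cB; rewrite /codeword.
have -> : charvec C = \sum_(i < \dim G) c 0 i *: X`_i.
  apply/ffunP => x; rewrite sum_ffunE.
  move/rowP/(_ (enum_rank x)): cB; rewrite !mxE enum_rankK ffunE => ->.
  by apply: eq_bigr => i _; rewrite XS !ffunE !mxE enum_rankK.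
by apply: memv_suml => i _; apply/memvZ/XG.
Qed.

Lemma codewordT : codeword G [set: Omega]%SET.
Proof.
apply: self_dual => D GD; rewrite finset.setTI.
by have := codeword_card GD; rewrite !inE => /or4P[|||/orP[]] /eqP->.
Qed.

Lemma codewordC C : codeword G C -> codeword G (~: C)%SET.
Proof.
move=> GC; suff -> : (~: C)%SET = sdiff [set: Omega]%SET C by exact: codeword_sdiff codewordT GC.
by apply/setP => x; rewrite !inE.
Qed.

Lemma codeword_short C : codeword G C -> (#|C| < 8)%N -> C = finset.set0.
Proof.
clear Omega24; move=> GC C8; apply/eqP; rewrite -cards_eq0.
by have := codeword_card GC; rewrite !inE; lia.
Qed.

End Golay.
End Codes.

(** * Dodecads and hexads *)

Section Dodecads.
Context {Omega : finType}.
Variable G : {vspace {ffun Omega -> ('F_2)^o}}.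
Hypothesis Omega24 : #|Omega| = 24%N.
Hypothesis golayG : extended_golay G.
Implicit Types C D : {set Omega}.
Local Notation cw := (codeword G).

Lemma pair_not_codeword a b : a != b -> ~~ cw [set a; b]%SET.
Proof.
move=> ab; apply/negP => /(codeword_card golayG).
by rewrite cards2 ab.
Qed.

Lemma pair_detected a b : a != b -> exists2 C, cw C & odd #|[set a; b]%SET :&: C|.
Proof.
move=> ab; case: (boolP [exists C, cw C && odd #|[set a; b]%SET :&: C|]).
  by case/existsP => C /andP[]; exists C.
move/existsPn => H; case/negP: (pair_not_codeword ab).
apply: (self_dual Omega24 golayG) => D GD.
by have := H D; rewrite GD.
Qed.

Lemma cardsI2 a b C : a != b ->
  #|[set a; b]%SET :&: C| = ((a \in C) + (b \in C))%N.
Proof.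
move=> ab; rewrite finset.setIUl cardsU.
have -> : ([set a] :&: C :&: ([set b] :&: C) = finset.set0)%SET.
  by apply/setP => z; rewrite !inE; case: eqP => // ->; rewrite (negPf ab) andbF.
rewrite cards0 subn0; congr (_ + _)%N; rewrite -[RHS]muln1.
  have [aC|aC] := boolP (a \in C).
    by rewrite (finset.setIidPl _) ?cards1 ?finset.sub1set.
  by apply/eqP; rewrite cards_eq0 finset.setI_eq0 finset.disjoints1.
have [aC|aC] := boolP (b \in C).
  by rewrite (finset.setIidPl _) ?cards1 ?finset.sub1set.
by apply/eqP; rewrite cards_eq0 finset.setI_eq0 finset.disjoints1.
Qed.

(** Otherwise all weights are divisible by 8, and all intersections by 4.  Then an
    octad O has a subset of size 4 or 2 orthogonal to the code, which would be
    a codeword by self-duality: its intersection with a word that meets it in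
    four points, or any pair of its points if no word does. *)
Lemma dodecad_exists : exists2 D, cw D & #|D| = 12%N.
Proof.
case: (boolP [exists D, cw D && (#|D| == 12)]) => [/existsP[D /andP[GD /eqP]]|].
  by exists D.
move/existsPn => no12.
have wt C : cw C -> #|C| \in [:: 0; 8; 16; 24]%N.
  by move=> GC; have := codeword_card golayG GC; have := no12 C; rewrite GC !inE; lia.
have wtI C D : cw C -> cw D -> (#|C :&: D| %% 4 = 0)%N.
  move=> GC GD; have := card_sdiff C D; have := wt _ (codeword_sdiff GC GD).
  by move: (wt _ GC) (wt _ GD); rewrite !inE; lia.
have self v : (forall D, cw D -> ~~ odd #|v :&: D|) -> #|v| \notin [:: 2; 4]%N.
  move=> /(self_dual Omega24 golayG)/wt; rewrite !inE; lia.
have [a [b [_ _ ab]]] : exists a b, [/\ a \in Omega, b \in Omega & a != b].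
  by apply/card_gt1P; rewrite Omega24.
have [C GC Cab] := pair_detected ab.
have [O GO cardO] : exists2 O, cw O & #|O| = 8%N.
  have := wt _ GC; rewrite !inE => /or4P[] /eqP cardC.
  - by move: Cab; rewrite (cards0_eq cardC) finset.setI0 cards0.
  - by exists C.
  - exists (~: C)%SET; first exact: codewordC.
    by have := cardsC C; rewrite cardC Omega24; lia.
  - have CT : C = [set: Omega]%SET by apply/eqP; rewrite finset.eqEcard finset.subsetT cardsT cardC Omega24.
    by move: Cab; rewrite CT finset.setIT cards2 ab.
case: (boolP [exists D, cw D && (#|O :&: D| == 4)]) => [/existsP[D /andP[GD /eqP OD]]|].
  have := self (O :&: D)%SET; rewrite OD => H.
  suff : false by []; apply: H => D' GD'.
  have := card_sdiff (O :&: D)%SET (O :&: D')%SET.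
  have -> : sdiff (O :&: D)%SET (O :&: D')%SET = (O :&: sdiff D D')%SET.
    by apply/setP => z; rewrite !inE; case: (z \in O).
  rewrite finset.setIACA finset.setIid finset.setIA.
  have := wtI _ _ GO (codeword_sdiff GD GD'); have := wtI _ _ GO GD; have := wtI _ _ GO GD'.
  lia.
move/existsPn => no4.
have [c [d [cO dO cd]]] : exists c d, [/\ c \in O, d \in O & c != d].
  by apply/card_gt1P; rewrite cardO.
have := self [set c; d]%SET; rewrite cards2 cd => H.
suff : false by []; apply: H => D GD; rewrite cardsI2 //.
have := no4 D; rewrite GD /=; have := wtI _ _ GO GD.
have := subset_leq_card (finset.subsetIl O D); rewrite cardO => le8 m4 n4.
have [/cards0_eq OD|OD] : (#|O :&: D| = 0 \/ #|O :&: D| = 8)%N by lia.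
  move/setP: OD => OD; have := OD c; have := OD d; rewrite !inE cO dO /= => -> ->.
  by [].
have /eqP OD' : (O :&: D)%SET == O by rewrite finset.eqEcard finset.subsetIl OD cardO.
by move/setP: OD' => OD'; have := OD' c; have := OD' d; rewrite !inE cO dO /= => -> ->.
Qed.

Section Hexads.
Variable D : {set Omega}.
Hypothesis GD : cw D.
Hypothesis D12 : #|D| = 12%N.

Lemma card_outside C a b : (forall z, z \notin D -> (z \in C) = (z == a) || (z == b)) ->
  a \notin D -> b \notin D -> a != b -> #|C| = (#|C :&: D| + 2)%N.
Proof.
move=> CE aD bD ab; rewrite -(cardsID D C); congr (_ + _)%N.
have -> : (C :\: D = [set a; b])%SET.
  apply/setP => z; rewrite !inE; case: (boolP (z \in D)) => [zD|/CE->//].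
  by apply/esym/negP => /orP[] /eqP e; move: aD bD; rewrite -e zD.
by rewrite cards2 ab.
Qed.

(** A word with two points outside the dodecad D has weight 8 or 12, and so has
    its sum with D; only 6 points inside D are compatible with both. *)
Lemma hexad_card C a b : cw C -> (forall z, z \notin D -> (z \in C) = (z == a) || (z == b)) ->
  a \notin D -> b \notin D -> a != b -> #|C :&: D| = 6%N.
Proof.
clear Omega24; move=> GC CE aD bD ab; have cC := card_outside CE aD bD ab.
have := codeword_card golayG GC; rewrite cC.
have := codeword_card golayG (codeword_sdiff GC GD).
have := card_sdiff C D; rewrite cC D12.
have := subset_leq_card (finset.subsetIr C D); rewrite D12 !inE; lia.
Qed.

Lemma inside_dodecadC v : cw v -> (forall z, z \in D -> z \notin v) ->
  v = finset.set0 \/ v = (~: D)%SET.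
Proof.
move=> Gv vD; have GE := codewordC Omega24 golayG GD.
have cE : #|(~: D)%SET| = 12%N by have := cardsC D; rewrite D12 Omega24; lia.
have vE : v \subset (~: D)%SET.
  by apply/fintype.subsetP => z zv; rewrite inE; apply/negP => /vD; rewrite zv.
have := card_sdiff v (~: D)%SET; rewrite (finset.setIidPl vE) cE.
have := codeword_card golayG (codeword_sdiff Gv GE).
have := codeword_card golayG Gv; have := subset_leq_card vE; rewrite cE !inE => le12 cv cs eq.
have [/cards0_eq->|v12] : (#|v| = 0 \/ #|v| = 12)%N by lia.
  by left.
by right; apply/eqP; rewrite finset.eqEcard vE v12 cE.
Qed.

(** By biduality the traces of codewords on the complement of D are the sets
    orthogonal to the codewords contained in it; these are 0 and the complement
    of D itself, so every even subset, in particular every pair, is a trace. *)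
Lemma hexad_exists a b : a \notin D -> b \notin D -> a != b ->
  exists2 C, cw C & forall z, z \notin D -> (z \in C) = (z == a) || (z == b).
Proof.
move=> aD bD ab.
pose S := [set v : {set Omega} | [exists C, cw C && (sdiff C v \subset D)]]%SET.
have inS C v : cw C -> sdiff C v \subset D -> v \in S.
  by move=> GC Cv; rewrite inE; apply/existsP; exists C; rewrite GC.
suff : [set a; b]%SET \in S.
  rewrite inE => /existsP[C /andP[GC /fintype.subsetP CS]]; exists C => // z zD.
  have := contra (CS z) zD; rewrite in_sdiff !inE.
  by case: (z \in C); case: (_ || _).
apply: bidual => [|v v'|v vS].
- by apply: (inS finset.set0); [exact: codeword0|apply/fintype.subsetP => z; rewrite !inE].
- rewrite !inE => /existsP[C /andP[GC /fintype.subsetP Cv]] /existsP[C' /andP[GC' /fintype.subsetP Cv']].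
  apply/existsP; exists (sdiff C C'); rewrite codeword_sdiff //=.
  apply/fintype.subsetP => z; have := Cv z; have := Cv' z; rewrite !in_sdiff.
  by case: (z \in C); case: (z \in C'); case: (z \in v); case: (z \in v') => /=; do 2?move/(_ isT).
have Gv : cw v.
  apply: (self_dual Omega24 golayG) => C GC; rewrite finset.setIC; apply: vS.
  apply: (inS C) => //; apply/fintype.subsetP => z; rewrite in_sdiff addbb //.
have vD z : z \in D -> z \notin v.
  move=> zD; have : [set z]%SET \in S.
    apply: (inS finset.set0); first exact: codeword0.
    by apply/fintype.subsetP => y; rewrite !inE => /eqP->.
  move/vS; apply: contra => zv; rewrite (finset.setIidPl _) ?cards1 //.
  by rewrite finset.sub1set.
case: (inside_dodecadC Gv vD) => ->; rewrite cardsI2 // !inE //.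
by rewrite aD bD.
Qed.

(** There are two hexads for a given pair, complementary in D: exactly one of
    them contains y0. *)
Lemma hexad_through x0 y0 : x0 \notin D -> y0 \in D ->
  exists hx : Omega -> {set Omega}, forall x, x \notin D -> x0 != x ->
    [/\ cw (hx x), (forall z, z \notin D -> (z \in hx x) = (z == x0) || (z == x)),
        #|hx x :&: D| = 6%N & y0 \in hx x].
Proof.
move=> x0D y0D.
suff /choice[hx hxP] : forall x, exists C, x \notin D -> x0 != x ->
    [/\ cw C, (forall z, z \notin D -> (z \in C) = (z == x0) || (z == x)),
        #|C :&: D| = 6%N & y0 \in C] by exists hx.
move=> x.
have [xD|xD] := boolP (x \in D); first by exists finset.set0.
have [->|x0x] := eqVneq x0 x; first by exists finset.set0.
have [C GC CE] := hexad_exists x0D xD x0x.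
have [y0C|y0C] := boolP (y0 \in C).
  by exists C; split=> //; apply: hexad_card GC CE _ _ _.
have GC' := codeword_sdiff GC GD.
have CE' z : z \notin D -> (z \in sdiff C D) = (z == x0) || (z == x).
  by move=> zD; rewrite in_sdiff (negPf zD) addbF CE.
exists (sdiff C D); split=> //; first exact: hexad_card GC' CE' _ _ _.
by rewrite in_sdiff y0D (negPf y0C).
Qed.

Lemma hexad_meet C C' a b b' : cw C -> cw C' ->
  (forall z, z \notin D -> (z \in C) = (z == a) || (z == b)) ->
  (forall z, z \notin D -> (z \in C') = (z == a) || (z == b')) ->
  a \notin D -> b \notin D -> b' \notin D -> a != b -> a != b' -> b != b' ->
  #|C :&: C' :&: D| = 3%N.
Proof.
clear Omega24; move=> GC GC' CE CE' aD bD b'D ab ab' bb'.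
have c1 := hexad_card GC CE aD bD ab; have c2 := hexad_card GC' CE' aD b'D ab'.
have := card_sdiff (C :&: D)%SET (C' :&: D)%SET; rewrite c1 c2.
have -> : (C :&: D :&: (C' :&: D) = C :&: C' :&: D)%SET.
  by apply/setP => z; rewrite !inE; case: (z \in D); rewrite ?andbT ?andbF.
have -> : sdiff (C :&: D)%SET (C' :&: D)%SET = (sdiff C C' :&: D)%SET.
  by apply/setP => z; rewrite !inE; case: (z \in D); rewrite ?andbT ?andbF.
rewrite (hexad_card (codeword_sdiff GC GC') (a := b) (b := b')) //; first lia.
move=> z zD; rewrite in_sdiff CE // CE' //.
have [->|] := eqVneq z a; first by rewrite (negPf ab) (negPf ab').
have [->|] := eqVneq z b; first by rewrite (negPf bb').
by case: (z == b').
Qed.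

End Hexads.
End Dodecads.

(** * Biplanes on eleven points *)

(** Fix a dodecad D with a point y0 in it, and a point x0 outside.  The hexads
    through y0 for the pairs {x0, x}, with y0 removed, are eleven blocks of
    size 5 on the eleven other points of D, and two of them meet in two points.
    One block is {0, ..., 4}; the ten others cut it in the ten pairs.  It
    remains to find their traces on the six remaining points: ten triples
    with prescribed intersections.  Up to the order of the six points there
    are two solutions, and each yields the code fixed above. *)
Section BiplaneSearch.
Local Open Scope nat_scope.

Definition pairs5 : seq (nat * nat) :=
  [:: (0, 1); (0, 2); (0, 3); (0, 4); (1, 2); (1, 3); (1, 4); (2, 3); (2, 4); (3, 4)].
Definition pair_row (e : nat) : bitseq :=
  let p := nth (0, 0) pairs5 e in [seq (k == p.1) || (k == p.2) | k <- iota 0 5].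
Definition triples6 : seq bitseq := [seq r <- all_keys 6 | count id r == 3].

(** The traces are added one by one; two blocks meet in two points in all, so
    the pairs leave 2 minus their overlap for the triples. *)
Definition extend_rows (m : nat) (rss : seq (seq bitseq)) : seq (seq bitseq) :=
  let ts := [seq 2 - overlap (pair_row f) (pair_row m) | f <- iota 0 m] in
  flatten [seq [seq rcons rs r | r <- triples6 &
      all (fun f => overlap (nth [::] rs f) r == nth 0 ts f) (iota 0 m)] | rs <- rss].
Definition biplane_rows (n : nat) : seq (seq bitseq) :=
  foldl (fun rss m => extend_rows m rss) [:: [::]] (iota 0 n).

Definition columns (rs : seq bitseq) : seq bitseq :=
  [seq [seq nth false r j | r <- rs] | j <- iota 0 6].

Definition columns_of (l : seq (seq nat)) : seq bitseq :=
  [seq [seq e \in c | e <- iota 0 10] | c <- l].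
Definition biplane_columns1 := columns_of
  [:: [:: 0; 1; 5; 8; 9]; [:: 0; 2; 6; 7; 8]; [:: 0; 3; 4; 7; 9];
      [:: 1; 2; 4; 6; 9]; [:: 1; 3; 5; 6; 7]; [:: 2; 3; 4; 5; 8]].
Definition biplane_columns2 := columns_of
  [:: [:: 0; 1; 6; 7; 9]; [:: 0; 2; 4; 8; 9]; [:: 0; 3; 5; 7; 8];
      [:: 1; 2; 5; 6; 8]; [:: 1; 3; 4; 5; 9]; [:: 2; 3; 4; 6; 7]].

(** The order of the 24 points is x0, x1, the ten points indexed by the pairs, then y0,
    the block of x1, and the six remaining points.  The words are D and the
    eleven words carrying the blocks; S is the list of the columns of the
    matrix of triples. *)
Definition biplane_basis (S : seq bitseq) : seq bitseq :=
  [:: nseq 12 false ++ nseq 12 true,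
      [:: true; true] ++ nseq 10 false ++ true :: nseq 5 true ++ nseq 6 false &
      [seq [:: true; false] ++ [seq f == e | f <- iota 0 10] ++ true :: pair_row e ++
           [seq nth false c e | c <- S] | e <- iota 0 10]].

Definition xor_span (B : seq bitseq) : seq bitseq :=
  foldr (fun b L => L ++ [seq xor_key b k | k <- L]) [:: nseq 24 false] B.

(** Orders of the points identifying each solution with the fixed coordinates. *)
Definition biplane_order1 : seq nat :=
  [:: 0; 1; 12; 13; 2; 3; 4; 5; 6; 11; 18; 23; 7; 10; 19; 22; 8; 9; 20; 21; 14; 15; 16; 17].
Definition biplane_order2 : seq nat :=
  [:: 0; 1; 2; 3; 4; 5; 13; 12; 6; 11; 17; 16; 9; 22; 21; 7; 20; 10; 19; 8; 18; 23; 14; 15].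

Definition order_check (S : seq bitseq) (o : seq nat) : bool :=
  perm_eq o (iota 0 24) &&
  all (fun b => [seq nth false b.2 (index i o) | i <- iota 0 24] \in xor_span (biplane_basis S))
    golay_basis.

Lemma order_check1 : order_check biplane_columns1 biplane_order1.
Proof. by vm_compute. Qed.
Lemma order_check2 : order_check biplane_columns2 biplane_order2.
Proof. by vm_compute. Qed.

Lemma biplane_unique : all (fun rs => perm_eq biplane_columns1 (columns rs) ||
  perm_eq biplane_columns2 (columns rs)) (biplane_rows 10).
Proof. by vm_compute. Qed.

Lemma mem_all_keys (k : bitseq) : k \in all_keys (size k).
Proof.
elim: k => //= b k IHk; rewrite mem_cat.
by case: b; rewrite map_f // orbT.
Qed.

Lemma biplane_rowsP (r : nat -> bitseq) n :
  (forall e, e < n -> size (r e) = 6 /\ count id (r e) = 3) ->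
  (forall e f, e < f -> f < n -> overlap (r e) (r f) + overlap (pair_row e) (pair_row f) = 2) ->
  mkseq r n \in biplane_rows n.
Proof.
elim: n => [|n IH] r3 rr; first by [].
have -> : biplane_rows n.+1 = extend_rows n (biplane_rows n).
  by rewrite /biplane_rows -addn1 iotaD foldl_cat.
apply/flatten_mapP; exists (mkseq r n).
  by apply: IH => [e en|e f ef fn]; [apply: r3; apply: leqW | apply: rr => //; apply: leqW].
rewrite mkseqS; apply: map_f.
have [sr cr] := r3 n (leqnn _); have rk := mem_all_keys (r n); rewrite sr in rk.
rewrite mem_filter; apply/andP; split; last by rewrite mem_filter cr rk.
apply/allP => f; rewrite mem_iota => /andP[_ fn].
rewrite nth_mkseq // (nth_map 0) ?size_iota // nth_iota // add0n.
by rewrite -(rr f n fn (leqnn _)) addnK.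
Qed.

End BiplaneSearch.

(** * Labelling the points of a Golay code *)

Section KeySets.
Context {Omega : finType}.
Variable G : {vspace {ffun Omega -> ('F_2)^o}}.
Hypothesis Omega24 : #|Omega| = 24%N.
Hypothesis golayG : extended_golay G.
Implicit Types (w : seq Omega) (k : bitseq).
Local Notation cw := (codeword G).

Definition key_set w k : {set Omega} := [set x in mask k w]%SET.

Definition labelling w : Prop := uniq w /\ size w = 24%N.

Lemma labelling_mem w x : labelling w -> x \in w.
Proof.
move=> [uw sw]; have : w =i predT.
  apply/subset_cardP; last exact: fintype.subset_predT.
  by rewrite (card_uniqP uw) sw -Omega24.
by move->.
Qed.

Lemma in_key_set w k x : labelling w -> (x \in key_set w k) = nth false k (index x w).
Proof. by move=> lw; rewrite inE in_mask ?labelling_mem //; case: lw. Qed.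

Lemma key_setE w (A : {set Omega}) : labelling w -> key_set w [seq x \in A | x <- w] = A.
Proof.
move=> lw; apply/setP => x; rewrite in_key_set // (nth_map x) ?nth_index ?labelling_mem //.
by rewrite index_mem labelling_mem.
Qed.

Lemma key_of_set w k : labelling w -> size k = 24%N -> [seq x \in key_set w k | x <- w] = k.
Proof.
move=> lw sk; case: (lw) => uw sw.
apply: (@eq_from_nth _ false) => [|i]; rewrite size_map sw ?sk // => i24.
have [x0 _] : exists x0 : Omega, true by case: w sw i24 {lw uw} => [|x0 w] //; exists x0.
by rewrite (nth_map x0) ?sw // in_key_set // index_uniq ?sw.
Qed.

Lemma nth_xor_key a b i : size a = size b ->
  nth false (xor_key a b) i = nth false a i (+) nth false b i.
Proof. by elim: a b i => [|x a IH] [|y b] [|i] //= [/IH]. Qed.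

Lemma size_xor_key a b : size a = size b -> size (xor_key a b) = size a.
Proof. by elim: a b => [|x a IH] [|y b] //= [/IH->]. Qed.

Lemma key_set_xor w a b : labelling w -> size a = size b ->
  key_set w (xor_key a b) = sdiff (key_set w a) (key_set w b).
Proof. by move=> lw ab; apply/setP => x; rewrite in_sdiff !in_key_set // nth_xor_key. Qed.

Lemma key_set0 w n : labelling w -> key_set w (nseq n false) = finset.set0.
Proof. by move=> lw; apply/setP => x; rewrite in_key_set // nth_nseq if_same inE. Qed.

Lemma xor_span_codeword w (B : seq bitseq) : labelling w ->
  (forall b, b \in B -> size b = 24%N /\ cw (key_set w b)) ->
  forall k, k \in xor_span B -> size k = 24%N /\ cw (key_set w k).
Proof.
move=> lw; elim: B => [|b B IH] BG k /=.
  by rewrite inE => /eqP->; have /= -> := key_set0 24 lw; split=> //; exact: codeword0.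
have {}IH := IH (fun c cB => BG c (mem_behead (s := b :: B) cB)).
have [sb Gb] := BG b (mem_head _ _).
rewrite mem_cat => /orP[/IH //|/mapP[k' /IH[sk' Gk'] ->]].
by rewrite size_xor_key ?sb ?sk' // key_set_xor ?sb // codeword_sdiff.
Qed.

Definition golay_labelling w : Prop :=
  labelling w /\ forall b, b \in golay_basis -> cw (key_set w b.2).

Lemma relabel w S o : labelling w -> order_check S o ->
  (forall b, b \in biplane_basis S -> size b = 24%N /\ cw (key_set w b)) ->
  exists w', golay_labelling w'.
Proof.
move=> lw /andP[po /allP bo] BG; have [uw sw] := lw.
have so : size o = 24%N by rewrite (perm_size po).
have uo : uniq o by rewrite (perm_uniq po) iota_uniq.
have [x0 _] : exists x0 : Omega, true by case: w sw {lw uw BG} => [|x0 w] // _; exists x0.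
have lw' : labelling [seq nth x0 w i | i <- o].
  split; last by rewrite size_map.
  rewrite (@perm_uniq _ _ [seq nth x0 w i | i <- iota 0 24]) ?perm_map //.
  by rewrite -sw map_nth_iota0 // take_size.
exists [seq nth x0 w i | i <- o]; split=> // b bB.
have [_] := xor_span_codeword lw BG (bo _ bB); congr (codeword _ _).
apply/setP => x; rewrite !in_key_set //.
have := labelling_mem x lw'; case/mapP => j /(nthP 0%N)[i io <-] ->.
have jo : (nth 0%N o i < 24)%N by have := mem_nth 0%N io; rewrite (perm_mem po) mem_iota.
rewrite index_uniq ?sw // (nth_map 0%N) ?size_iota // nth_iota // add0n index_uniq //.
by rewrite -(nth_map _ x0) // index_uniq ?size_map //; case: lw'.
Qed.

End KeySets.

Section Labelling.
Context {Omega : finType}.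

Lemma count_overlap (A B : {set Omega}) s :
  count (mem (A :&: B)%SET) s = overlap [seq x \in A | x <- s] [seq x \in B | x <- s].
Proof. by elim: s => //= x s ->; rewrite inE. Qed.

Variable G : {vspace {ffun Omega -> ('F_2)^o}}.
Hypothesis Omega24 : #|Omega| = 24%N.
Hypothesis golayG : extended_golay G.
Local Notation cw := (codeword G).

Lemma perm_map_perm (T : eqType) (U : eqType) (f : T -> U) (s : seq T) (t : seq U) :
  perm_eq t [seq f x | x <- s] -> exists2 s', perm_eq s' s & [seq f x | x <- s'] = t.
Proof.
case: s => [|x0 s]; first by move=> /perm_nilP->; exists [::].
move=> /(perm_iotaP (f x0))[Is pI ->].
exists [seq nth x0 (x0 :: s) i | i <- Is].
  apply: perm_trans (perm_map _ pI) _; rewrite size_map map_nth_iota0 // take_size //.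
rewrite -map_comp; apply/eq_in_map => i; rewrite (perm_mem pI) mem_iota size_map => /andP[_ il].
exact/esym/(@nth_map _ x0 _ (f x0) f i (x0 :: s)).
Qed.

(** The uniqueness of the Golay code, in the form of coordinates in which it contains the
    fixed basis.  The hexads of a dodecad D and those of its complement are
    dual to each other: x belongs to the hexad of y iff y belongs to that of
    x.  Hence two points of the block of x1 lie together in another block, whose
    label is a point common to their dual hexads; this indexes the blocks by
    pairs and feeds the search above. *)
Theorem golay_labelling_exists : exists w, golay_labelling G w.
Proof.
have [D GD D12] := dodecad_exists Omega24 golayG.
have GE := codewordC Omega24 golayG GD.
have E12 : #|(~: D)%SET| = 12%N by have := cardsC D; rewrite D12 Omega24; lia.
have [y0 y0D] : exists y0, y0 \in D by apply/finset.set0Pn; rewrite -cards_eq0 D12.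
have [x0 [x1 [x0E x1E x01]]] : exists x0 x1, [/\ x0 \in (~: D)%SET, x1 \in (~: D)%SET & x0 != x1].
  by apply/card_gt1P; rewrite E12.
rewrite !finset.in_setC in x0E x1E.
have [hx hxP] := hexad_through Omega24 golayG GD D12 x0E y0D.
have y0E : y0 \notin (~: D)%SET by rewrite finset.in_setC negbK.
have x0EE : x0 \in (~: D)%SET by rewrite finset.in_setC.
have [ky kyP] := hexad_through Omega24 golayG GE E12 y0E x0EE.
have hx_meet x x' : x \notin D -> x' \notin D -> x0 != x -> x0 != x' -> x != x' ->
    #|hx x :&: hx x' :&: D| = 3%N.
  move=> xD x'D x0x x0x' xx'.
  have [G1 E1 _ _] := hxP x xD x0x; have [G2 E2 _ _] := hxP x' x'D x0x'.
  by apply: (hexad_meet golayG GD D12 G1 G2 E1 E2).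
have ky_meet y y' : y \in D -> y' \in D -> y0 != y -> y0 != y' -> y != y' ->
    #|ky y :&: ky y' :&: ~: D| = 3%N.
  move=> yD y'D y0y y0y' yy'.
  have yE : y \notin (~: D)%SET by rewrite finset.in_setC negbK.
  have y'E : y' \notin (~: D)%SET by rewrite finset.in_setC negbK.
  have [G1 E1 _ _] := kyP y yE y0y; have [G2 E2 _ _] := kyP y' y'E y0y'.
  by apply: (hexad_meet golayG GE E12 G1 G2 E1 E2).
(* The words for {x0, x} and {y0, y} meet evenly, and share x0 and y0. *)
have dual x y : x \notin D -> x0 != x -> y \in D -> y0 != y -> (x \in ky y) = (y \in hx x).
  move=> xD x0x yD y0y.
  have yE : y \notin (~: D)%SET by rewrite finset.in_setC negbK.
  have [G1 E1 _ h1] := hxP x xD x0x; have [G2 E2 _ k1] := kyP y yE y0y.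
  have := codeword_even golayG G1 G2; rewrite -(cardsID D) oddD.
  have -> : (hx x :&: ky y :&: D = [set y0; y] :&: hx x)%SET.
    apply/setP => z; rewrite !inE; have [zD|zD] := boolP (z \in D).
      by rewrite andbT andbC E2 // finset.in_setC negbK.
    rewrite andbF; apply/esym/negP => /andP[/orP[]/eqP e _]; move: zD; rewrite e ?y0D ?yD //.
  have -> : (hx x :&: ky y :\: D = [set x0; x] :&: ky y)%SET.
    apply/setP => z; rewrite !inE; have [zD|zD] := boolP (z \in D).
      apply/esym/negP => /andP[/orP[]/eqP e _]; move: zD; rewrite e ?(negPf x0E) ?(negPf xD) //.
    by rewrite /= E1.
  rewrite !cardsI2 // h1 k1 /=.
  by case: (x \in ky y); case: (y \in hx x).
have [G1 E1 C1 y0h1] := hxP x1 x1E x01.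
pose B := (hx x1 :&: D :\ y0)%SET.
have B5 : #|B| = 5%N.
  have := cardsD1 y0 (hx x1 :&: D)%SET; by rewrite C1 finset.in_setI y0h1 y0D add1n => -[<-].
pose ys := enum B.
have sys : size ys = 5%N by rewrite -cardE.
have uys : uniq ys by exact: enum_uniq.
have ysP y : y \in ys -> [/\ y \in D, y0 != y & y \in hx x1].
  by rewrite mem_enum !inE eq_sym => /and3P[-> -> ->].
pose yi i := nth y0 ys i.
have yiP i : (i < 5)%N -> [/\ yi i \in D, y0 != yi i & yi i \in hx x1].
  by move=> i5; apply/ysP/mem_nth; rewrite sys.
have edge e : (e < 10)%N -> let p := nth (0, 0)%N pairs5 e in
    [/\ (p.1 < 5)%N, (p.2 < 5)%N & p.1 != p.2].
  move=> e10 /=.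
  have : all (fun p => [&& (p.1 < 5)%N, (p.2 < 5)%N & p.1 != p.2]) pairs5 by [].
  by move/allP/(_ _ (mem_nth (0, 0)%N (e10 : e < size pairs5)%N))/and3P.
have xe_exists e : exists x, (e < 10)%N -> let p := nth (0, 0)%N pairs5 e in
    [/\ x \notin D, x0 != x, x1 != x, yi p.1 \in hx x & yi p.2 \in hx x].
  have [e10|] := ltnP e 10; last by exists x0.
  set p := nth _ _ _.
  have [p1 p2 p12] := edge e e10; rewrite -/p in p1 p2 p12.
  have [d1 n1 h1] := yiP _ p1; have [d2 n2 h2] := yiP _ p2.
  have n12 : yi p.1 != yi p.2 by rewrite nth_uniq ?sys.
  (* The dual hexads of the two ends share three points, hence one besides x0, x1. *)
  have [x xT xx] : exists2 x, x \in (ky (yi p.1) :&: ky (yi p.2) :&: ~: D)%SET & x \notin [:: x0; x1].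
    apply/exists_inP; apply: contraT; rewrite negb_exists_in => /forall_inP sub.
    suff : (#|(ky (yi p.1) :&: ky (yi p.2) :&: ~: D)%SET| <= size [:: x0; x1])%N by rewrite ky_meet.
    apply: leq_trans (card_size _); apply/subset_leq_card/fintype.subsetP => x xT.
    by have := sub x xT; rewrite negbK.
  exists x => _ /=; move: xx xT; rewrite !inE negb_or => /andP[xx0 xx1] /andP[/andP[k1 k2] xD].
  rewrite [x0 == x]eq_sym xx0 [x1 == x]eq_sym xx1.
  by rewrite -!dual // eq_sym.
have [xe xeP'] := choice xe_exists.
have {xe_exists} xeP e : (e < 10)%N -> let p := nth (0, 0)%N pairs5 e in
    [/\ xe e \notin D, x0 != xe e, x1 != xe e, yi p.1 \in hx (xe e) & yi p.2 \in hx (xe e)].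
  by move=> e10; apply: xeP'.
pose Z := (D :\ y0 :\: B)%SET; pose zs := enum Z.
have enumD : perm_eq (enum D) (y0 :: ys ++ zs).
  apply: uniq_perm; first exact: enum_uniq.
    rewrite /= cat_uniq !enum_uniq andbT /= mem_cat !mem_enum !inE eqxx /=.
    by apply/hasPn => z; rewrite !mem_enum !inE => /andP[].
  move=> z; rewrite mem_enum inE mem_cat !mem_enum !inE.
  by have [->|] := eqVneq z y0; rewrite ?y0D //=; case: (z \in D); case: (z \in hx x1).
have szs : size zs = 6%N.
  have := perm_size enumD; rewrite /= size_cat sys -cardE D12 => /eqP.
  by rewrite -[12%N]/(6 + 6)%N -addSn eqn_add2l eq_sym => /eqP.
have countD (A : {set Omega}) : #|A :&: D| =
    ((y0 \in A) + count (mem A) ys + count (mem A) zs)%N.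
  have -> : #|A :&: D| = count (mem A) (enum D).
    rewrite -sum1_card -sum1_count big_enum_cond /=.
    by apply: eq_bigl => z; rewrite !inE andbC.
  by rewrite (seq.permP enumD) /= count_cat addnA.
have y0hx e : (e < 10)%N -> y0 \in hx (xe e).
  by move=> /xeP[xD x0x _ _ _]; have [] := hxP _ xD x0x.
(* The block of x1 and the block of e share two points, so just the ends of e. *)
have hx_ys e : (e < 10)%N -> [seq y \in hx (xe e) | y <- ys] = pair_row e.
  move=> e10; have [xD x0x x1x h1 h2] := xeP e e10; set v := map _ _.
  have sv : size v = 5%N by rewrite size_map.
  have cv : count id v = 2%N.
    have := hx_meet _ _ x1E xD x01 x0x x1x; rewrite countD inE y0h1 y0hx //=.
    have -> : count (mem (hx x1 :&: hx (xe e))%SET) zs = 0%N.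
      apply/eqP; rewrite -leqn0 leqNgt -has_count; apply/hasPn => z.
      rewrite mem_enum !inE => /andP[zB /andP[zy0 zD]]; move: zB.
      by rewrite zy0 zD /= andbT => /negPf->.
    rewrite addn0 add1n => -[<-]; rewrite count_map; apply: eq_in_count => y /ysP[_ _ yh] /=.
    by rewrite inE yh.
  have vi i : (i < 5)%N -> nth false v i = (yi i \in hx (xe e)).
    by move=> i5; rewrite (nth_map y0) ?sys.
  have : all (fun v => all (fun e => let p := nth (0, 0)%N pairs5 e in
      [&& count id v == 2, nth false v p.1 & nth false v p.2] ==> (v == pair_row e))
      (iota 0 10)) (all_keys 5) by vm_compute.
  have vk := mem_all_keys v; rewrite sv in vk.
  move/allP/(_ v vk)/allP/(_ e); rewrite mem_iota e10 => /(_ isT) /=.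
  have [p1 p2 _] := edge e e10.
  by rewrite cv !vi // h1 h2 => /eqP.
pose r e := [seq z \in hx (xe e) | z <- zs].
have r3 e : (e < 10)%N -> size (r e) = 6%N /\ count id (r e) = 3%N.
  move=> e10; have [xD x0x _ _ _] := xeP e e10; have [_ _ + _] := hxP _ xD x0x.
  rewrite countD y0hx // !size_map szs.
  have -> : count (mem (hx (xe e))) ys = count id (pair_row e) by rewrite -hx_ys // count_map.
  have -> : count (mem (hx (xe e))) zs = count id (r e) by rewrite count_map.
  have : all (fun e => count id (pair_row e) == 2) (iota 0 10) by [].
  move/allP/(_ e); rewrite mem_iota e10 => /(_ isT)/eqP->.
  by rewrite -[6%N]/(true + 2 + 3)%N => /eqP; rewrite eqn_add2l => /eqP->.
have xe_inj e f : (e < f)%N -> (f < 10)%N -> xe e != xe f.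
  move=> ef f10; apply/eqP => xef; have := hx_ys e (ltn_trans ef f10); rewrite xef hx_ys //.
  have : all (fun f => all (fun e => pair_row f != pair_row e) (iota 0 f)) (iota 0 10) by [].
  move/allP/(_ f); rewrite mem_iota f10 => /(_ isT)/allP/(_ e); rewrite mem_iota ef.
  by move=> /(_ isT)/eqP.
have rr e f : (e < f)%N -> (f < 10)%N ->
    (overlap (r e) (r f) + overlap (pair_row e) (pair_row f) = 2)%N.
  move=> ef f10; have e10 := ltn_trans ef f10.
  have [eD x0e _ _ _] := xeP e e10; have [fD x0f _ _ _] := xeP f f10.
  have := hx_meet _ _ eD fD x0e x0f (xe_inj _ _ ef f10).
  rewrite countD inE !y0hx // !count_overlap !hx_ys //= -addnA add1n => -[].
  by rewrite addnC.
have := allP biplane_unique _ (biplane_rowsP r3 rr).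
pose col z := [seq z \in hx (xe e) | e <- iota 0 10].
have -> : columns (mkseq r 10) = [seq col z | z <- zs].
  apply: (@eq_from_nth _ [::]) => [|i]; first by rewrite !size_map szs size_iota.
  rewrite size_map size_iota => i6; rewrite !(nth_map 0%N) ?size_iota // (nth_map y0) ?szs //.
  rewrite nth_iota // -map_comp; apply: eq_map => e /=.
  by rewrite /r (nth_map y0) ?szs.
have [xs xsE] : exists xs, xs = [seq xe e | e <- iota 0 10] by eexists.
pose w zs' := x0 :: x1 :: xs ++ y0 :: ys ++ zs'.
have xsP x : x \in xs -> exists2 e, (e < 10)%N & x = xe e.
  by rewrite xsE => /mapP[e]; rewrite mem_iota; exists e.
have xs_notin : {in [:: x0, x1 & xs], forall x, x \notin D}.
  by move=> x; rewrite !inE => /or3P[/eqP->//|/eqP->//|/xsP[e /xeP[eD _ _ _ _] ->]].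
have xs_uniq : uniq [:: x0, x1 & xs].
  have -> : uniq [:: x0, x1 & xs] = [&& x0 != x1, x0 \notin xs, x1 \notin xs & uniq xs].
    by rewrite /= inE negb_or -andbA.
  apply/and4P; split=> //.
  - by apply/negP => /xsP[e /xeP[_ n0 _ _ _] eq]; rewrite -eq eqxx in n0.
  - by apply/negP => /xsP[e /xeP[_ _ n1 _ _] eq]; rewrite -eq eqxx in n1.
  rewrite xsE map_inj_in_uniq ?iota_uniq // => e f.
  rewrite !mem_iota => e10 f10 xef; have [ef|fe|//] := ltngtP e f.
    by have := xe_inj _ _ ef f10; rewrite xef eqxx.
  by have := xe_inj _ _ fe e10; rewrite xef eqxx.
have ys_perm zs' : perm_eq zs' zs -> perm_eq (y0 :: ys ++ zs') (enum D).
  by move=> pz; rewrite perm_sym (perm_trans enumD) // perm_cons perm_cat2l perm_sym.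
have lw zs' : perm_eq zs' zs -> labelling (w zs').
  move=> pz; have pD := ys_perm _ pz; split.
    rewrite /w -[x0 :: _]/([:: x0, x1 & xs] ++ (y0 :: ys ++ zs')).
    rewrite cat_uniq xs_uniq (perm_uniq pD) enum_uniq andbT; apply/hasPn => z.
    rewrite (perm_mem pD) mem_enum; apply/contraTN => /xs_notin; exact.
  by rewrite /w /= size_cat xsE size_map size_iota /= size_cat sys (perm_size pz) szs.
have map_const (A : {set Omega}) (s : seq Omega) c n : size s = n ->
    {in s, forall x, (x \in A) = c} -> [seq x \in A | x <- s] = nseq n c.
  move=> <-; elim: s => //= x s IH sA; rewrite sA ?mem_head // IH // => y ys'.
  by apply: sA; rewrite inE ys' orbT.
have zsP z : z \in zs -> z \in D /\ z \notin hx x1.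
  rewrite mem_enum !inE => /andP[zB /andP[zy0 zD]]; split=> //.
  by move: zB; rewrite zy0 zD andbT.
have basisP zs' : perm_eq zs' zs ->
    forall b, b \in biplane_basis (map col zs') -> size b = 24%N /\ cw (key_set (w zs') b).
  move=> pz b bB.
  have pzm z : z \in zs' -> z \in zs by rewrite (perm_mem pz).
  have szs' : size zs' = 6%N by rewrite (perm_size pz).
  suff [A GA ->] : exists2 A, cw A & b = [seq x \in A | x <- w zs'].
    by rewrite key_setE // ?size_map; [split=> //; case: (lw _ pz) | exact: lw].
  have wE (A : {set Omega}) : [seq x \in A | x <- w zs'] =
      [:: x0 \in A, x1 \in A & [seq xe e \in A | e <- iota 0 10] ++
        (y0 \in A) :: [seq y \in A | y <- ys] ++ [seq z \in A | z <- zs']].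
    by rewrite /w !map_cons map_cat map_cons map_cat xsE -map_comp.
  have xs_const (A : {set Omega}) c : (forall e, (e < 10)%N -> (xe e \in A) = c) ->
      [seq xe e \in A | e <- iota 0 10] = nseq 10 c.
    move=> H; have -> : [seq xe e \in A | e <- iota 0 10] = [seq x \in A | x <- xs].
      by rewrite xsE -map_comp.
    by apply: map_const => [|x /xsP[e e10 ->]]; [rewrite xsE size_map | exact: H].
  move: bB; rewrite 2!in_cons => /or3P[/eqP->|/eqP->|/mapP[e]].
  - exists D => //; rewrite wE (negPf x0E) (negPf x1E) y0D.
    rewrite (xs_const _ false) => [|e /xeP[/negPf-> //]].
    rewrite (map_const _ ys true 5) => // [|y /ysP[] //].
    by rewrite (map_const _ zs' true 6) // => z /pzm/zsP[].
  - exists (hx x1) => //; rewrite wE (E1 x0) // (E1 x1) // !eqxx orbT y0h1.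
    rewrite (xs_const _ false) => [|e /xeP[eD n0 n1 _ _]]; last first.
      by rewrite E1 // eq_sym (negPf n0) eq_sym (negPf n1).
    rewrite (map_const _ ys true 5) => // [|y /ysP[] //].
    by rewrite (map_const _ zs' false 6) // => z /pzm/zsP[_ /negPf].
  rewrite mem_iota => /andP[_ e10] ->; have [eD n0 n1 _ _] := xeP e e10.
  have [Ge Ee _ y0e] := hxP _ eD n0.
  exists (hx (xe e)) => //; rewrite wE (Ee x0) // (Ee x1) // eqxx y0e hx_ys //.
  rewrite [x1 == x0]eq_sym (negPf x01) (negPf n1).
  have -> : [seq xe f \in hx (xe e) | f <- iota 0 10] = [seq f == e | f <- iota 0 10].
    apply/eq_in_map => f; rewrite mem_iota => /andP[_ f10]; have [fD m0 _ _ _] := xeP f f10.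
    rewrite Ee // [xe f == x0]eq_sym (negPf m0).
    have [ef|fe|->] := ltngtP f e; last by rewrite eqxx.
      by rewrite (negPf (xe_inj _ _ ef e10)) orbF.
    by rewrite eq_sym (negPf (xe_inj _ _ fe f10)) orbF.
  have -> : [seq z \in hx (xe e) | z <- zs'] = [seq nth false c e | c <- map col zs'].
    rewrite -map_comp; apply/eq_map => z /=.
    by rewrite (nth_map 0%N) ?size_iota // nth_iota.
  by [].
case/orP => /perm_map_perm[zs' pz eS]; have lz := lw _ pz; have := basisP _ pz;
  rewrite eS; apply: relabel lz _ => //; [exact: order_check1 | exact: order_check2].
Qed.
End Labelling.

(** * Codewords and M24 in coordinates *)

Section GolayCoordinates.
Context {Omega : finType}.
Variable G : {vspace {ffun Omega -> ('F_2)^o}}.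
Hypothesis Omega24 : #|Omega| = 24%N.
Hypothesis golayG : extended_golay G.
Variable w : seq Omega.
Hypothesis wG : golay_labelling G w.
Implicit Types (k : bitseq) (q : seq nat).
Local Notation cw := (codeword G).
Local Notation basis_keys := [seq b.2 | b <- golay_basis].

Let lw : labelling w. Proof. by case: wG. Qed.

Lemma golay_wordsE : golay_words = xor_span basis_keys.
Proof.
rewrite /golay_words /signed_words; elim: golay_basis => //= b B IH.
by rewrite map_cat -map_comp IH -IH -map_comp.
Qed.

Lemma basis_codeword b : b \in basis_keys -> size b = 24%N /\ cw (key_set w b).
Proof.
move=> bB; split; last by case/mapP: bB => c cB ->; case: wG => _; apply.
have : all (fun b => size b == 24) basis_keys by [].
by move/allP/(_ b bB)/eqP.
Qed.

Lemma golay_word_codeword k : k \in golay_words -> size k = 24%N /\ cw (key_set w k).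
Proof. by rewrite golay_wordsE; apply: (xor_span_codeword Omega24 lw); exact: basis_codeword. Qed.

Lemma key_set_inj k k' : size k = 24%N -> size k' = 24%N ->
  key_set w k = key_set w k' -> k = k'.
Proof. by move=> sk sk' kk'; rewrite -(key_of_set Omega24 lw sk) kk' key_of_set. Qed.

Lemma charvec_inj : injective (@charvec Omega).
Proof.
move=> A B /ffunP AB; apply/setP => x; have := AB x; rewrite !ffunE.
by case: (x \in A); case: (x \in B).
Qed.

Lemma size_xor_span (B : seq bitseq) k : (forall b, b \in B -> size b = 24%N) ->
  k \in xor_span B -> size k = 24%N.
Proof.
elim: B k => [|b B IH] k sB; first by rewrite inE => /eqP->; rewrite size_nseq.
have sB' c (cB : c \in B) : size c = 24%N by apply: sB; rewrite inE cB orbT.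
rewrite mem_cat => /orP[/(IH _ sB') //|/mapP[k' /(IH _ sB') sk' ->]].
by rewrite size_xor_key ?sk' sB ?mem_head.
Qed.

Lemma span_xor_span (B : seq bitseq) u : (forall b, b \in B -> size b = 24%N) ->
  u \in <<[seq charvec (key_set w b) | b <- B]>>%VS ->
  exists2 k, k \in xor_span B & u = charvec (key_set w k).
Proof.
elim: B u => [|b B IH] u sB.
  rewrite span_nil memv0 => /eqP->; exists (nseq 24 false); first exact: mem_head.
  by rewrite key_set0 // charvec0.
have sB' c (cB : c \in B) : size c = 24%N by apply: sB; rewrite inE cB orbT.
rewrite map_cons span_cons => /memv_addP[v /vlineP[a ->] [v' v'B ->]].
have [k kB ->] := IH v' sB' v'B.
rewrite F2_scale; case: eqP => _.
  by exists k; [rewrite /= mem_cat kB | rewrite add0r].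
have sk : size k = 24%N by apply: size_xor_span kB.
exists (xor_key b k); first by rewrite /= mem_cat map_f ?orbT.
by rewrite key_set_xor ?charvec_sdiff // sk sB ?mem_head.
Qed.

Fixpoint key_free (B : seq bitseq) : bool :=
  if B is b :: B' then (b \notin xor_span B') && key_free B' else true.

Lemma key_free_free (B : seq bitseq) : (forall b, b \in B -> size b = 24%N /\ cw (key_set w b)) ->
  key_free B -> free [seq charvec (key_set w b) | b <- B].
Proof.
elim: B => [|b B IH] BG; first by rewrite nil_free.
move=> /= /andP[bB fB]; have BG' c (cB : c \in B) : size c = 24%N /\ cw (key_set w c).
  by apply: BG; rewrite inE cB orbT.
rewrite free_cons IH // andbT; apply: contra bB.
move=> /(span_xor_span (fun c cB => (BG' c cB).1))[k kB /charvec_inj bk].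
have [sk _] := xor_span_codeword Omega24 lw BG' kB.
by rewrite (key_set_inj _ sk bk) // (BG b (mem_head _ _)).1.
Qed.

Lemma golay_basis_free : key_free basis_keys.
Proof. by vm_compute. Qed.

(** The twelve basis words are independent, so by dimension they span the code. *)
Lemma codeword_golay_word C : cw C -> exists2 k, k \in golay_words & C = key_set w k.
Proof.
have [dimG _] := golayG.
pose X := [seq charvec (key_set w b) | b <- basis_keys].
have fX : free X by apply: key_free_free golay_basis_free => b /basis_codeword.
have XG : (<<X>> <= G)%VS.
  by apply/span_subvP => v /mapP[b /basis_codeword[_ Gb] ->].
have /eqP <- : <<X>>%VS == G.
  by rewrite eqEdim XG dimG; move: fX; rewrite /free => /eqP->; rewrite !size_map.
rewrite /codeword => /(span_xor_span (fun b bB => (basis_codeword bB).1))[k kB /charvec_inj ->].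
by exists k; rewrite ?golay_wordsE.
Qed.

Lemma codeword_key k : size k = 24%N -> cw (key_set w k) = (k \in golay_words).
Proof.
move=> sk; apply/idP/idP => [/codeword_golay_word[k' k'W kk']|/golay_word_codeword[]//].
by have [sk' _] := golay_word_codeword k'W; rewrite (key_set_inj sk sk' kk').
Qed.

Lemma card_count (A : {set Omega}) : #|A| = count (mem A) w.
Proof.
have [uw sw] := lw; rewrite -size_filter -(card_uniqP (filter_uniq _ uw)).
by apply: eq_card => x; rewrite mem_filter labelling_mem // andbT.
Qed.

Lemma key_set_even a b : size a = 24%N -> size b = 24%N ->
  key_even a b = ~~ odd #|key_set w a :&: key_set w b|.
Proof. by move=> sa sb; rewrite card_count count_overlap !key_of_set. Qed.

Lemma even_codeword C : {in basis_keys, forall b, ~~ odd #|C :&: key_set w b|} -> cw C.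
Proof.
move=> CB; apply: (self_dual Omega24 golayG) => D /codeword_golay_word[k + ->] {D}.
rewrite golay_wordsE; have : forall b, b \in basis_keys -> size b = 24%N by move=> b /basis_codeword[].
elim: basis_keys k CB => [|b B IH] k CB sB.
  by rewrite inE => /eqP->; rewrite key_set0 // finset.setI0 cards0.
have BG' c : c \in B -> c \in b :: B by move=> cB; rewrite inE cB orbT.
have {}IH k' := IH k' (fun c cB => CB c (BG' c cB)) (fun c cB => sB c (BG' c cB)).
rewrite /= mem_cat => /orP[/IH //|/mapP[k' k'B ->]].
have sk' : size k' = 24%N by apply: size_xor_span k'B => c /BG' /sB.
have sb := sB b (mem_head _ _).
rewrite key_set_xor ?sb ?sk' // odd_setI_sdiff (negPf (IH _ k'B)) addbF.
by apply: CB; exact: mem_head.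
Qed.


Lemma golay_test_codeword k : golay_test k -> size k = 24%N /\ cw (key_set w k).
Proof.
move=> /andP[/eqP sk /allP kB]; split=> //; apply: even_codeword => _ /mapP[b bB ->].
have [sb _] := basis_codeword (map_f snd bB).
by rewrite -key_set_even //; exact: kB.
Qed.

Lemma M24P (s : {perm Omega}) :
  reflect (forall C, cw C -> cw (s @: C)) (s \in M24 G).
Proof.
apply: (iffP idP) => [sN C GC|sG].
  by move: GC; have := astabs_act C sN; rewrite !inE => <-.
rewrite /M24 2!inE; apply/andP; split; first by rewrite inE.
by apply/fintype.subsetP => C; rewrite !inE; exact: sG.
Qed.

Lemma M24_group1 : 1%g \in M24 G. Proof. exact: group1. Qed.
Lemma M24_groupM s t : s \in M24 G -> t \in M24 G -> (s * t)%g \in M24 G.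
Proof. exact: groupM. Qed.
Lemma M24_groupV s : (s^-1%g \in M24 G) = (s \in M24 G).
Proof. exact: groupV. Qed.

Definition perm_labels q (s : {perm Omega}) : Prop :=
  forall x0 i, (i < 24)%N -> s (nth x0 w i) = nth x0 w (nth 0%N q i).

Lemma perm_iota_lt q n i : perm_eq q (iota 0 n) -> (i < n)%N -> (nth 0%N q i < n)%N.
Proof.
move=> pq; have {1}<- : size q = n by rewrite (perm_size pq) size_iota.
by move=> /(mem_nth 0%N); rewrite (perm_mem pq) mem_iota.
Qed.

Lemma perm_labels_exists q : perm_eq q (iota 0 24) -> exists s, perm_labels q s.
Proof.
move=> pq; have [uw sw] := lw; have sq : size q = 24%N by rewrite (perm_size pq).
have uq : uniq q by rewrite (perm_uniq pq) iota_uniq.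
have q24 i := @perm_iota_lt q 24 i pq.
have wi x : (index x w < 24)%N by rewrite -sw index_mem labelling_mem.
pose f x := nth x w (nth 0%N q (index x w)).
have finj : injective f.
  move=> x y; rewrite /f (set_nth_default x) ?sw ?q24 // => /eqP.
  rewrite nth_uniq ?sw ?q24 // nth_uniq ?sq // => /eqP xy.
  by rewrite -(nth_index x (labelling_mem Omega24 x lw)) xy nth_index ?labelling_mem.
exists (perm finj) => x0 i i24; rewrite permE /f index_uniq ?sw //.
by apply: set_nth_default; rewrite sw q24.
Qed.

Lemma pull_key_set q s k : perm_eq q (iota 0 24) -> perm_labels q s ->
  key_set w (pull_key q k) = (s @^-1: key_set w k)%SET.
Proof.
move=> pq qs; have [uw sw] := lw; apply/setP => x; rewrite [RHS]inE !in_key_set //.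
have xw := labelling_mem Omega24 x lw; have := xw; rewrite -index_mem sw => x24.
rewrite (nth_map 0%N) ?(perm_size pq) // -{2}(nth_index x xw) qs // index_uniq ?sw //.
exact: perm_iota_lt.
Qed.

Lemma M24_of_preim (s : {perm Omega}) : (forall C, cw C -> cw (s @^-1: C)%SET) -> s \in M24 G.
Proof.
move=> sG; rewrite -M24_groupV; apply/M24P => C /sG; congr (codeword _ _).
by apply/setP => x; rewrite inE -{2}(permK s x) mem_imset //; exact: perm_inj.
Qed.

(** It is enough that s pulls the basis words back to codewords. *)
Lemma gen_M24 q (s : {perm Omega}) : gen_check q -> perm_labels q s -> s \in M24 G.
Proof.
move=> /and3P[pq /allP qB _] qs.
have preimB b : b \in basis_keys -> cw (s @^-1: key_set w b)%SET.
  case/mapP => c cB ->; rewrite -(pull_key_set _ pq qs).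
  by have [] := golay_test_codeword (qB _ cB).
apply: M24_of_preim => _ /codeword_golay_word[k + ->]; rewrite golay_wordsE.
have : forall b, b \in basis_keys -> size b = 24%N by move=> b /basis_codeword[].
elim: basis_keys k preimB => [|b B IH] k sB szB.
  rewrite inE => /eqP->; rewrite key_set0 // finset.preimset0; exact: codeword0.
have BG' c : c \in B -> c \in b :: B by move=> cB; rewrite inE cB orbT.
have {}IH k' := IH k' (fun c cB => sB c (BG' c cB)) (fun c cB => szB c (BG' c cB)).
rewrite /= mem_cat => /orP[/IH //|/mapP[k' k'B ->]].
have sk' : size k' = 24%N by apply: size_xor_span k'B => c /BG' /szB.
have sb := szB b (mem_head _ _); rewrite key_set_xor ?sb ?sk' //.
have -> : (s @^-1: sdiff (key_set w b) (key_set w k') =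
    sdiff (s @^-1: key_set w b) (s @^-1: key_set w k'))%SET by apply/setP => x; rewrite !inE.
by apply: codeword_sdiff; [apply: sB; exact: mem_head | exact: IH].
Qed.

End GolayCoordinates.

(** * Sign changes and tetrad reflections *)

Section Isometries.
Context {R : realType} {Omega : finType}.
Local Notation V := (euclid R Omega).
Local Notation tens g := (tensors R Omega g).

Definition sign_map (A : {set Omega}) (x : V) : V := [ffun i => (-1) ^+ (i \in A) * x i].
Lemma sign_map_linear A : linear (sign_map A).
Proof.
by move=> a x y; apply/ffunP => i; rewrite !ffunE mulrDr; congr (_ + _); rewrite /GRing.scale /= mulrCA.
Qed.
HB.instance Definition _ A := GRing.isLinear.Build R V V _ (sign_map A) (sign_map_linear A).

Definition refl_map (l : seq Omega) (x : V) : V :=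
  x - (2^-1 * \sum_(y <- l) (x y : R)) *: \sum_(y <- l) nu y.
Lemma refl_map_linear l : linear (refl_map l).
Proof.
move=> a x y; rewrite /refl_map.
have -> : \sum_(z <- l) ((a *: x + y) z : R) = a * (\sum_(z <- l) (x z : R)) + \sum_(z <- l) (y z : R).
  by rewrite mulr_sumr -big_split; apply: eq_bigr => z _; rewrite !ffunE.
by rewrite mulrDr scalerDl scalerBr scalerA mulrCA opprD addrACA.
Qed.
HB.instance Definition _ l := GRing.isLinear.Build R V V _ (refl_map l) (refl_map_linear l).

Lemma nuE (i j : Omega) : (nu i : V) j = (j == i)%:R. Proof. by rewrite ffunE. Qed.

Lemma sign_map_nu A i : sign_map A (nu i) = (-1) ^+ (i \in A) *: nu i.
Proof.
apply/ffunP => j; rewrite !ffunE; have [->|] := eqVneq j i => //.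
by rewrite mulr0 scaler0.
Qed.

Lemma sign_mapK A : involutive (sign_map A).
Proof. by move=> x; apply/ffunP => i; rewrite !ffunE mulrA -signr_addb addbb mul1r. Qed.

Lemma sum_nu_seq (l : seq Omega) i : uniq l -> (\sum_(y <- l) nu y : V) i = (i \in l)%:R.
Proof.
move=> ul; rewrite sum_ffunE; under eq_bigr do rewrite nuE.
elim: l ul => [|y l IH] /=; first by rewrite big_nil.
case/andP => yl ul; rewrite big_cons IH // inE; have [->|] := eqVneq i y => /=.
  by rewrite (negPf yl) addr0.
by rewrite add0r.
Qed.

Lemma sum_seq_nu (l : seq Omega) i : uniq l -> \sum_(y <- l) ((nu i : V) y : R) = (i \in l)%:R.
Proof.
move=> ul; rewrite -(sum_nu_seq i ul) sum_ffunE; apply: eq_bigr => y _.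
by rewrite !nuE eq_sym.
Qed.

Lemma refl_map_nu l i : uniq l -> i \notin l -> refl_map l (nu i) = nu i.
Proof. by move=> ul il; rewrite /refl_map sum_seq_nu // (negPf il) mulr0 scale0r subr0. Qed.

Lemma refl_mapK l : uniq l -> size l = 4%N -> involutive (refl_map l).
Proof.
move=> ul sl x; rewrite /refl_map; set u := \sum_(y <- l) nu y; set c : R := \sum_(y <- l) (x y : R).
have -> : \sum_(y <- l) ((x - (2^-1 * c) *: u) y : R) = - c.
  rewrite (eq_big_seq (fun y => (x y : R) - 2^-1 * c)) => [|y yl]; last first.
    by rewrite !ffunE /u sum_nu_seq // yl /GRing.scale /= mulr1.
  by rewrite sumrB -/c big_const_seq count_predT sl iter_addr_0; field.
by rewrite mulrN scaleNr opprK subrK.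
Qed.

Lemma extmap_comp g (f h : {linear V -> V}) (t : tens g) :
  extmap f (extmap h t) = extmap (f \o h) t.
Proof.
apply/ffunP => i; rewrite !ffunE.
under eq_bigr => k _ do rewrite ffunE mulr_sumr.
rewrite exchange_big /=; apply: eq_bigr => j _.
under eq_bigr => k _ do rewrite mulrA -big_split /=.
rewrite -mulr_suml; congr (_ * _).
rewrite -(bigA_distr_bigA (fun a x => (f (nu x) (i a) : R) * (h (nu (j a)) x : R))).
apply: eq_bigr => a _; rewrite {2}[h _]euclid_sum_nu linear_sum sum_ffunE.
by apply: eq_bigr => x _; rewrite linearZ /= ffunE mulrC.
Qed.

Lemma extmap_id g (f : {linear V -> V}) (t : tens g) : f =1 id -> extmap f t = t.
Proof.
move=> f1; apply/ffunP => i; rewrite ffunE (bigD1 i) //= big1 ?mul1r => [|a _]; last first.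
  by rewrite f1 nuE eqxx.
rewrite big1 ?addr0 ?mul1r // => j ji.
have [a ja] : exists a, i a != j a.
  apply/existsP; apply: contraNT ji; rewrite negb_exists => /forallP ij.
  by apply/eqP/ffunP => a; apply/esym/eqP; have := ij a; rewrite negbK.
by rewrite (bigD1 a) //= f1 nuE (negPf ja) !mul0r.
Qed.

Lemma extmapK g (f h : {linear V -> V}) : cancel f h -> cancel (@extmap R Omega g f) (extmap h).
Proof. by move=> fK t; rewrite extmap_comp extmap_id. Qed.

(** A reflection in a block fixes the factors outside the block, so on a
    multivector it acts through the table of its action inside the block. *)
Lemma extmap_refl g (l : seq Omega) (k : bitseq) (m1 m2 : seq V) :
  uniq l -> size l = 4%N -> size k = 4%N ->
  map (refl_map l) m1 = m1 -> map (refl_map l) m2 = m2 ->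
  2 *: extmap (refl_map l) (wedge_seq g (m1 ++ mask k (map nu l) ++ m2)) =
  \sum_(q <- refl_terms k) zr q.1 *: wedge_seq g (m1 ++ mask q.2 (map nu l) ++ m2).
Proof.
move=> ul sl sk e1 e2; rewrite extmap_wedge_seq !map_cat e1 e2.
set ps : seq V := map nu l; have sps : size ps = 4%N by rewrite size_map.
set p := mask k [:: 0; 1; 2; 3]%N.
have [x0 _] : exists x0, x0 \in l by case: (l) sl => [|x0 l'] // _; exists x0; rewrite mem_head.
have pE : mask k ps = [seq nth 0 ps i | i <- p].
  rewrite /p map_mask; congr (mask _ _).
  by rewrite -[[:: 0; 1; 2; 3]%N]/(iota 0 4) -sps map_nth_iota0 // take_size.
have p4 i : i \in p -> (i < 4)%N by move=> /mem_mask; rewrite !inE => /or4P[] /eqP->.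
pose a (x : V) : R := 2^-1 * \sum_(y <- l) (x y : R).
pose u : V := \sum_(y <- l) nu y.
have a_ps i : (i < 4)%N -> a (nth 0 ps i) = 2^-1.
  by move=> i4; rewrite /a (nth_map x0) ?sl // sum_seq_nu // mem_nth ?sl // mulr1.
have uE : u = \sum_(y <- [:: 0; 1; 2; 3]%N) nth 0 ps y.
  rewrite -[[:: 0; 1; 2; 3]%N]/(iota 0 4) -(big_map (nth 0 ps) predT id).
  by rewrite -sps map_nth_iota0 // take_size big_map.
rewrite -[map (refl_map l) _]/[seq x - a x *: u | x <- mask k ps] wedge_seq_transvection.
set W := wedge_seq g (m1 ++ mask k ps ++ m2).
pose N j y := wedge_seq g (m1 ++ (take j (mask k ps) ++ nth 0 ps y :: drop j.+1 (mask k ps)) ++ m2).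
have NE j y : (j < size p)%N -> (y < 4)%N ->
    N j y = if norm_key 4 (take j p ++ y :: drop j.+1 p) is Some (s, k')
            then (-1) ^+ s *: wedge_seq g (m1 ++ mask k' ps ++ m2) else 0.
  move=> jp y4; rewrite /N pE -map_take -map_drop -map_cons -map_cat wedge_seq_norm sps //.
  rewrite all_cat /= y4 /=; apply/andP; split; apply/allP => i.
    by move/mem_take/p4.
  by move/mem_drop/p4.
have sp : size (mask k ps) = size p by rewrite pE size_map.
have up : uniq p by apply: mask_uniq.
have jterm j : j \in iota 0 (size p) ->
    2 *: (a (nth 0 (mask k ps) j) *:
      wedge_seq g (m1 ++ (take j (mask k ps) ++ u :: drop j.+1 (mask k ps)) ++ m2)) =
    W + \sum_(y <- [seq y <- [:: 0; 1; 2; 3]%N | y != nth 0%N p j]) N j y.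
  rewrite mem_iota => /andP[_ jp]; have pj4 : (nth 0%N p j < 4)%N by apply/p4/mem_nth.
  rewrite {1}pE (nth_map 0%N) // a_ps // scalerA mulfV ?pnatr_eq0 // scale1r uE.
  have -> : wedge_seq g (m1 ++ (take j (mask k ps) ++ (\sum_(y <- [:: 0; 1; 2; 3]%N) nth 0 ps y) ::
      drop j.+1 (mask k ps)) ++ m2) = \sum_(y <- [:: 0; 1; 2; 3]%N) N j y.
    have assoc z : m1 ++ (take j (mask k ps) ++ z :: drop j.+1 (mask k ps)) ++ m2 =
        (m1 ++ take j (mask k ps)) ++ z :: (drop j.+1 (mask k ps) ++ m2) by rewrite -!catA.
    by rewrite assoc wedge_seq_sum; apply: eq_bigr => y _; rewrite /N assoc.
  have pj : nth 0%N p j \in [:: 0; 1; 2; 3]%N by move: (nth 0%N p j) pj4; case=> [|[|[|[]]]].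
  rewrite (bigD1_seq _ pj) // big_filter; congr (_ + _).
  rewrite /N /W; congr (wedge_seq g (m1 ++ _ ++ m2)).
  rewrite -[in RHS](cat_take_drop j (mask k ps)); congr (_ ++ _).
  by rewrite [RHS](drop_nth 0) ?sp // {2}pE (nth_map 0%N).
rewrite scalerBr scaler_sumr sp (eq_big_seq _ jterm) big_split big_const_seq count_predT size_iota.
rewrite iter_addr_0 opprD addrA /refl_terms big_cons; congr (_ + _).
  rewrite -/p -scaler_nat -scalerBl; congr (_ *: _).
  rewrite /zr -[Z.sub _ _]/(Zpos (xO xH) - Z_of_int (size p)) rmorphB.
  rewrite intrB; congr (_ - _).
  by have /= -> := Z_of_intK (size p).
rewrite big_flatten big_map -/p -sumrN; apply: eq_big_seq => j; rewrite mem_iota => /andP[_ jp].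
rewrite big_pmap -sumrN big_seq [RHS]big_seq; apply: eq_bigr => y.
rewrite mem_filter => /andP[_ y4]; rewrite NE //; last first.
  by move: y4; rewrite !inE => /or4P[] /eqP->.
case: (norm_key _ _) => [[s k']|]; rewrite /oapp /omap /obind /=; last by rewrite oppr0.
by rewrite -scaleNr zr_sgz; case: s; rewrite /= ?expr0 ?expr1 ?opprK.
Qed.

Lemma wedge_seq_signs g (A : {set Omega}) (s : seq Omega) (l2 : seq V) :
  wedge_seq g ([seq sign_map A (nu x) | x <- s] ++ l2) =
  (-1) ^+ odd (count (mem A) s) *: wedge_seq g ([seq nu x | x <- s] ++ l2).
Proof.
have H (l1 : seq V) : wedge_seq g (l1 ++ [seq sign_map A (nu x) | x <- s] ++ l2) =
    (-1) ^+ odd (count (mem A) s) *: wedge_seq g (l1 ++ [seq nu x | x <- s] ++ l2).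
  elim: s l1 => [|x s IH] l1 /=; first by rewrite scale1r.
  rewrite sign_map_nu wedge_seqZ -cat_rcons IH cat_rcons scalerA -signr_addb.
  by rewrite oddD oddb.
exact: (H [::]).
Qed.

End Isometries.

(** * The invariant multivector *)

(** The finite computations behind the invariance of t and the transitivity of M24. *)
Lemma gens_ok : all gen_check golay_gens. Proof. by vm_compute. Qed.
(** With r_j the reflection in the j-th tetrad and e the sign change on tetrad 0,
    xi = r_0 ... r_5 e fixes t iff r_2 r_1 r_0 t = r_3 r_4 r_5 e t, as the r_j
    are involutions.  Splitting the six reflections in two halves keeps the
    multivectors sparse. *)
Lemma xi_ok : trie_all0 (trie_add (refl_at 2 (refl_at 1 (refl_at 0 golay_trie)))
  (trie_scale (Zneg xH)
    (refl_at 3 (refl_at 4 (refl_at 5 (trie_sign (d := 4) (n := 20) golay_trie)))))).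
Proof. by vm_compute. Qed.
Lemma sift_ok : sift_check. Proof. by vm_compute. Qed.
Lemma transitive4_ok : transitive4_check. Proof. by vm_compute. Qed.
Lemma transitive_ok : transitive_check. Proof. by vm_compute. Qed.

Lemma golay_trieE :
  golay_trie = trie_sum (fun x => trie_single 24 x.2 (sgz x.1)) signed_words.
Proof. by []. Qed.

Opaque signed_words golay_trie trie_refl.

Section GolayTensor.
Context {R : realType} {Omega : finType}.
Local Notation V := (euclid R Omega).
Local Notation tens g := (tensors R Omega g).
Variable G : {vspace {ffun Omega -> ('F_2)^o}}.
Hypothesis Omega24 : #|Omega| = 24%N.
Hypothesis golayG : extended_golay G.
Variable w : seq Omega.
Hypothesis wG : golay_labelling G w.
Variable g : nat.
Local Notation cw := (codeword G).
Local Notation ps := [seq (nu x : V) | x <- w].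
Local Notation F := (fun k : bitseq => wedge_seq g (mask k ps)).

Let lw : labelling w. Proof. by case: wG. Qed.
Let sps : size ps = 24%N. Proof. by rewrite size_map; case: lw. Qed.

(** The multivector t, the sum of the +- beta_C over the codewords C of weight g. *)
Definition golay_tensor : tens g := ev F golay_trie.
Local Notation t := golay_tensor.

Lemma signed_words_size p : p \in signed_words -> size p.2 = 24%N.
Proof. by move=> pw; have [] := golay_word_codeword Omega24 wG (map_f snd pw). Qed.

Lemma golay_tensorE : t = \sum_(p <- signed_words) (-1) ^+ p.1 *: F p.2.
Proof.
rewrite /golay_tensor golay_trieE ev_sum; apply: eq_big_seq => p pw.
by rewrite ev_single ?zr_sgz // signed_words_size.
Qed.

Lemma extmap_golay_tensor (f : {linear V -> V}) :
  extmap f t = \sum_(p <- signed_words) (-1) ^+ p.1 *: wedge_seq g (map f (mask p.2 ps)).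
Proof.
rewrite golay_tensorE linear_sum; apply: eq_bigr => p _.
by rewrite linearZ /= extmap_wedge_seq.
Qed.

Lemma perm_euclid_labels q (s : {perm Omega}) : perm_eq q (iota 0 24) -> perm_labels w q s ->
  map (perm_euclid s) ps = [seq nth 0 ps i | i <- q].
Proof.
move=> pq qs; have [_ sw] := lw; apply: (@eq_from_nth _ 0).
  by rewrite !size_map (perm_size pq) size_iota.
move=> i; rewrite !size_map => iw; have [x0 _] : exists x0 : Omega, true.
  by case: (w) iw => [|x0 ?] // _; exists x0.
have i24 : (i < 24)%N by rewrite -sw.
rewrite (nth_map 0) ?size_map // (nth_map x0) // [RHS](nth_map 0%N) ?(perm_size pq) //.
by rewrite [RHS](nth_map x0) ?sw ?perm_iota_lt // perm_euclid_nu qs.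
Qed.

Lemma gen_tensor q (s : {perm Omega}) : gen_check q -> perm_labels w q s ->
  extmap (perm_euclid s) t = t.
Proof.
move=> /and3P[pq _ chk] qs; have psE := perm_euclid_labels pq qs.
have q24 k : all (gtn 24) (mask k q).
  by apply/allP => i /mem_mask; rewrite (perm_mem pq) mem_iota.
rewrite extmap_golay_tensor; apply/eqP; rewrite -subr_eq0; apply/eqP.
transitivity (ev F (trie_add
        (trie_sum (fun x => if norm_key 24 (mask x.2 q) is Some (s, k)
                            then trie_single 24 k (sgz (s (+) x.1)) else trie0 24)
           signed_words)
        (trie_scale (Zneg xH) golay_trie))); last exact: ev_all0 chk.
clear chk.
rewrite ev_add ev_scale ev_sum -[Zneg xH]/(sgz true) zr_sgz expr1 scaleN1r.
congr (_ - _); apply: eq_bigr => p _.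
rewrite map_mask psE -map_mask.
have := @wedge_seq_norm R Omega g ps (mask p.2 q) [::] [::]; rewrite !cats0 sps => -> //.
case E: (norm_key _ _) => [[s' k]|]; last by rewrite scaler0 ev0.
rewrite [mask k ps ++ _]cats0 (ev_single _ _ (norm_key_size E)) zr_sgz scalerA -signr_addb.
by rewrite addbC.
Qed.

(** The sign change on a codeword A multiplies beta_C by (-1)^|A :&: C| = 1. *)
Lemma sign_tensor A : cw A -> extmap (sign_map A) t = t.
Proof.
move=> GA; rewrite extmap_golay_tensor golay_tensorE; apply: eq_big_seq => p pw.
have [sp Gp] := golay_word_codeword Omega24 wG (map_f snd pw).
have := @wedge_seq_signs R Omega g A (mask p.2 w) [::]; rewrite !cats0 -!map_mask -map_comp => ->.
have -> : odd (count (mem A) (mask p.2 w)) = false.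
  apply/negbTE; have := codeword_even golayG GA Gp.
  congr (~~ odd _); rewrite -size_filter -(card_uniqP _) ?filter_uniq ?mask_uniq //; last by case: lw.
  by apply: eq_card => x; rewrite inE mem_filter inE.
by rewrite scale1r.
Qed.

Lemma trie_refl_tensor d n (w1 l w2 : seq Omega) (u : trie (d + (4 + n))) :
  w = w1 ++ l ++ w2 -> size w1 = d -> size l = 4%N -> size w2 = n ->
  ev F (trie_at (trie_refl (n := n)) u) = 2 *: extmap (refl_map l) (ev F u).
Proof.
move=> wE s1 sl s2; apply: ev_at => k {}u sk; apply: ev_refl => k4 r sk4 sr.
have [] := lw; rewrite {1}wE !cat_uniq => /and3P[u1 n1 /and3P[ul n2 u2]] _.
have maskE k' : size k' = 4%N -> mask (k ++ k' ++ r) ps =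
    mask k (map nu w1) ++ mask k' (map nu l) ++ mask r (map nu w2) :> seq V.
  by move=> sk'; rewrite wE !map_cat !mask_cat // size_map ?sk ?s1 ?sk' ?sl.
have fixed v m : (forall x, x \in v -> x \notin l) ->
    map (refl_map l) (mask m (map nu v)) = mask m (map nu v) :> seq V.
  move=> vl; rewrite -map_mask -map_comp; apply/eq_in_map => x /mem_mask/vl xl.
  exact: refl_map_nu.
cbv beta; rewrite maskE // extmap_refl ?fixed // => [|x xw1|x xw2].
- rewrite big_seq [RHS]big_seq; apply: eq_bigr => q qk; rewrite maskE //.
  have : all (fun k => all (fun q => size q.2 == 4) (refl_terms k)) (all_keys 4) by [].
  have kk := mem_all_keys k4; rewrite sk4 in kk.
  by move=> /allP/(_ k4 kk)/allP/(_ q qk)/eqP.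
- by apply: contra n1 => xl; apply/hasP; exists x; rewrite // mem_cat xl.
- by move/hasPn: n2 => /(_ x xw2).
Qed.

Definition tetrad j : seq Omega := take 4 (drop (4 * j)%N w).

Lemma tetrad_size j : (j < 6)%N -> size (tetrad j) = 4%N.
Proof. by move=> j6; have [_ sw] := lw; rewrite size_take size_drop sw; case: ifP => //; lia. Qed.

Lemma tetrad_uniq j : uniq (tetrad j).
Proof. by have [uw _] := lw; rewrite take_uniq // drop_uniq. Qed.

Lemma refl_at_tensor j u : (j < 6)%N ->
  ev F (refl_at j u) = 2 *: extmap (refl_map (tetrad j)) (ev F u).
Proof.
have [_ sw] := lw.
have wE i : (i < 6)%N -> w = take (4 * i)%N w ++ tetrad i ++ drop (4 * i + 4)%N w.
  by move=> i6; rewrite /tetrad addnC -drop_drop !cat_take_drop.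
have st i : (i < 6)%N -> size (take (4 * i)%N w) = (4 * i)%N by move=> i6; rewrite size_take sw; case: ifP => //; lia.
have sd i : size (drop (4 * i + 4)%N w) = (24 - (4 * i + 4))%N by rewrite size_drop sw.
case: j => [|[|[|[|[|[|//]]]]]] j6.
- exact: (@trie_refl_tensor 0 20 _ _ _ u (wE 0%N j6) (st 0%N j6) (tetrad_size j6) (sd 0%N)).
- exact: (@trie_refl_tensor 4 16 _ _ _ u (wE 1%N j6) (st 1%N j6) (tetrad_size j6) (sd 1%N)).
- exact: (@trie_refl_tensor 8 12 _ _ _ u (wE 2%N j6) (st 2%N j6) (tetrad_size j6) (sd 2%N)).
- exact: (@trie_refl_tensor 12 8 _ _ _ u (wE 3%N j6) (st 3%N j6) (tetrad_size j6) (sd 3%N)).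
- exact: (@trie_refl_tensor 16 4 _ _ _ u (wE 4%N j6) (st 4%N j6) (tetrad_size j6) (sd 4%N)).
- exact: (@trie_refl_tensor 20 0 _ _ _ u (wE 5%N j6) (st 5%N j6) (tetrad_size j6) (sd 5%N)).
Qed.

Definition tetrad_set : {set Omega} := [set x in tetrad 0]%SET.

Lemma trie_sign_tensor :
  ev F (trie_sign (d := 4) (n := 20) golay_trie) = extmap (sign_map tetrad_set) t.
Proof.
rewrite ev_sign /golay_tensor -[extmap _ _]scale1r.
rewrite (@ev_lin _ _ 24 unit [:: tt] (fun=> 1) 1 _ _ (fun _ k => (-1) ^+ odd (count id (take 4 k)) *: F k)).
  by rewrite big_seq1 scale1r.
move=> k sk; rewrite big_seq1 !scale1r /= extmap_wedge_seq -map_mask -map_comp.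
have := @wedge_seq_signs R Omega g tetrad_set (mask k w) [::]; rewrite !cats0 => ->.
have tE x : (x \in tetrad_set) = (x \in take 4 w) by rewrite inE /tetrad muln0 drop0.
have [uw sw] := lw; congr ((-1) ^+ _ *: _); congr odd.
rewrite -[in LHS](cat_take_drop 4 w) -[in LHS](cat_take_drop 4 k).
rewrite mask_cat ?size_take ?sw ?sk // count_cat.
have -> : count (mem tetrad_set) (mask (drop 4 k) (drop 4 w)) = 0%N.
  apply/eqP; rewrite -leqn0 leqNgt -has_count; apply/hasPn => x /mem_mask xd.
  change (x \notin tetrad_set); rewrite tE; move: uw; rewrite -{1}(cat_take_drop 4 w) cat_uniq.
  by case/and3P => _ /hasPn/(_ x xd).
rewrite addn0 -(size_mask (m := take 4 k) (s := take 4 w)) ?size_take ?sw ?sk //.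
apply/eqP; rewrite -all_count; apply/allP => x /mem_mask xT.
by change (x \in tetrad_set); rewrite tE.
Qed.

(** Conway's isometry, which is not monomial: on a tetrad it is the sign change
    followed by a reflection, on the five others only the reflection. *)
Definition xi : {linear V -> V} :=
  refl_map (tetrad 0) \o refl_map (tetrad 1) \o refl_map (tetrad 2) \o
  refl_map (tetrad 3) \o refl_map (tetrad 4) \o refl_map (tetrad 5) \o sign_map tetrad_set.

Lemma refl_extmapK j : (j < 6)%N -> involutive (@extmap R Omega g (refl_map (tetrad j))).
Proof.
by move=> j6; apply: extmapK; apply: refl_mapK; rewrite ?tetrad_size ?tetrad_uniq.
Qed.

Lemma scaled_halves (W : lmodType R) (f : nat -> {linear W -> W}) (c : R) (x y : W) :
  c != 0 -> c *: f 2%N (c *: f 1%N (c *: f 0%N x)) - c *: f 3%N (c *: f 4%N (c *: f 5%N y)) = 0 ->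
  f 2%N (f 1%N (f 0%N x)) = f 3%N (f 4%N (f 5%N y)).
Proof.
move=> c0 /eqP; rewrite subr_eq0 => /eqP; rewrite !linearZ /= !scalerA => e.
by apply: scalerI e; rewrite !mulf_neq0.
Qed.

Let r j : {linear tens g -> tens g} := @extmap R Omega g (refl_map (tetrad j)).

Lemma refl_at_r j u : (j < 6)%N -> ev F (refl_at j u) = 2 *: r j (ev F u).
Proof. exact: refl_at_tensor. Qed.

Lemma refl_at_halves (u v : trie 24) :
  trie_all0 (trie_add (refl_at 2 (refl_at 1 (refl_at 0 u)))
    (trie_scale (Zneg xH) (refl_at 3 (refl_at 4 (refl_at 5 v))))) ->
  r 2 (r 1 (r 0 (ev F u))) = r 3 (r 4 (r 5 (ev F v))).
Proof.
move/(ev_all0 F); rewrite ev_add ev_scale -[Zneg xH]/(sgz true) zr_sgz expr1 scaleN1r.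
have two : 2 != 0 :> R by rewrite pnatr_eq0.
move: r refl_at_r => f fE; rewrite !fE //; exact: scaled_halves.
Qed.

Lemma xi_tensor : extmap xi t = t.
Proof.
have xiE x : extmap xi x = r 0 (r 1 (r 2 (r 3 (r 4 (r 5 (extmap (sign_map tetrad_set) x)))))).
  by rewrite /r /xi -!extmap_comp.
have half := @refl_at_halves golay_trie (trie_sign (d := 4) (n := 20) golay_trie) xi_ok.
have e := etrans half (f_equal (fun z => r 3 (r 4 (r 5 z))) trie_sign_tensor).
have rK j : (j < 6)%N -> involutive (r j) by exact: refl_extmapK.
rewrite xiE; move: (extmap (sign_map tetrad_set) t) e => y.
rewrite /golay_tensor; clear half xiE.
move: (ev _ golay_trie) => x.
move: r rK => f fK <-.
by rewrite !fK.
Qed.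

End GolayTensor.

(** * M24 by sifting *)

Section Sifting.
Context {R : realType} {Omega : finType}.
Local Notation V := (euclid R Omega).
Variable G : {vspace {ffun Omega -> ('F_2)^o}}.
Hypothesis Omega24 : #|Omega| = 24%N.
Hypothesis golayG : extended_golay G.
Variable w : seq Omega.
Hypothesis wG : golay_labelling G w.
Variable g : nat.
Variable z0 : Omega.
Local Notation cw := (codeword G).
Local Notation t := (golay_tensor (R := R) w g).
Local Notation lab i := (nth z0 w i).

Let lw : labelling w. Proof. by case: wG. Qed.

Definition M24_fixing (s : {perm Omega}) : Prop :=
  s \in M24 G /\ extmap (perm_euclid s) t = t.

Lemma extmap_permM g' (s u : {perm Omega}) (x : tensors R Omega g') :
  extmap (perm_euclid (s * u)%g) x = extmap (perm_euclid u) (extmap (perm_euclid s) x).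
Proof.
rewrite extmap_comp; apply/ffunP => i; rewrite !ffunE; apply: eq_bigr => j _.
by congr (_ * _); apply: eq_bigr => a _; rewrite /= !perm_euclid_nu permM.
Qed.

Lemma extmap_perm1 g' (x : tensors R Omega g') : extmap (perm_euclid 1%g) x = x.
Proof. by apply: extmap_id => y; apply/ffunP => i; rewrite ffunE invg1 perm1. Qed.

Lemma fixing1 : M24_fixing 1%g.
Proof. by split; [exact: M24_group1 | exact: extmap_perm1]. Qed.

Lemma fixingM s u : M24_fixing s -> M24_fixing u -> M24_fixing (s * u)%g.
Proof.
by move=> [sG st] [uG ut]; split; [exact: M24_groupM | rewrite extmap_permM st ut].
Qed.

Lemma fixingV s : M24_fixing s -> M24_fixing s^-1%g.
Proof.
move=> [sG st]; split; first by rewrite M24_groupV.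
by rewrite -[in LHS]st -extmap_permM mulgV extmap_perm1.
Qed.

Lemma gen_fixing q s : q \in golay_gens -> perm_labels w q s -> M24_fixing s.
Proof.
move=> qg qs; have qc := allP gens_ok q qg; split.
  exact: (gen_M24 Omega24 golayG wG qc qs).
exact: (gen_tensor Omega24 wG g qc qs).
Qed.

Definition fixes (P : seq nat) (s : {perm Omega}) : Prop := forall i, i \in P -> s (lab i) = lab i.

Lemma lab_index x : lab (index x w) = x.
Proof. by rewrite nth_index ?labelling_mem. Qed.

Lemma index_lt x : (index x w < 24)%N.
Proof. by case: lw => _ <-; rewrite index_mem labelling_mem. Qed.

Lemma lab_inj i j : (i < 24)%N -> (j < 24)%N -> lab i = lab j -> i = j.
Proof. by move=> i24 j24 /eqP; case: lw => uw sw; rewrite nth_uniq ?sw // => /eqP. Qed.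

Lemma gen_orbitP P b j : (b < 24)%N -> {in P, forall i, (i < 24)%N} -> j \in gen_orbit (fixing P) b ->
  (j < 24)%N /\ exists s, [/\ M24_fixing s, fixes P s & s (lab b) = lab j].
Proof.
move=> b24 P24; suff H n : forall j,
    j \in iter n (fun S => undup (S ++ [seq nth 0%N q j | q <- fixing P, j <- S])) [:: b] ->
    (j < 24)%N /\ exists s, [/\ M24_fixing s, fixes P s & s (lab b) = lab j] by exact: H.
elim: n {j} => [|n IH] j.
  rewrite inE => /eqP->; split=> //; exists 1%g; split; first exact: fixing1.
    by move=> i _; rewrite perm1.
  by rewrite perm1.
rewrite iterS mem_undup mem_cat => /orP[jn|]; first exact: IH.
case/allpairsP => -[q i] /= [qP iS ->]; have [i24 [s [sK sP sb]]] := IH i iS.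
move: qP; rewrite mem_filter => /andP[/allP qP qg].
have /and3P[pq _ _] := allP gens_ok q qg.
have [u qu] := perm_labels_exists Omega24 wG pq.
split; first exact: perm_iota_lt.
exists (s * u)%g; split; first exact: fixingM sK (gen_fixing qg qu).
  by move=> l lP; rewrite permM sP // qu ?P24 // (eqP (qP l lP)).
by rewrite permM sb qu.
Qed.

Lemma size_octad o : o \in golay_octads -> [/\ size o = 24%N, cw (key_set w o) & #|key_set w o| = 8%N].
Proof.
rewrite mem_filter => /andP[/eqP o8 /(golay_word_codeword Omega24 wG)[so Go]]; split=> //.
by rewrite (card_count Omega24 wG) -o8 -{2}(key_of_set Omega24 lw so) count_map.
Qed.

(** The image of the octad shares five points with it; their sum has fewer than
    8 points, so they coincide. *)
Lemma octad_fixed s P o : s \in M24 G -> fixes P s -> uniq P -> {in P, forall i, (i < 24)%N} ->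
  o \in golay_octads -> (5 <= count (nth false o) P)%N -> s @: key_set w o = key_set w o.
Proof.
move=> sG sP uP P24 /size_octad[so Go o8] P5.
have Gso : cw (s @: key_set w o) by apply/M24P.
have so8 : #|s @: key_set w o| = 8%N by rewrite card_imset //; exact: perm_inj.
have meet : (5 <= #|s @: key_set w o :&: key_set w o|)%N.
  have uL : uniq [seq lab i | i <- P & nth false o i].
    rewrite map_inj_in_uniq ?filter_uniq // => i j; rewrite !mem_filter => /andP[_ iP] /andP[_ jP].
    by apply: lab_inj; exact: P24.
  apply: leq_trans P5 _; rewrite -size_filter -(size_map (fun i => lab i)) -(card_uniqP uL).
  apply/subset_leq_card/fintype.subsetP => y /mapP[i]; rewrite mem_filter => /andP[oi iP] ->.
  have lo : lab i \in key_set w o by rewrite in_key_set // index_uniq ?P24 //; case: lw => // _ ->; exact: P24.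
  by rewrite inE lo andbT -(sP i iP) imset_f.
have := card_sdiff (s @: key_set w o) (key_set w o); rewrite so8 o8 => eq.
have lt8 : (#|sdiff (s @: key_set w o) (key_set w o)| < 8)%N by lia.
have s0 := codeword_short golayG (codeword_sdiff Gso Go) lt8.
by apply/setP => x; move/setP/(_ x): s0; rewrite in_sdiff finset.in_set0; do 2!case: (x \in _).
Qed.

Lemma sift_base_perm : perm_eq sift_base (iota 0 24).
Proof. by []. Qed.

(** An element fixing the first base points sends the next one inside the atom
    that the octads allow, hence into the orbit computed from the generators; so
    multiplying by a product of generators makes it fix one more base point.
    In the end the identity is reached, and the element is a product of
    generators. *)
Lemma sift m s : (m <= 24)%N -> s \in M24 G -> fixes (take (24 - m) sift_base) s -> M24_fixing s.
Proof.
have pb := sift_base_perm; have ub : uniq sift_base by rewrite (perm_uniq pb) iota_uniq.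
have b24 i : i \in sift_base -> (i < 24)%N by rewrite (perm_mem pb) mem_iota.
elim: m s => [|m IH] s m24 sG sP.
  have -> : s = 1%g; last exact: fixing1.
  apply/permP => x; rewrite perm1 -(lab_index x) sP // subn0 take_oversize //.
  by rewrite (perm_mem pb) mem_iota index_lt.
set k := (24 - m.+1)%N in sP; have k24 : (k < 24)%N by rewrite /k; lia.
have kS : (24 - m = k.+1)%N by rewrite /k; lia.
set P := take k sift_base in sP; set b := nth 0%N sift_base k.
have bB : b \in sift_base by rewrite mem_nth.
have PB i : i \in P -> i \in sift_base by apply: mem_take.
have bP : b \notin P.
  move: ub; rewrite -(cat_take_drop k sift_base) cat_uniq => /and3P[_ /hasPn nP _].
  by apply: nP; rewrite (drop_nth 0%N) // mem_head.
have P24 : {in P, forall i, (i < 24)%N} by move=> i /PB/b24.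
have uP : uniq P by rewrite take_uniq.
pose j := index (s (lab b)) w; have j24 : (j < 24)%N := index_lt _.
have jC : j \in sift_cand P b.
  rewrite mem_filter mem_iota leq0n j24 !andbT; apply/andP; split.
    apply/negP => jP; have := sP _ jP; rewrite lab_index => /perm_inj e.
    by case/negP: bP; rewrite -(lab_inj j24 (b24 _ bB) _) // /j lab_index.
  apply/allP => o; rewrite mem_filter => /andP[P5 oO]; have [so Go _] := size_octad oO.
  have fo := octad_fixed sG sP uP P24 oO P5.
  have := in_key_set Omega24 o (s (lab b)) lw; rewrite -/j => <-.
  rewrite -fo mem_imset ?in_key_set //; last exact: perm_inj.
  by have [uw sw] := lw; rewrite index_uniq ?sw // b24.
have jO : j \in gen_orbit (fixing P) b.
  by have := sift_ok; rewrite /sift_check => /allP/(_ k); rewrite mem_iota => /(_ k24)/allP/(_ j jC).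
have [_ [u [uK uP' ub']]] := gen_orbitP (b24 _ bB) P24 jO.
have e : s = (s * u^-1 * u)%g by rewrite mulgKV.
have [uVG _] := fixingV uK; rewrite e; apply: fixingM uK.
apply: IH; [exact: ltnW | exact: M24_groupM | rewrite kS (take_nth 0%N) // => i].
rewrite mem_rcons inE permM => /orP[/eqP->|iP].
  by rewrite -/b -[s (lab b)]lab_index -/j -ub' permK.
by rewrite sP // -{1}(uP' i iP) permK.
Qed.

Theorem M24_tensor s : s \in M24 G -> extmap (perm_euclid s) t = t.
Proof. by move=> sG; have [] := @sift 24 s (leqnn _) sG (fun i => _). Qed.

(** The images are adjusted one at a time, using the orbit of each label under the
    generators that fix the previous ones. *)
Lemma transitive4 n (a : nat -> Omega) : (n <= 4)%N ->
  (forall i j, (i < j)%N -> (j < n)%N -> a i != a j) ->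
  exists2 s, M24_fixing s & forall i, (i < n)%N -> s (lab i) = a i.
Proof.
elim: n => [|n IH] n4 aP; first by exists 1%g => //; exact: fixing1.
have [|i j ij jn|u uK ua] := IH; first exact: ltnW.
  by apply: aP => //; exact: leqW.
pose j := index (u^-1%g (a n)) w; have j24 : (j < 24)%N := index_lt _.
have n24 : (n < 24)%N by apply: leq_trans n4 _.
have P24 : {in iota 0 n, forall i, (i < 24)%N}.
  by move=> i; rewrite mem_iota => /andP[_ /ltn_trans]; apply.
have jn : j \notin iota 0 n.
  rewrite mem_iota add0n; apply/negP => jn; have := ua j jn; rewrite lab_index permKV => e.
  by have := aP j n jn (leqnn _); rewrite e eqxx.
have jO : j \in gen_orbit (fixing (iota 0 n)) n.
  have := transitive4_ok; rewrite /transitive4_check => /allP/(_ n).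
  by rewrite mem_iota => /(_ n4)/allP/(_ j); rewrite mem_iota (negPf jn) => /(_ j24).
have [_ [v [vK vP vb]]] := gen_orbitP n24 P24 jO.
exists (v * u)%g; first exact: fixingM.
move=> i; rewrite ltnS leq_eqVlt permM => /orP[/eqP->|i_n].
  by rewrite vb lab_index permKV.
by rewrite vP ?mem_iota // ua.
Qed.

(** The lexicographic order of keys is turned into the order of integers, which
    is the measure of the descent to the representatives. *)
Fixpoint key_value (k : bitseq) : nat :=
  if k is x :: k' then (~~ x * 2 ^ size k' + key_value k')%N else 0%N.

Lemma key_value_lt k : (key_value k < 2 ^ size k)%N.
Proof. by elim: k => //= x k IH; rewrite expnS; case: x => /=; lia. Qed.

Lemma lex_lt_value a b : size a = size b -> lex_lt a b -> (key_value a < key_value b)%N.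
Proof.
elim: a b => [|x a IH] [|y b] //= [sab]; have := key_value_lt a; rewrite sab.
by case: eqP => [-> + /(IH _ sab)|]; case: x; case: y => //=; lia.
Qed.

Lemma pull_word_M24 l k : size k = 24%N -> {in l, forall i, (i < size golay_gens)%N} ->
  size (pull_word l k) = 24%N /\
  exists2 s, s \in M24 G & key_set w (pull_word l k) = (s @^-1: key_set w k)%SET.
Proof.
elim: l k => [|i l IH] k sk lP.
  by split=> //; exists 1%g; [exact: M24_group1 | apply/setP => x; rewrite [RHS]inE perm1].
have qg : nth [::] golay_gens i \in golay_gens by rewrite mem_nth // lP // mem_head.
have /and3P[pq _ _] := allP gens_ok _ qg.
have [u qu] := perm_labels_exists Omega24 wG pq; have [uG _] := gen_fixing qg qu.
have sk' : size (pull_key (nth [::] golay_gens i) k) = 24%N by rewrite size_map (perm_size pq).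
have [|s' [s sG e]] := IH _ sk'; first by move=> j jl; apply: lP; rewrite inE jl orbT.
split=> //; exists (s * u)%g; first exact: M24_groupM.
rewrite [LHS]e (pull_key_set Omega24 wG _ pq qu).
by apply/setP => x; rewrite !inE permM.
Qed.

Lemma golay_word_rep k : k \in golay_words ->
  exists2 r, r \in golay_reps & exists2 s, s \in M24 G & key_set w r = (s @^-1: key_set w k)%SET.
Proof.
have [n] := ubnP (key_value k); elim: n k => // n IH k kn kW.
have [sk Gk] := golay_word_codeword Omega24 wG kW.
have /orP[kr|/hasP[l ll lk]] : descends k.
  by have := transitive_ok; rewrite /transitive_check => /allP; apply.
  by exists k => //; exists 1%g; [exact: M24_group1 | apply/setP => x; rewrite [RHS]inE perm1].
have lP : {in l, forall i, (i < size golay_gens)%N}.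
  have /allP/(_ l ll)/allP : all (all (gtn (size golay_gens))) descent_words by [].
  by [].
have [sl [s sG e]] := pull_word_M24 sk lP.
have pW : pull_word l k \in golay_words.
  rewrite -(codeword_key Omega24 golayG wG) // e -[(s @^-1: _)%SET]/(s @^-1: key_set w k)%SET.
  have -> : (s @^-1: key_set w k = s^-1%g @: key_set w k)%SET.
    by apply/setP => x; rewrite inE -{2}(permK s x) mem_imset //; exact: perm_inj.
  by apply/M24P => //; rewrite M24_groupV.
have lt_n : (key_value (pull_word l k) < n)%N.
  by rewrite ltnS in kn; apply: leq_trans kn; apply: lex_lt_value lk; rewrite sl sk.
have [r rr [u uG e']] := IH _ lt_n pW.
exists r => //; exists (u * s)%g; first exact: M24_groupM.
by rewrite e' e; apply/setP => x; rewrite !inE permM.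
Qed.

Theorem M24_transitive C D : cw C -> cw D -> #|C| = #|D| ->
  exists2 s : {perm Omega}, s \in M24 G & s @: C = D.
Proof.
move=> /(codeword_golay_word Omega24 golayG wG)[k kW ->].
move=> /(codeword_golay_word Omega24 golayG wG)[k' k'W ->] cardE.
have [r rr [s sG e]] := golay_word_rep kW; have [r' rr' [s' sG' e']] := golay_word_rep k'W.
have card_preim (u : {perm Omega}) (A : {set Omega}) : #|(u @^-1: A)%SET| = #|A|.
  by apply: card_preimset; exact: perm_inj.
have rr_eq : r = r'.
  have : all (fun r => all (fun r' => (count id r == count id r') ==> (r == r')) golay_reps) golay_reps.
    by vm_compute.
  move=> /allP/(_ r rr)/allP/(_ r' rr'); have size24 : all (fun r => size r == 24) golay_reps by [].
  have cnt q : q \in golay_reps -> count id q = #|key_set w q|.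
    move=> /(allP size24)/eqP sq; rewrite (card_count Omega24 wG).
    by rewrite -{1}(key_of_set Omega24 lw sq) count_map.
  by rewrite !cnt // e e' !card_preim cardE eqxx => /eqP.
exists (s^-1 * s')%g; first by apply: M24_groupM => //; rewrite M24_groupV.
apply/setP => x; rewrite -[x in LHS](permKV (s^-1 * s')%g) mem_imset; last exact: perm_inj.
rewrite invMg invgK permM; have /setP/(_ (s'^-1%g x)) := etrans (esym e) (etrans (f_equal _ rr_eq) e').
by rewrite !inE permKV.
Qed.

End Sifting.

(** * Coordinates of Leech vectors *)

Lemma int_mod2 (a : int) : a = (~~ (2 %| a)%Z)%:Z + 2 * (a %/ 2)%Z.
Proof. by case: (boolP (2 %| a)%Z) => h /=; lia. Qed.

Section LeechCoordinates.
Context {R : realType} {Omega : finType}.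
Local Notation V := (euclid R Omega).
Local Notation zvec := {ffun Omega -> int}.
Variable G : {vspace {ffun Omega -> ('F_2)^o}}.
Hypothesis Omega24 : #|Omega| = 24%N.
Hypothesis golayG : extended_golay G.
Local Notation cw := (codeword G).
Local Notation L := (leech R G).
Implicit Types (z u : zvec) (C D : {set Omega}).

Definition ivec (z : zvec) : V := [ffun i => (Num.sqrt 8)^-1 * (z i)%:~R].

Lemma sqrt8_neq0 : Num.sqrt 8 != 0 :> R.
Proof. by rewrite sqrtr_eq0 -ltNge ltr0n. Qed.

Lemma ivecB z u : ivec (z - u) = ivec z - ivec u.
Proof. by apply/ffunP => i; rewrite !ffunE intrD mulrDr rmorphN mulrN. Qed.

Lemma ivec0 : ivec 0 = 0.
Proof. by apply/ffunP => i; rewrite !ffunE mulr0. Qed.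

Lemma ivec_inj : injective ivec.
Proof.
move=> z u /ffunP zu; apply/ffunP => i; have := zu i; rewrite !ffunE.
by move/(mulfI (invr_neq0 sqrt8_neq0))/eqP; rewrite eqr_int => /eqP.
Qed.

(** The usual congruences of the Leech lattice, in coordinates scaled by sqrt 8:
    together they say that all coordinates have one parity m, that for each
    residue modulo 4 the coordinates with that residue occupy a codeword, and
    that the sum is 4m modulo 8. *)
Definition leech_cond (z : zvec) : Prop :=
  (forall i, (8 %| \sum_j z j - 4 * z i)%Z) /\
  (forall C, cw C -> (4 %| \sum_(i in C) z i)%Z).

Definition set_vec (a : int) (C : {set Omega}) : zvec := [ffun i => a * (i \in C)%:Z].

Lemma sum_set_vec a C D : \sum_(i in D) set_vec a C i = a * #|C :&: D|%:Z.
Proof.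
under eq_bigr do rewrite ffunE.
rewrite -mulr_sumr; congr (_ * _); rewrite -sum1_card (big_morph Posz PoszD erefl).
rewrite [LHS]big_mkcond [RHS]big_mkcond; apply: eq_bigr => i _; rewrite inE.
by case: (i \in C); case: (i \in D).
Qed.

Lemma sum_set_vecT a C : \sum_i set_vec a C i = a * #|C|%:Z.
Proof.
rewrite -[C in RHS]finset.setIT -sum_set_vec; apply: eq_bigl => i; rewrite inE //.
Qed.

Lemma leech_condB z u : leech_cond z -> leech_cond u -> leech_cond (z - u).
Proof.
move=> [A1 B1] [A2 B2]; split=> [i|C GC].
  have -> : \sum_j (z - u) j = \sum_j z j - \sum_j u j.
    by rewrite -sumrB; apply: eq_bigr => j _; rewrite !ffunE.
  rewrite !ffunE (_ : _ - _ = (\sum_j z j - 4 * z i) - (\sum_j u j - 4 * u i)); last by ring.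
  exact: rpredB.
have -> : \sum_(j in C) (z - u) j = \sum_(j in C) z j - \sum_(j in C) u j.
  by rewrite -sumrB; apply: eq_bigr => j _; rewrite !ffunE.
by apply: rpredB; [exact: B1 | exact: B2].
Qed.

Lemma codeword_card4 C : cw C -> (#|C| %% 4 = 0)%N.
Proof. by move=> /(codeword_card golayG); rewrite !inE => /or4P[|||/orP[]] /eqP->. Qed.

Lemma leech_cond_codeword C : cw C -> leech_cond (set_vec 2 C).
Proof.
move=> GC; have c4 := codeword_card4 GC; split=> [i|D GD].
  by rewrite sum_set_vecT ffunE; case: (i \in C) => /=; lia.
by rewrite sum_set_vec; have := codeword_even golayG GC GD; lia.
Qed.

Lemma leech_cond0 : leech_cond 0.
Proof. by split=> [i|C _]; rewrite ?big1 ?ffunE // => j _; rewrite ffunE. Qed.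

Lemma leech_condD z u : leech_cond z -> leech_cond u -> leech_cond (z + u).
Proof.
move=> cz cu; rewrite -[u]opprK -[- u]sub0r; apply: leech_condB => //.
exact: leech_condB leech_cond0 cu.
Qed.

Definition leech_gen i : zvec := set_vec 1 [set: Omega]%SET - set_vec 4 [set i]%SET.

Lemma leech_genE i j : leech_gen i j = 1 - 4 * (j == i)%:Z.
Proof. by rewrite !ffunE !inE mulr1. Qed.

Lemma leech_cond_gen i : leech_cond (leech_gen i).
Proof.
split=> [j|C GC].
  have -> : \sum_j leech_gen i j = 20.
    have -> : \sum_j leech_gen i j = \sum_j set_vec 1 [set: Omega]%SET j - \sum_j set_vec 4 [set i]%SET j.
      by rewrite -sumrB; apply: eq_bigr => k _; rewrite !ffunE.
    by rewrite !sum_set_vecT cardsT Omega24 cards1.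
  by rewrite leech_genE; case: (j == i).
have -> : \sum_(j in C) leech_gen i j = \sum_(j in C) set_vec 1 [set: Omega]%SET j - \sum_(j in C) set_vec 4 [set i]%SET j.
  by rewrite -sumrB; apply: eq_bigr => k _; rewrite !ffunE.
by rewrite !sum_set_vec finset.setTI; have := codeword_card4 GC; lia.
Qed.

Lemma leech0 : L 0. Proof. by move=> H [[H0 _] _]. Qed.
Lemma leechB x y : L x -> L y -> L (x - y).
Proof. by move=> Lx Ly H HH; have [[_ HB] _] := HH; apply: HB; [exact: Lx | exact: Ly]. Qed.

Lemma nuSE C j : (nuS C : V) j = (j \in C)%:R.
Proof.
rewrite /nuS sum_ffunE; have [jC|jC] := boolP (j \in C).
  rewrite (bigD1 j) //= nuE eqxx big1 ?addr0 // => k /andP[_ kj].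
  by rewrite nuE eq_sym (negPf kj).
by rewrite big1 // => k kC; rewrite nuE; case: eqP jC => // ->; rewrite kC.
Qed.

Lemma octad_vecE C : (Num.sqrt 8)^-1 *: (2 *: nuS C) = ivec (set_vec 2 C) :> V.
Proof.
apply/ffunP => j; rewrite !ffunE nuSE /GRing.scale /=; congr (_ * _).
by rewrite intrM; congr (_ * _); case: (j \in C).
Qed.

Lemma leech_gen_vecE i :
  (Num.sqrt 8)^-1 *: (nuS [set: Omega]%SET - 4 *: nu i) = ivec (leech_gen i) :> V.
Proof.
apply/ffunP => j; rewrite [RHS]ffunE leech_genE !ffunE nuSE inE /GRing.scale /=; congr (_ * _).
by rewrite intrB intrM; congr (_ - _ * _).
Qed.

Lemma leech_ind (H : set V) : additive_subgroup H ->
  (forall C, octad G C -> H (ivec (set_vec 2 C))) -> (forall i, H (ivec (leech_gen i))) ->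
  forall x, L x -> H x.
Proof.
move=> HH HC Hi x; apply; split=> // y [[C /= OC <-]|[i _ <-]].
  by rewrite octad_vecE; exact: HC.
by rewrite leech_gen_vecE; exact: Hi.
Qed.

Lemma leech_octad C : octad G C -> L (ivec (set_vec 2 C)).
Proof. by move=> OC H [_ HG]; apply: HG; left; exists C; rewrite ?octad_vecE. Qed.

Lemma leech_leech_gen i : L (ivec (leech_gen i)).
Proof. by move=> H [_ HG]; apply: HG; right; exists i; rewrite ?leech_gen_vecE. Qed.

Lemma leech_sub x : L x -> exists2 z, x = ivec z & leech_cond z.
Proof.
apply: (@leech_ind (fun x => exists2 z, x = ivec z & leech_cond z)) => [|C /andP[GC _]|i].
- split; first by exists 0; [rewrite ivec0 | exact: leech_cond0].
  by move=> x' y [z -> cz] [u -> cu]; exists (z - u); [rewrite ivecB | exact: leech_condB].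
- by exists (set_vec 2 C) => //; exact: leech_cond_codeword.
- by exists (leech_gen i) => //; exact: leech_cond_gen.
Qed.

Lemma leech_cond_parity z i j : leech_cond z -> (2 %| z i - z j)%Z.
Proof.
move=> [A _]; have := rpredB (A j) (A i).
rewrite (_ : _ - _ - _ = 4 * (z i - z j)); last by ring.
by have -> := @dvdz_mul2l 4 2 (z i - z j) isT.
Qed.

Definition odd_set (u : zvec) : {set Omega} := [set i | ~~ (2 %| u i)%Z]%SET.

Lemma sum_odd_set u C : (2 %| \sum_(i in C) u i)%Z = ~~ odd #|C :&: odd_set u|.
Proof.
have -> : \sum_(i in C) u i = \sum_(i in C) set_vec 1 (odd_set u) i + 2 * \sum_(i in C) (u i %/ 2)%Z.
  rewrite mulr_sumr -big_split; apply: eq_bigr => i _ /=; rewrite ffunE inE.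
  by rewrite mul1r; exact: int_mod2.
by rewrite sum_set_vec mul1r finset.setIC rpredDr ?dvdz_mulr //; exact: dvdn2.
Qed.

Lemma sum_parity z b u C : (forall i, z i = b + 2 * u i) ->
  \sum_(i in C) z i = b * #|C|%:Z + 2 * \sum_(i in C) u i.
Proof.
move=> zE; rewrite mulr_sumr (eq_bigr (fun i => b + 2 * u i)) => [|i _]; last exact: zE.
by rewrite big_split /= sumr_const -(mulr_natr b) natz.
Qed.

(** For a codeword C, the sum of z over C is 2 times the sum of u modulo 4, so the
    set where u is odd is orthogonal to C; the code being its own dual, this set
    is a codeword. *)
Lemma leech_cond_word z (b : int) (u : zvec) : leech_cond z ->
  (forall i, z i = b + 2 * u i) -> cw (odd_set u).
Proof.
move=> [_ B] zE; apply: (self_dual Omega24 golayG) => C GC.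
rewrite finset.setIC -sum_odd_set; have := B C GC.
rewrite (sum_parity C zE).
have /dvdnP[m ->] : (4 %| #|C|)%N by rewrite /dvdn codeword_card4.
by rewrite PoszM mulrA; move: (b * m) (\sum_(i in C) u i); lia.
Qed.


Lemma ivecD z u : ivec (z + u) = ivec z + ivec u.
Proof. by apply/ffunP => i; rewrite !ffunE intrD mulrDr. Qed.

(** To contain the vectors satisfying the congruences, a subgroup only needs the
    octads of the basis, the vector 2 nu_Omega and the nu_Omega - 4 nu_i. *)
Section SmallGenerators.
Variable w : seq Omega.
Hypothesis wG : golay_labelling G w.
Variable H : set V.
Hypothesis HH : additive_subgroup H.
Hypothesis H_octad : forall b, b \in [seq b.2 | b <- golay_basis] -> H (ivec (set_vec 2 (key_set w b))).
Hypothesis H_all : H (ivec (set_vec 2 [set: Omega]%SET)).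
Hypothesis H_gen : forall i, H (ivec (leech_gen i)).
Let lw : labelling w. Proof. by case: wG. Qed.

Let H0 : H 0. Proof. by case: HH. Qed.
Let HN x : H x -> H (- x). Proof. by move=> Hx; case: HH => _ HB; rewrite -[- x]add0r; exact: HB. Qed.
Let HD x y : H x -> H y -> H (x + y).
Proof. by move=> Hx Hy; case: HH => _ HB; rewrite -[y]opprK; apply: HB => //; exact: HN. Qed.
Let HB x y : H x -> H y -> H (x - y). Proof. by case: HH => _; apply. Qed.

Let H_mul (n : int) z : H (ivec z) -> H (ivec (z *~ n)).
Proof.
have Hn m u : H (ivec u) -> H (ivec (u *+ m)).
  by move=> Hu; elim: m => [|m IH]; rewrite ?mulr0n ?ivec0 // mulrS ivecD; exact: HD.
move=> Hz; case: n => m; first exact: Hn.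
by rewrite NegzE mulrNz -[- _]sub0r ivecB ivec0 sub0r; apply/HN/Hn.
Qed.

(** Every codeword vector is congruent to a sum of basis octads modulo vectors
    divisible by 4, by the rule 2 (a + b - 2ab) = 2a + 2b - 4ab on indicators. *)
Lemma word_vec k : k \in golay_words ->
  exists2 u, H (ivec (set_vec 2 (key_set w k) + u *+ 4)) & leech_cond (set_vec 2 (key_set w k) + u *+ 4).
Proof.
rewrite golay_wordsE.
have : forall b, b \in [seq b.2 | b <- golay_basis] ->
    [/\ size b = 24%N, H (ivec (set_vec 2 (key_set w b))) & leech_cond (set_vec 2 (key_set w b))].
  move=> b bB; have [sb Gb] := basis_codeword wG bB; split=> //; first exact: H_octad.
  exact: leech_cond_codeword.
elim: [seq b.2 | b <- golay_basis] k => [|b B IH] k HB'.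
  have e : set_vec 2 (key_set w (nseq 24 false)) + 0 *+ 4 = 0.
    by rewrite key_set0 // mul0rn addr0; apply/ffunP => i; rewrite !ffunE inE mulr0.
  by rewrite inE => /eqP->; exists 0; rewrite e ?ivec0 //; exact: leech_cond0.
have BG' c : c \in B -> c \in b :: B by move=> cB; rewrite inE cB orbT.
have {}IH k' := IH k' (fun c cB => HB' c (BG' c cB)).
rewrite /= mem_cat => /orP[/IH //|/mapP[k' k'B ->]].
have sk' : size k' = 24%N by apply: size_xor_span k'B => c /BG' /HB'[].
have [u Hu cu] := IH _ k'B; have [sb Hb cb] := HB' b (mem_head _ _).
suff e : set_vec 2 (key_set w (xor_key b k')) +
    (u + [ffun i => ((i \in key_set w b) && (i \in key_set w k'))%:Z]) *+ 4 =
    set_vec 2 (key_set w b) + (set_vec 2 (key_set w k') + u *+ 4).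
  exists (u + [ffun i => ((i \in key_set w b) && (i \in key_set w k'))%:Z]); rewrite e.
    by rewrite ivecD; exact: HD.
  exact: leech_condD.
rewrite key_set_xor ?sb ?sk' //.
apply/ffunP => i; rewrite mulrnDl !(ffunE, ffunMnE) in_sdiff.
by case: (i \in key_set w b); case: (i \in key_set w k') => /=; ring.
Qed.

(** The vectors 4 nu_i - 4 nu_j are differences of generators, and 8 nu_i is
    2 nu_Omega minus twice a generator. *)
Lemma four_vec (i0 : Omega) (y : zvec) : (2 %| \sum_i y i)%Z -> H (ivec (y *+ 4)).
Proof.
case/dvdzP => c cE.
have -> : y *+ 4 = \sum_i (leech_gen i0 - leech_gen i) *~ y i +
    (set_vec 2 [set: Omega]%SET - leech_gen i0 *~ 2) *~ c.
  have mulz (f : zvec) (n : int) j : (f *~ n) j = f j * n.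
    by case: n => n; rewrite ?NegzE ?mulrNz ?ffunE ffunMnE -mulr_natr natz // mulrN.
  have ffB (f h : zvec) j : (f - h) j = f j - h j by rewrite !ffunE.
  apply/ffunP => j; rewrite ffunMnE [RHS]ffunE sum_ffunE mulz ffB mulz leech_genE.
  have -> : \sum_i ((leech_gen i0 - leech_gen i) *~ y i) j =
      4 * (\sum_i (j == i)%:Z * y i) - 4 * (j == i0)%:Z * \sum_i y i.
    rewrite !mulr_sumr -sumrB; apply: eq_bigr => i _; rewrite mulz ffB !leech_genE.
    by ring.
  rewrite (bigD1 j) //= big1 ?eqxx => [|i ij]; last by rewrite eq_sym (negPf ij) mul0r.
  rewrite cE ffunE inE; move: (y j) (Posz (j == i0)) => a e; rewrite -[Posz true]/(1 : int); ring.
rewrite ivecD; apply: HD; last by apply: H_mul; rewrite ivecB; apply: HB => //; exact: H_mul.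
have sum_H (I : Type) (r : seq I) (F : I -> zvec) : (forall i, H (ivec (F i))) -> H (ivec (\sum_(i <- r) F i)).
  move=> HF; elim: r => [|i r IH]; rewrite ?big_nil ?ivec0 // big_cons ivecD; exact: HD.
by apply: sum_H => i; apply: H_mul; rewrite ivecB; exact: HB.
Qed.

Lemma even_vec (z u : zvec) : leech_cond z -> (forall i, z i = 2 * u i) -> H (ivec z).
Proof.
move=> cz zE; have Gu : cw (odd_set u).
  by apply: (@leech_cond_word z 0 u) => // i; rewrite add0r.
have [k kW uk] := codeword_golay_word Omega24 golayG wG Gu.
have [u' Hu' cu'] := word_vec kW; rewrite -uk in Hu' cu'.
have [i0 _] : exists i0 : Omega, true.
  by move: Omega24; rewrite cardT; case: (enum Omega) => [|i0 ?] //; exists i0.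
pose y : zvec := [ffun i => (u i %/ 2)%Z - u' i].
have zy : z - (set_vec 2 (odd_set u) + u' *+ 4) = y *+ 4.
  apply/ffunP => i; rewrite !(ffunE, ffunMnE) zE inE {1}(int_mod2 (u i)).
  by move: (u i %/ 2)%Z (u' i) (~~ _)%:Z => p q r; ring.
have Hy : H (ivec (y *+ 4)).
  apply: (four_vec i0); have [/(_ i0) + _] := leech_condB cz cu'; rewrite zy.
  have -> : \sum_j (y *+ 4) j - 4 * (y *+ 4) i0 = 4 * (\sum_j y j) - 8 * (2 * y i0).
    have mul4 j : (y *+ 4) j = 4 * y j by rewrite ffunMnE; move: (y j) => a; ring.
    by rewrite mulr_sumr (eq_bigr (fun j => 4 * y j)) // mul4; ring.
  move=> h; have := rpredD h (dvdz_mulr (2 * y i0) (dvdzz 8)); rewrite subrK.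
  by have -> := @dvdz_mul2l 4 2 (\sum_j y j) isT.
have -> : z = y *+ 4 + (set_vec 2 (odd_set u) + u' *+ 4) by rewrite -zy subrK.
by rewrite ivecD; exact: HD.
Qed.

(** Subtract a generator nu_Omega - 4 nu_i to make the coordinates even, then a codeword
    vector to make them divisible by 4. *)
Lemma leech_cond_sub z : leech_cond z -> H (ivec z).
Proof.
have even z' i : leech_cond z' -> (2 %| z' i)%Z -> H (ivec z').
  move=> cz z2; apply: (@even_vec z' [ffun j => (z' j %/ 2)%Z]) => // j; rewrite ffunE.
  have : (2 %| z' j)%Z by rewrite -(subrK (z' i) (z' j)) rpredD //; exact: leech_cond_parity.
  by rewrite mulrC => /divzK.
have [i _] : exists i : Omega, true.
  by move: Omega24; rewrite cardT; case: (enum Omega) => [|i0 ?] //; exists i0.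
move=> cz; case: (boolP (2 %| z i)%Z) => [|zi]; first exact: even.
rewrite -(subrK (leech_gen i) z) ivecD; apply: HD => //; apply: (even _ i).
  by apply: leech_condB => //; exact: leech_cond_gen.
have -> : (z - leech_gen i) i = z i - leech_gen i i by rewrite !ffunE.
by rewrite leech_genE eqxx; move: (z i) zi => a; lia.
Qed.

End SmallGenerators.
End LeechCoordinates.

(** * Maps preserving the Leech lattice *)

Section LeechMaps.
Context {R : realType} {Omega : finType}.
Local Notation V := (euclid R Omega).
Local Notation zvec := {ffun Omega -> int}.
Variable G : {vspace {ffun Omega -> ('F_2)^o}}.
Hypothesis Omega24 : #|Omega| = 24%N.
Hypothesis golayG : extended_golay G.
Variable w : seq Omega.
Hypothesis wG : golay_labelling G w.
Local Notation cw := (codeword G).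
Local Notation L := (leech R G).
Local Notation ivec := (@ivec R Omega).
Local Notation lcond := (leech_cond G).
Implicit Types (z u : zvec) (A C D : {set Omega}) (s : {perm Omega}).
Let lw : labelling w. Proof. by case: wG. Qed.

Lemma card_key_set k : size k = 24%N -> #|key_set w k| = count id k.
Proof. by move=> sk; rewrite (card_count Omega24 wG) -{2}(key_of_set Omega24 lw sk) count_map. Qed.

Lemma leechE z : L (ivec z) <-> lcond z.
Proof.
split=> [/(leech_sub Omega24 golayG)[u /ivec_inj-> //]|].
apply: (leech_cond_sub Omega24 golayG wG); first by split; [exact: leech0 | exact: leechB].
- move=> b bB; have [sb Gb] := basis_codeword wG bB; apply: leech_octad.
  rewrite /octad Gb card_key_set //.
  have : all (fun b => count id b == 8)%N [seq b.2 | b <- golay_basis] by [].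
  by move/allP/(_ b bB).
- have oct i : i \in [:: 0; 8; 16]%N -> L (ivec (set_vec 2 (key_set w (key_of (iota i 8))))).
    move=> iI; have : all (fun i => golay_test (key_of (iota i 8)) && (count id (key_of (iota i 8)) == 8)%N) [:: 0; 8; 16]%N.
      by vm_compute.
    move=> /allP/(_ i iI)/andP[/(golay_test_codeword Omega24 golayG wG)[sk Gk] /eqP ck].
    by apply: leech_octad; rewrite /octad Gk card_key_set // ck.
  have -> : set_vec 2 [set: Omega]%SET = set_vec 2 (key_set w (key_of (iota 0 8))) -
      (0 - set_vec 2 (key_set w (key_of (iota 8 8)))) - (0 - set_vec 2 (key_set w (key_of (iota 16 8)))).
    apply/ffunP => x; rewrite !ffunE inE !in_key_set //.
    have := index_lt Omega24 wG x.
    by move: (index x w); do 24!case=> //.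
  rewrite !ivecB ivec0; apply: leechB; first apply: leechB; first exact: oct.
    by apply: leechB; [exact: leech0 | exact: oct].
  by apply: leechB; [exact: leech0 | exact: oct].
exact: leech_leech_gen.
Qed.

Lemma sum_setT (F : Omega -> int) : \sum_(i in [set: Omega]%SET) F i = \sum_i F i.
Proof. by apply: eq_bigl => i; rewrite inE. Qed.

Lemma sum_sign z A C : \sum_(i in C) ((-1) ^+ (i \in A) * z i) =
  \sum_(i in C) z i - 2 * \sum_(i in C :&: A) z i.
Proof.
have -> : \sum_(i in C :&: A) z i = \sum_(i in C) (i \in A)%:Z * z i.
  rewrite big_mkcond [RHS]big_mkcond; apply: eq_bigr => i _; rewrite inE.
  by case: (i \in C); case: (i \in A) => /=; rewrite ?mul1r ?mul0r.
rewrite mulr_sumr -sumrB; apply: eq_bigr => i _.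
by case: (i \in A) => /=; ring.
Qed.

Lemma parity_form z i0 : lcond z -> exists u, forall i, z i = z i0 + 2 * u i.
Proof.
move=> cz; exists [ffun i => ((z i - z i0) %/ 2)%Z] => i; rewrite ffunE mulrC divzK ?(leech_cond_parity _ _ cz) //.
by rewrite addrC subrK.
Qed.

Let point : exists i0 : Omega, true.
Proof. by move: Omega24; rewrite cardT; case: (enum Omega) => [|i0 ?] //; exists i0. Qed.

Lemma leech_cond_sign z A : cw A -> lcond z -> lcond [ffun i => (-1) ^+ (i \in A) * z i].
Proof.
move=> GA cz; have [c1 c2] := cz; have [i0 _] := point; have [u zE] := parity_form i0 cz.
split=> [i|C GC].
  have -> : \sum_j [ffun i => (-1) ^+ (i \in A) * z i] j = \sum_j z j - 2 * \sum_(j in A) z j.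
    rewrite (eq_bigr (fun j => (-1) ^+ (j \in A) * z j)) => [|j _]; last by rewrite ffunE.
    have := sum_sign z A [set: Omega]; rewrite finset.setTI => e.
    by rewrite -[LHS]sum_setT -[\sum_j z j]sum_setT.
  rewrite ffunE; have := c1 i; have /dvdzP[q ->] := c2 A GA; move: (z i) (\sum_j z j) => a s.
  by case: (i \in A) => /=; lia.
under eq_bigr do rewrite ffunE.
rewrite sum_sign (sum_parity (C :&: A) zE).
have := codeword_even golayG GC GA; have := c2 C GC; rewrite -dvdn2 => + /dvdnP[m ->].
by rewrite PoszM mulrA; move: (_ * m%:Z) (\sum_(i in C) z i) (\sum_(i in _) u i); lia.
Qed.

Lemma leech_cond_perm z s : s \in M24 G -> lcond z -> lcond [ffun i => z (s^-1%g i)].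
Proof.
move=> sG [c1 c2]; split=> [i|C GC].
  rewrite ffunE; have := c1 (s^-1%g i); congr (_ %| _ - _)%Z.
  by rewrite [RHS](reindex_inj (@perm_inj _ s)) /=; apply: eq_bigr => j _; rewrite ffunE permK.
have sC : cw (s^-1%g @: C) by apply/M24P => //; rewrite M24_groupV.
have := c2 _ sC; congr (_ %| _)%Z; rewrite (reindex_inj (@perm_inj _ s^-1%g)) /=.
by apply: eq_big => [j|j _]; rewrite ?ffunE // mem_imset //; exact: perm_inj.
Qed.

Definition blk (x : Omega) : 'I_6 := inord (index x w %/ 4).
Definition block (j : 'I_6) : {set Omega} := [set x | blk x == j]%SET.

Lemma blkE x : blk x = (index x w %/ 4)%N :> nat.
Proof. by rewrite inordK // ltn_divLR // (index_lt Omega24 wG). Qed.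

Lemma block_key j : block j = key_set w (key_of (iota (4 * j) 4)).
Proof.
apply/setP => x; rewrite inE in_key_set // (nth_map 0%N) ?size_iota ?(index_lt Omega24 wG) //.
rewrite nth_iota ?(index_lt Omega24 wG) // add0n mem_iota -val_eqE /= blkE.
by apply/eqP/andP => [<-|[]]; have := index_lt Omega24 wG x; lia.
Qed.

Lemma card_block j : #|block j| = 4%N.
Proof.
rewrite block_key card_key_set //.
have /allP/(_ (nat_of_ord j)) : all (fun j => count id (key_of (iota (4 * j) 4)) == 4%N) (iota 0 6) by [].
by rewrite mem_iota ltn_ord => /(_ isT)/eqP.
Qed.

Lemma tetrad_block (j : 'I_6) x : (x \in tetrad w j) = (x \in block j).
Proof.
rewrite block_key in_key_set // (nth_map 0%N) ?size_iota ?(index_lt Omega24 wG) //.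
have [uw sw] := lw; rewrite nth_iota ?(index_lt Omega24 wG) // add0n /tetrad -(@map_nth_iota _ x); last first.
  by rewrite sw; have := ltn_ord j; lia.
apply/mapP/idP => [[i iI ->]|iI]; last by exists (index x w) => //; rewrite nth_index ?labelling_mem.
by rewrite index_uniq // sw; move: iI; rewrite mem_iota; have := ltn_ord j; lia.
Qed.

Lemma block_pair j : j != ord0 -> cw (sdiff (block ord0) (block j)).
Proof.
move=> j0; rewrite !block_key -key_set_xor //.
have /allP/(_ (nat_of_ord j)) : all (fun j => golay_test (xor_key (key_of (iota 0 4)) (key_of (iota (4 * j) 4)))) (iota 1 5).
  by vm_compute.
rewrite mem_iota lt0n j0 ltn_ord => /(_ isT)/(golay_test_codeword Omega24 golayG wG)[] //.
Qed.

Lemma sum_blocks (A : nmodType) (F : Omega -> A) C : \sum_(i in C) F i = \sum_j \sum_(i in C :&: block j) F i.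
Proof.
rewrite (partition_big blk xpredT) //; apply: eq_bigr => j _; apply: eq_bigl => i.
by rewrite !inE.
Qed.

Lemma sum_blocksT (A : nmodType) (F : Omega -> A) : \sum_i F i = \sum_j \sum_(i in block j) F i.
Proof.
by rewrite (partition_big blk xpredT) //; apply: eq_bigr => j _; apply: eq_bigl => i; rewrite inE.
Qed.

(** Let h j be half the sum over the j-th block after the sign change.  The congruences
    of z on the octads made of two blocks say that the h j agree modulo 2, so
    h j = h0 + 2 q j.  A codeword meets all the blocks with the same parity p,
    since it meets these octads evenly.  Both congruences for the image then
    reduce to those of z and to the parity of the sum of the q j, which is that
    of the coordinates of z. *)
Lemma leech_cond_xi z : lcond z -> exists h : 'I_6 -> int,
  (forall j, \sum_(i in block j) ((-1) ^+ (i \in block ord0) * z i) = 2 * h j) /\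
  lcond [ffun i => (-1) ^+ (i \in block ord0) * z i - h (blk i)].
Proof.
move=> cz; have [c1 c2] := cz; have [i0 _] := point; have [u zE] := parity_form i0 cz.
pose S (j : 'I_6) : int := \sum_(i in block j) z i; pose e (j : 'I_6) : int := (-1) ^+ (j == ord0).
have eS j : \sum_(i in block j) ((-1) ^+ (i \in block ord0) * z i) = e j * S j.
  by rewrite mulr_sumr; apply: eq_bigr => i; rewrite !inE => /eqP->.
have SE j : S j = 4 * z i0 + 2 * \sum_(i in block j) u i.
  by rewrite /S (sum_parity _ zE) card_block mulrC.
pose h0 := - (2 * z i0 + \sum_(i in block ord0) u i).
have [q qE] : exists q : 'I_6 -> int, forall j, e j * S j = 2 * (h0 + 2 * q j).
  have qj j : exists q : int, e j * S j = 2 * (h0 + 2 * q).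
    have [->|j0] := eqVneq j ord0; first by exists 0; rewrite SE /e eqxx /h0 expr1; ring.
    have := c2 _ (block_pair j0).
    have -> : \sum_(i in sdiff (block ord0) (block j)) z i = S ord0 + S j.
      rewrite /S [LHS]big_mkcond [X in _ = X + _]big_mkcond [X in _ = _ + X]big_mkcond -big_split; apply: eq_bigr => i _; rewrite !inE.
      have [->|_] := eqVneq (blk i) ord0; last by rewrite /= add0r.
      by rewrite eq_sym (negPf j0) /= addr0.
    move=> /dvdzP[c cE]; exists c; rewrite /e (negPf j0) expr0 mul1r.
    have -> : S j = c * 4 - S ord0 by rewrite -cE; ring.
    by rewrite SE /h0; ring.
  by have [q qP] := choice qj; exists q.
exists (fun j => h0 + 2 * q j); split=> [j|]; first by rewrite eS.
have zS : \sum_i z i = 8 * h0 + 4 * \sum_j q j.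
  have q0 : q ord0 = 0.
    by have := qE ord0; rewrite SE /e eqxx expr1 /h0; move: (q _) (z i0) (\sum_(i in _) u i); lia.
  have Sq j : S j = 2 * (h0 + 2 * q j) - 4 * (j == ord0)%:Z * (h0 + 2 * q j).
    transitivity (e j * (e j * S j)); first by rewrite /e signrMK.
    by rewrite qE /e; case: (j == ord0) => /=; ring.
  rewrite sum_blocksT (eq_bigr _ (fun j _ => Sq j)) sumrB -mulr_sumr big_split -mulr_sumr sumr_const card_ord /=.
  rewrite [X in _ - X](bigD1 ord0) //= [X in _ - (_ + X)]big1 ?q0 => [|j j0]; last by rewrite (negPf j0) mulr0 mul0r.
  by move: (\sum_j q j) => a; ring.
have qpar : (2 %| \sum_j q j - z i0)%Z.
  have := c1 i0; rewrite zS.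
  by move: (\sum_j q j) (z i0) => a b; lia.
split=> [i|C GC].
  have -> : \sum_j [ffun i => (-1) ^+ (i \in block ord0) * z i - (h0 + 2 * q (blk i))] j =
      - \sum_i z i - 4 * h0.
    rewrite sum_blocksT zS (eq_bigr (fun j => - 2 * (h0 + 2 * q j))) => [|j _].
      by rewrite -mulr_sumr big_split -mulr_sumr sumr_const card_ord /=; move: (\sum_j q j) => a; ring.
    rewrite (eq_bigr (fun i => (-1) ^+ (i \in block ord0) * z i - (h0 + 2 * q j))) => [|k].
      by rewrite sumrB eS qE sumr_const card_block; ring.
    by rewrite ffunE !inE => /eqP->.
  rewrite ffunE; have := c1 i; move: (\sum_i z i) (z i) (q _) => a b c.
  by case: (i \in _) => /=; lia.
have [p [m mE]] : exists p : int, exists m : 'I_6 -> int, forall j, #|C :&: block j|%:Z = p + 2 * m j.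
  exists #|C :&: block ord0|%:Z, (fun j => ((#|C :&: block j|%:Z - #|C :&: block ord0|%:Z) %/ 2)%Z) => j.
  have [->|j0] := eqVneq j ord0; first by rewrite subrr div0z mulr0 addr0.
  have := codeword_even golayG GC (block_pair j0); rewrite odd_setI_sdiff.
  by move: #|_| #|_|; lia.
have -> : \sum_(i in C) [ffun i => (-1) ^+ (i \in block ord0) * z i - (h0 + 2 * q (blk i))] i =
   \sum_(i in C) z i - 2 * \sum_(i in C :&: block ord0) z i - (h0 * #|C|%:Z + 2 * (p * \sum_j q j + 2 * \sum_j m j * q j)).
  under eq_bigr do rewrite ffunE.
  rewrite sumrB sum_sign; congr (_ - _ - _); rewrite sum_blocks.
  have -> : #|C|%:Z = \sum_j #|C :&: block j|%:Z.
    by rewrite -sum1_card (big_morph Posz PoszD erefl) sum_blocks; apply: eq_bigr => j _; rewrite -(big_morph Posz PoszD erefl) sum1_card.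
  rewrite !mulr_sumr -big_split mulr_sumr -big_split; apply: eq_bigr => j _ /=.
  rewrite (eq_bigr (fun=> h0 + 2 * q j)) => [|i]; last by rewrite !inE => /andP[_ /eqP->].
  rewrite sumr_const -(mulr_natr (_ + _)) (natz #|_|) mE; ring.
rewrite (sum_parity (C :&: block ord0) zE) mE.
have /dvdzP[a ->] := c2 C GC; have /dvdnP[b ->] : (4 %| #|C|)%N by rewrite /dvdn (codeword_card4 golayG).
have /dvdzP[c cE] := qpar; have -> : \sum_j q j = z i0 + c * 2 by rewrite -cE; ring.
move: (\sum_j _) (\sum_(i in _) u i) => M U.
apply/dvdzP; exists (a - z i0 * m ord0 - U - h0 * b%:Z - p * z i0 - p * c - M); rewrite PoszM; ring.
Qed.

End LeechMaps.

(** * Isometries fixing the multivector *)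

Section LatticeIsometries.
Context {R : realType} {Omega : finType}.
Local Notation V := (euclid R Omega).
Local Notation zvec := {ffun Omega -> int}.

Definition isometry (f : V -> V) : Prop := forall x y, dotp (f x) (f y) = dotp x y.

Lemma isometry_comp f h : isometry f -> isometry h -> isometry (f \o h).
Proof. by move=> fI hI x y; rewrite /= fI hI. Qed.

Lemma isometry_sign A : isometry (sign_map A).
Proof.
move=> x y; apply: eq_bigr => i _; rewrite !ffunE mulrACA -expr2 sqrr_sign mul1r //.
Qed.

Lemma isometry_perm s : isometry (perm_euclid s).
Proof.
move=> x y; rewrite /dotp (reindex_inj (@perm_inj _ s)); apply: eq_bigr => i _.
by rewrite !ffunE permK.
Qed.

Lemma refl_mapE l (x : V) i : uniq l ->
  refl_map l x i = (x i : R) - (2^-1 * \sum_(y <- l) (x y : R)) * (i \in l)%:R.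
Proof. by move=> ul; rewrite !ffunE sum_nu_seq. Qed.

Lemma isometry_refl l : uniq l -> size l = 4%N -> isometry (refl_map l).
Proof.
move=> ul sl x y; rewrite /dotp; set a := \sum_(y <- l) (x y : R); set b := \sum_(z <- l) (y z : R).
have sl_sum (z : V) : \sum_i (z i : R) * (i \in l)%:R = \sum_(y <- l) (z y : R).
  rewrite (big_uniq _ ul) [RHS]big_mkcond; apply: eq_bigr => i _.
  by case: ifP => _; rewrite ?mulr1 ?mulr0.
have n_sum : \sum_i ((i \in l)%:R : R) = 4.
  have := sl_sum [ffun=> 1]; under eq_bigr do rewrite ffunE mul1r.
  move=> ->; rewrite (eq_bigr (fun=> 1)) => [|i _]; last by rewrite ffunE.
  by rewrite big_const_seq count_predT sl iter_addr_0.
transitivity (\sum_i ((x i : R) * (y i : R) - (2^-1 * b) * ((x i : R) * (i \in l)%:R)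
   - (2^-1 * a) * ((y i : R) * (i \in l)%:R) + (2^-1 * a) * (2^-1 * b) * (i \in l)%:R)).
  apply: eq_bigr => i _; rewrite !refl_mapE // -/a -/b.
  by case: (i \in l); rewrite ?mulr1 ?mulr0 /=; ring.
rewrite big_split !sumrB -!mulr_sumr !sl_sum n_sum /=.
rewrite -/a -/b -/(dotp x y). 
by field.
Qed.

Lemma dotp_ivec (z u : zvec) : dotp (ivec z : V) (ivec u) = 8^-1 * (\sum_i z i * u i)%:~R.
Proof.
rewrite /dotp rmorph_sum mulr_sumr; apply: eq_bigr => i _; rewrite !ffunE mulrACA -invfM -expr2.
by rewrite sqr_sqrtr ?ler0n // rmorphM.
Qed.

Lemma isometry_ivec f (z u z' u' : zvec) : isometry f -> f (ivec z) = ivec z' -> f (ivec u) = ivec u' ->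
  \sum_i z' i * u' i = \sum_i z i * u i.
Proof.
move=> fI fz fu; have := fI (ivec z) (ivec u); rewrite fz fu !dotp_ivec.
move/(mulfI _)=> H; apply/eqP; rewrite -(eqr_int R); apply/eqP/H.
by rewrite invr_eq0 pnatr_eq0.
Qed.

Lemma sign_map_ivec A (z : zvec) : sign_map A (ivec z : V) = ivec [ffun i => (-1) ^+ (i \in A) * z i].
Proof.
apply/ffunP => i; rewrite !ffunE rmorphM rmorphXn rmorphN1 mulrCA //.
Qed.

Lemma perm_euclid_ivec s (z : zvec) : perm_euclid s (ivec z : V) = ivec [ffun i => z (s^-1%g i)].
Proof. by apply/ffunP => i; rewrite !ffunE. Qed.

Lemma ivecZ (n : int) (z : zvec) : n%:~R *: ivec z = ivec [ffun i => n * z i] :> V.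
Proof. by apply/ffunP => i; rewrite !ffunE intrM /GRing.scale /= mulrCA. Qed.

End LatticeIsometries.

Section Good.
Context {R : realType} {Omega : finType}.
Local Notation V := (euclid R Omega).
Local Notation zvec := {ffun Omega -> int}.
Variable G : {vspace {ffun Omega -> ('F_2)^o}}.
Hypothesis Omega24 : #|Omega| = 24%N.
Hypothesis golayG : extended_golay G.
Variable w : seq Omega.
Hypothesis wG : golay_labelling G w.
Variable g : nat.
Variable z0 : Omega.
Local Notation cw := (codeword G).
Local Notation L := (leech R G).
Local Notation ivec := (@ivec R Omega).
Local Notation lcond := (leech_cond G).
Local Notation t := (golay_tensor (R := R) w g).
Local Notation lab i := (nth z0 w i).
Local Notation blk := (blk w).
Local Notation block := (block w).
Implicit Types (z u v : zvec) (A C D : {set Omega}) (s : {perm Omega}).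
Let lw : labelling w. Proof. by case: wG. Qed.

Lemma foldr_refl (js : seq nat) (x : V) i : uniq js -> all (gtn 6) js ->
  foldr (fun j => refl_map (tetrad w j)) x js i =
  if (blk i : nat) \in js then (x i : R) - 2^-1 * \sum_(y in block (blk i)) (x y : R) else x i.
Proof.
elim: js i => //= j js IH i /andP[jn ujs] /andP[j6 js6].
rewrite refl_mapE ?(tetrad_uniq wG) // (tetrad_block Omega24 wG (Ordinal j6)) !inE -val_eqE /=.
have [jE|ji] := eqVneq; last by rewrite mulr0 subr0 IH.
rewrite IH // jE (negPf jn) mulr1 orTb; congr (_ - _ * _).
rewrite (big_uniq _ (tetrad_uniq wG _)) /= -jE; apply: eq_big => [y|y].
  exact: (tetrad_block Omega24 wG (blk i) y).
by rewrite (tetrad_block Omega24 wG (blk i)) inE => /eqP yi; rewrite IH // yi jE (negPf jn).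
Qed.

Lemma xiE (x : V) i : xi w x i = (-1) ^+ (i \in block ord0) * x i -
   2^-1 * \sum_(y in block (blk i)) ((-1) ^+ (y \in block ord0) * x y) :> R.
Proof.
have -> : xi w x = foldr (fun j => refl_map (tetrad w j)) (sign_map (tetrad_set w) x) (iota 0 6) by [].
rewrite foldr_refl // mem_iota ltn_ord /=.
have tE y : (y \in tetrad_set w) = (y \in block ord0) by rewrite inE (tetrad_block Omega24 wG ord0).
rewrite ffunE tE; congr (_ - _ * _); apply: eq_bigr => y _; rewrite ffunE tE.
by [].
Qed.

Lemma xi_ivec z : lcond z -> exists z', [/\ xi w (ivec z) = ivec z', lcond z' &
  forall i, 2 * z' i = 2 * (-1) ^+ (i \in block ord0) * z i -
    \sum_(y in block (blk i)) ((-1) ^+ (y \in block ord0) * z y)].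
Proof.
move=> cz; have [h [hE ch]] := leech_cond_xi Omega24 golayG wG cz.
exists [ffun i => (-1) ^+ (i \in block ord0) * z i - h (blk i)]; split=> // [|i]; last first.
  by rewrite ffunE hE; ring.
apply/ffunP => i; rewrite xiE !ffunE.
rewrite (eq_bigr (fun y => (Num.sqrt 8)^-1 * ((-1) ^+ (y \in block ord0) * z y)%:~R)) => [|y _]; last first.
  by rewrite ffunE rmorphM rmorphXn rmorphN1 mulrCA.
rewrite -mulr_sumr -rmorph_sum hE intrB !intrM rmorphXn rmorphN1.
by field; exact: sqrt8_neq0.
Qed.

(** The maps used in the descent.  The left inverse makes the action of h on
    multivectors injective, so that h can be cancelled at the end. *)
Definition good (h : {linear V -> V}) : Prop :=
  [/\ isometry h, forall x, L x -> L (h x), extmap h t = t & exists h' : {linear V -> V}, cancel h h'].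

Lemma good_comp (h k : {linear V -> V}) : good h -> good k -> good (h \o k).
Proof.
move=> [hI hL ht [h' hK]] [kI kL kt [k' kK]]; split.
- exact: isometry_comp.
- by move=> x /kL/hL.
- by move: t kt ht => x kx hx; rewrite -extmap_comp kx.
- by exists (k' \o h') => x; rewrite /= hK kK.
Qed.

Lemma leech_map (h : V -> V) : (forall z, lcond z -> exists2 z', h (ivec z) = ivec z' & lcond z') ->
  forall x, L x -> L (h x).
Proof.
move=> hz x /(leech_sub Omega24 golayG)[z -> /hz[z' -> cz']].
by apply/(leechE Omega24 golayG wG).
Qed.

Lemma good_sign A : cw A -> good (sign_map A).
Proof.
move=> GA; split.
- exact: isometry_sign.
- apply: leech_map => z cz; eexists; first exact: sign_map_ivec.
  exact: leech_cond_sign.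
- exact: (sign_tensor Omega24 golayG wG g GA).
- by exists (sign_map A); exact: sign_mapK.
Qed.

Lemma perm_leech s : s \in M24 G -> forall x, L x -> L (perm_euclid s x).
Proof.
move=> sG; apply: leech_map => z cz; eexists; first exact: perm_euclid_ivec.
exact: leech_cond_perm.
Qed.

Lemma good_perm s : s \in M24 G -> good (perm_euclid s).
Proof.
move=> sG; split.
- exact: isometry_perm.
- exact: perm_leech.
- exact: (M24_tensor Omega24 golayG wG g z0 sG).
- by exists (perm_euclid s^-1%g) => x; apply/ffunP => i; rewrite !ffunE invgK permK.
Qed.

Lemma good_xi : good (xi w).
Proof.
have rI j : (j < 6)%N -> isometry (refl_map (R := R) (tetrad w j)).
  by move=> j6; apply: isometry_refl; [exact: tetrad_uniq wG _ | exact: tetrad_size wG _ j6].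
have rK j : (j < 6)%N -> involutive (refl_map (R := R) (tetrad w j)).
  by move=> j6; apply: refl_mapK; [exact: tetrad_uniq wG _ | exact: tetrad_size wG _ j6].
split.
- apply: isometry_comp; last exact: isometry_sign.
  by do 5!(apply: isometry_comp; last exact: rI); exact: rI.
- by apply: leech_map => z /xi_ivec[z' [e c _]]; exists z'.
- exact: (xi_tensor Omega24 wG).
- exists (sign_map (tetrad_set w) \o refl_map (tetrad w 5) \o refl_map (tetrad w 4) \o refl_map (tetrad w 3)
    \o refl_map (tetrad w 2) \o refl_map (tetrad w 1) \o refl_map (tetrad w 0)) => x.
  by rewrite /= !rK // sign_mapK.
Qed.

End Good.

(** * Integer vectors of norm 64 *)

(** m is the largest absolute value of a coordinate, and a, b, c are the next three.
    The twenty other ones are at most c: if c = 0 they vanish, if c = 1 they are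
    all 1 by parity, and if 2 <= c the bounds on the sum and on the squares are
    already decisive. *)
Definition dominant_check : bool := (
  all (fun m => all (fun a => all (fun b => all (fun c => let r := if c == 0 then 0 else 20 in
    [&& a + b + c <= m, odd m == odd a, odd m == odd b, odd m == odd c, c <= b, b <= a,
        (2 <= c) || (m * m + a * a + b * b + c * c + r == 64) & m * m + a * a + b * b + c * c <= 64] ==>
    [|| (m == 8) && (a == 0) | [&& m == 6, a == 2, b == 2 & c == 2]])
  (iota 0 9)) (iota 0 9)) (iota 0 9)) (iota 0 9))%N.

Lemma dominant_ok : dominant_check. Proof. by vm_compute. Qed.

Section DominantCoordinate.
Context {Omega : finType}.
Hypothesis Omega24 : #|Omega| = 24%N.
Variable n : Omega -> nat.

Lemma max_outside (l : seq Omega) : (size l < 24)%N ->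
  exists2 a, a \notin l & forall b, b \notin l -> (n b <= n a)%N.
Proof.
move=> l24; have [a0 a0l] : exists a, a \notin l.
  apply/existsP; rewrite -negb_forall; apply: contraL l24 => /forallP lP.
  rewrite -leqNgt -Omega24; apply: leq_trans (card_size l).
  by apply/subset_leq_card/fintype.subsetP => x _; exact: lP.
have [a al aP] := @arg_maxnP _ a0 (fun a => a \notin l) n a0l.
by exists a.
Qed.

(** The hypothesis on a, b, c comes from the maximality of n i over an orbit: a
    move produces the coordinate (n i + n a + n b + n c) / 2. *)
Lemma dominant_coordinate i : (\sum_j n j * n j = 64)%N -> (forall j, odd (n j) = odd (n i)) ->
  (forall a b c, uniq [:: i; a; b; c] -> (n a + n b + n c <= n i)%N) ->
  (forall j, (n j <= n i)%N) ->
  (n i = 8%N /\ forall j, j != i -> n j = 0%N) \/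
  exists a b c, [/\ uniq [:: i; a; b; c], n i = 6%N, n a = 2%N, n b = 2%N & n c = 2%N].
Proof.
move=> s64 par top4 top.
have [a ai aP] := @max_outside [:: i] isT.
have [b bi bP] := @max_outside [:: a; i] isT.
have [c ci cP] := @max_outside [:: b; a; i] isT.
have u4 : uniq [:: c; b; a; i].
  by rewrite cons_uniq ci cons_uniq bi cons_uniq ai.
have u4' : uniq [:: i; a; b; c] by rewrite -rev_uniq.
have abc := top4 _ _ _ u4'.
have rest (F : Omega -> nat) : (\sum_j F j = F i + F a + F b + F c + \sum_(j | j \notin [:: c; b; a; i]) F j)%N.
  rewrite (bigID (fun j => j \in [:: c; b; a; i])) /= -(big_uniq _ u4) /= !big_cons big_nil; lia.
have s4 := rest (fun j => (n j * n j)%N).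
have ba : (n b <= n a)%N by apply: aP; move: bi; rewrite !inE negb_or => /andP[].
have cb : (n c <= n b)%N by apply: bP; move: ci; rewrite !inE !negb_or => /and3P[_ -> ->].
have m8 : (n i <= 8)%N by move: s4; rewrite s64; nia.
have lt9 k : (k <= n i)%N -> k \in iota 0 9 by rewrite mem_iota => ki; rewrite ltnS (leq_trans ki).
have cnt : (\sum_(j | j \notin [:: c; b; a; i]) 1 = 20)%N.
  have := rest (fun=> 1%N); rewrite sum1_card Omega24; lia.
have tail : (2 <= n c)%N \/ (\sum_(j | j \notin [:: c; b; a; i]) n j * n j = if n c == 0 then 0 else 20)%N.
  case: (leqP 2 (n c)) => [|c2]; [by left | right].
  rewrite -cnt; case: eqP => c0.
    apply: big1 => j jn; have := cP j; rewrite c0 leqn0 => /(_ _)/eqP-> //.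
    by move: jn; rewrite !inE !negb_or => /and4P[_ -> -> ->].
  apply: eq_bigr => j jn; have : (n j <= n c)%N.
    by apply: cP; move: jn; rewrite !inE !negb_or => /and4P[_ -> -> ->].
  have := par j; have := par c; have c1 : n c = 1%N by lia.
  by rewrite c1 => <-; case: (n j) => [|[|]].
have := dominant_ok; rewrite /dominant_check.
move=> /allP/(_ (n i) (lt9 _ (leqnn _)))/allP/(_ (n a) (lt9 _ (top _))).
move=> /allP/(_ (n b) (lt9 _ (top _)))/allP/(_ (n c) (lt9 _ (top _))).
rewrite s64 in s4; cbv zeta => /implyP dominant_case.
have /dominant_case/orP : [&& n a + n b + n c <= n i, odd (n i) == odd (n a), odd (n i) == odd (n b),
    odd (n i) == odd (n c), n c <= n b, n b <= n a, (2 <= n c) || (n i * n i + n a * n a + n b * n b +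
    n c * n c + (if n c == 0 then 0 else 20) == 64) & n i * n i + n a * n a + n b * n b + n c * n c <= 64]%N.
  rewrite abc !par !eqxx ba cb /=; apply/andP; split; last by lia.
  by case: tail => [->//|te]; rewrite -te; apply/orP; right; lia.
case => [/andP[/eqP i8 /eqP a0]|/and4P[/eqP ? /eqP ? /eqP ? /eqP ?]]; last by right; exists a, b, c.
by left; split=> // j ji; apply/eqP; rewrite -leqn0 -a0 aP // inE.
Qed.
End DominantCoordinate.

(** * Descent to a coordinate axis *)

Lemma sign_words_ok : all (fun e => has (fun k => take 4 k == e) golay_words) (all_keys 4).
Proof. by vm_compute. Qed.

Section Descent.
Context {R : realType} {Omega : finType}.
Local Notation V := (euclid R Omega).
Local Notation zvec := {ffun Omega -> int}.
Variable G : {vspace {ffun Omega -> ('F_2)^o}}.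
Hypothesis Omega24 : #|Omega| = 24%N.
Hypothesis golayG : extended_golay G.
Variable w : seq Omega.
Hypothesis wG : golay_labelling G w.
Variable g : nat.
Variable z0 : Omega.
Local Notation cw := (codeword G).
Local Notation L := (leech R G).
Local Notation ivec := (@ivec R Omega).
Local Notation lcond := (leech_cond G).
Local Notation t := (golay_tensor (R := R) w g).
Local Notation lab i := (nth z0 w i).
Local Notation good := (good (R := R) G w g).
Implicit Types (z u v : zvec) (A C D : {set Omega}) (s : {perm Omega}).
Let lw : labelling w. Proof. by case: wG. Qed.

Definition reach z u : Prop := exists2 h : {linear V -> V}, good h & h (ivec z) = ivec u.

Lemma reach_trans z u v : reach z u -> reach u v -> reach z v.
Proof.
move=> [h hg hz] [k kg ku]; exists (k \o h); last by rewrite /= hz.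
exact: good_comp.
Qed.

Lemma reach_cond z u : reach z u -> lcond z -> lcond u.
Proof.
move=> [h [_ hL _ _] hz] /(leechE Omega24 golayG wG)/hL; rewrite hz.
by move/(leechE Omega24 golayG wG).
Qed.

Lemma reach_norm z u : reach z u -> \sum_i u i * u i = \sum_i z i * z i.
Proof. by move=> [h [hI _ _ _] hz]; exact: (isometry_ivec hI hz hz). Qed.

Lemma reach_sign A z : cw A -> reach z [ffun i => (-1) ^+ (i \in A) * z i].
Proof. by move=> GA; exists (sign_map A); [exact: good_sign | exact: sign_map_ivec]. Qed.

Lemma reach_perm s z : s \in M24 G -> reach z [ffun i => z (s^-1%g i)].
Proof. by move=> sG; exists (perm_euclid s); [exact: (good_perm Omega24 golayG wG g z0) | exact: perm_euclid_ivec]. Qed.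

Lemma sign_codeword (e : bitseq) : size e = 4%N ->
  exists2 C, cw C & forall i, (i < 4)%N -> (lab i \in C) = nth false e i.
Proof.
move=> se; have [uw sw] := lw.
have /hasP[k kW /eqP ke] : has (fun k => take 4 k == e) golay_words.
  by have := allP sign_words_ok e; apply; rewrite -se mem_all_keys.
have [sk Gk] := golay_word_codeword Omega24 wG kW; exists (key_set w k) => // i i4.
have i24 : (i < 24)%N by apply: leq_trans i4 _.
by rewrite in_key_set // index_uniq ?sw // -ke nth_take.
Qed.

Lemma lab_block i : (i < 24)%N -> blk w (lab i) = (i %/ 4)%N :> nat.
Proof. by move=> i24; have [uw sw] := lw; rewrite (blkE Omega24 wG) index_uniq ?sw. Qed.

Lemma sum_block0 (F : Omega -> int) :
  \sum_(y in block w ord0) F y = F (lab 0) + F (lab 1) + F (lab 2) + F (lab 3).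
Proof.
have [uw sw] := lw; rewrite -(eq_bigl _ _ (tetrad_block Omega24 wG ord0)).
rewrite -(big_uniq _ (tetrad_uniq wG 0)) /tetrad drop0.
have -> : take 4 w = [:: lab 0; lab 1; lab 2; lab 3].
  by move: sw => {uw}; case: w => [|a [|b [|c [|d l]]]] //= _; rewrite take0.
by rewrite !big_cons big_nil /= addr0 !addrA.
Qed.

(** Conjugating xi by M24, and composing it with sign changes, one may apply to any four
    coordinates with any signs the map that replaces each entry by half the
    sum of the four minus the entry. *)
Lemma reach_move z (a : nat -> Omega) (e : bitseq) : lcond z -> size e = 4%N ->
  (forall i j, (i < j)%N -> (j < 4)%N -> a i != a j) ->
  let y i := (-1) ^+ nth false e i * z (a i) in
  exists2 u, reach z u & forall i, (i < 4)%N -> 2 * u (lab i) = y 0%N + y 1%N + y 2%N + y 3%N - 2 * y i.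
Proof.
move=> cz se aD y; have [s [sG _] sa] := transitive4 (R := R) Omega24 golayG wG g z0 (leqnn 4) aD.
have [C GC Ce] := sign_codeword se.
have sVG : s^-1%g \in M24 G by rewrite M24_groupV.
have r1 := reach_perm z sVG; have r2 := reach_trans r1 (reach_sign _ GC).
move: r2; set z2 := [ffun i => _] => r2.
have z2y i : (i < 4)%N -> z2 (lab i) = y i.
  by move=> i4; rewrite !ffunE invgK sa // Ce.
have [u [xu cu uE]] := xi_ivec (R := R) Omega24 golayG wG (reach_cond r2 cz).
exists u => [|i i4].
  by apply: (reach_trans r2); exists (xi w); [exact: good_xi | exact: xu].
have b0 j : (j < 4)%N -> blk w (lab j) = ord0.
  by move=> j4; apply/val_inj; rewrite /= lab_block ?divn_small // (leq_trans j4).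
have in0 j : (j < 4)%N -> (lab j \in block w ord0) = true by move=> j4; rewrite inE b0 ?eqxx.
by rewrite uE b0 // sum_block0 !in0 // !z2y // expr1; ring.
Qed.

Lemma abs_sign (a : int) : exists b : bool, (-1) ^+ b * a = `|a|%N.
Proof. by exists (a < 0); case: (ltrP a 0) => a0 /=; lia. Qed.

Lemma distinct4 (i a b c : Omega) : uniq [:: i; a; b; c] ->
  forall k l, (k < l)%N -> (l < 4)%N -> nth z0 [:: i; a; b; c] k != nth z0 [:: i; a; b; c] l.
Proof. by move=> u4 k l kl l4; rewrite nth_uniq //= ?neq_ltn ?kl // (ltn_trans kl). Qed.

(** With the sign of the first entry opposite to the others, the move yields the
    half sum of the absolute values in its place. *)
Lemma reach_sum z i a b c : lcond z -> uniq [:: i; a; b; c] ->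
  exists2 u, reach z u & exists j, 2 * u j = (`|z i| + `|z a| + `|z b| + `|z c|)%N.
Proof.
move=> cz u4; have [e0 i0] := abs_sign (z i); have [e1 a1] := abs_sign (z a).
have [e2 b2] := abs_sign (z b); have [e3 c3] := abs_sign (z c).
have [u zu uE] := @reach_move z (nth z0 [:: i; a; b; c]) [:: ~~ e0; e1; e2; e3] cz erefl (distinct4 u4).
exists u => //; exists (lab 0); rewrite uE //= signrN mulNr i0 a1 b2 c3 !PoszD; ring.
Qed.

(** Signs are chosen so that the four entries become 6, 2, 2, 2, with half sum 6. *)
Lemma reach_balanced z i a b c : lcond z -> uniq [:: i; a; b; c] ->
  `|z i|%N = 6%N -> `|z a|%N = 2%N -> `|z b|%N = 2%N -> `|z c|%N = 2%N ->
  exists2 u, reach z u & [/\ u (lab 0) = 0, u (lab 1) = 4, u (lab 2) = 4 & u (lab 3) = 4].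
Proof.
move=> cz u4 zi za zb zc; have [e0 i0] := abs_sign (z i); have [e1 a1] := abs_sign (z a).
have [e2 b2] := abs_sign (z b); have [e3 c3] := abs_sign (z c).
have [u zu uE] := @reach_move z (nth z0 [:: i; a; b; c]) [:: e0; e1; e2; e3] cz erefl (distinct4 u4).
exists u => //; have := uE 0%N isT; have := uE 1%N isT; have := uE 2%N isT; have := uE 3%N isT.
rewrite /= i0 a1 b2 c3 zi za zb zc.
by split; lia.
Qed.

(** Among the vectors of the orbit take one with the largest coordinate.  It is on
    an axis, or else has entries 6, 2, 2, 2; in the latter case a move yields
    0, 4, 4, 4, and then maximality forces all the other coordinates to vanish,
    which contradicts the norm. *)
Lemma reach_axis v : lcond v -> \sum_i v i * v i = 64 ->
  exists2 u, reach v u & exists (j : Omega) (b : bool), u = [ffun k => (-1) ^+ b * 8 * (k == j)%:Z].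
Proof.
move=> cv v64.
pose P m := `[< exists2 z, reach v z & exists i, `|z i|%N = m >].
have norm z : reach v z -> (\sum_i `|z i| * `|z i| = 64)%N.
  move=> vz; apply/eqP; rewrite -eqz_nat; apply/eqP; transitivity (\sum_i v i * v i); last exact: v64.
  rewrite -(reach_norm vz) (big_morph Posz PoszD erefl); apply: eq_bigr => i _.
  by move: (z i) => a; nia.
have P8 m : P m -> (m <= 8)%N.
  move=> /asboolP[z vz [i <-]]; have := norm z vz; rewrite (bigD1 i) //=; nia.
have Pv : exists m, P m.
  exists `|v z0|%N; apply/asboolP; exists v; last by exists z0.
  exists (perm_euclid 1%g); first by apply: (good_perm Omega24 golayG wG g z0); exact: M24_group1.
  by apply/ffunP => i; rewrite ffunE invg1 perm1.
case: (ex_maxnP Pv P8) => M /asboolP[z vz [i zi]] Mmax.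
have top z' j : reach v z' -> (`|z' j| <= M)%N.
  by move=> vz'; apply: Mmax; apply/asboolP; exists z' => //; exists j.
have top4 z' i' a b c : reach v z' -> uniq [:: i'; a; b; c] -> (`|z' i'| + `|z' a| + `|z' b| + `|z' c| <= 2 * M)%N.
  move=> vz' u4; have [u z'u [j uj]] := reach_sum (reach_cond vz' cv) u4.
  by have := top _ j (reach_trans vz' z'u); move: (`|z' i'| + _ + _ + _)%N uj => m; lia.
have cz := reach_cond vz cv.
have par j : odd `|z j| = odd `|z i|.
  have := leech_cond_parity j i cz; lia.
have [| |[zi8 zj]|[a [b [c [u4 z6 za zb zc]]]]] := @dominant_coordinate _ Omega24 (fun j => `|z j|%N) i (norm z vz) par.
- by move=> a b c u4; have := top4 z i a b c vz u4; rewrite zi; lia.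
- by move=> j; rewrite zi; exact: top.
- exists z => //; have [b bE] := abs_sign (z i); exists i, b; apply/ffunP => j; rewrite ffunE.
  have [->|ji] := eqVneq j i; last by have := zj j ji; lia.
  transitivity ((-1) ^+ b * ((-1) ^+ b * z i)); first by rewrite mulrA -signr_addb addbb mul1r.
  by rewrite bE zi8 mulr1.
have M6 : M = 6%N by rewrite -zi.
have [u zu [u0 u1 u2 u3]] := reach_balanced cz u4 z6 za zb zc.
have vu := reach_trans vz zu.
have [uw sw] := lw.
have ulab k l : (k < l)%N -> (l < 4)%N -> lab k != lab l.
  by move=> kl l4; have l24 := leq_trans l4 (isT : 4 <= 24)%N; rewrite nth_uniq ?sw // ?(ltn_trans kl) // neq_ltn kl.
have uz d : d != lab 1 -> d != lab 2 -> d != lab 3 -> u d = 0.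
  move=> d1 d2 d3; have ud : uniq [:: d; lab 1; lab 2; lab 3].
    by rewrite /= !inE !negb_or d1 d2 d3 !ulab.
  by have := top4 u d (lab 1) (lab 2) (lab 3) vu ud; rewrite u1 u2 u3 M6; lia.
have := norm u vu; rewrite (bigD1 (lab 1)) //= (bigD1 (lab 2)) /=; last by rewrite eq_sym ulab.
rewrite (bigD1 (lab 3)) /=; last by rewrite ![lab 3 == _]eq_sym !ulab.
by rewrite u1 u2 u3 big1 // => d /andP[/andP[d1 d2] d3]; rewrite uz.
Qed.

End Descent.

(** * From the axes to M24 and sign changes *)

Section SignedPermutations.
Context {R : realType} {Omega : finType}.
Local Notation V := (euclid R Omega).
Local Notation zvec := {ffun Omega -> int}.
Implicit Types (f h : {linear V -> V}) (z u : zvec).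

Lemma dotp_nu i k : dotp (nu i : V) (nu k) = (i == k)%:R.
Proof.
rewrite /dotp (bigD1 i) //= big1 => [|j /negPf ji]; last by rewrite nuE ji mul0r.
by rewrite !nuE eqxx mul1r addr0.
Qed.

Lemma linear_nu_eq f h : (forall i, f (nu i) = h (nu i)) -> f =1 h.
Proof.
move=> fh x; rewrite [x]euclid_sum_nu !linear_sum; apply: eq_bigr => i _.
by rewrite !linearZ /= fh.
Qed.

Lemma extmap_eq g f h (x : tensors R Omega g) : f =1 h -> extmap f x = extmap h x.
Proof.
move=> fh; apply/ffunP => i; rewrite !ffunE; apply: eq_bigr => j _; congr (_ * _).
by apply: eq_bigr => a _; rewrite fh.
Qed.

Lemma signed_perm f : isometry f -> (forall i, exists k (b : bool), f (nu i) = (-1) ^+ b *: nu k) ->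
  exists (s : {perm Omega}) (D : {set Omega}), f =1 sign_map D \o perm_euclid s.
Proof.
move=> fI fS; have fS' i : exists q : Omega * bool, f (nu i) = (-1) ^+ q.2 *: nu q.1.
  by have [k [b e]] := fS i; exists (k, b).
have [p pE] := choice fS'.
have pI : injective (fun i => (p i).1).
  move=> i k pik; apply/eqP; apply: contraT => ik.
  have := fI (nu i) (nu k); rewrite !pE pik dotp_nu (negPf ik).
  have -> (a b : R) (x : V) : dotp (a *: x) (b *: x) = a * b * dotp x x.
    by rewrite /dotp mulr_sumr; apply: eq_bigr => j _; rewrite !ffunE mulrACA.
  by rewrite dotp_nu eqxx mulr1 -signr_addb => /eqP; rewrite signr_eq0.
pose s := perm pI; exists s, [set s i | i in [set i | (p i).2]]%SET.
apply: linear_nu_eq => i; rewrite /= perm_euclid_nu sign_map_nu mem_imset ?inE; last exact: perm_inj.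
by rewrite pE permE.
Qed.

Lemma ivec_axis a j : ivec (set_vec a [set j]%SET) = ((Num.sqrt 8)^-1 * a%:~R) *: nu j :> V.
Proof. by apply/ffunP => k; rewrite !ffunE inE intrM mulrA; congr (_ * _); case: (k == j). Qed.

(** The entries are even and their squares add up to 4, so a single one is
    nonzero. *)
Lemma axis_square z : \sum_i z i * z i = 4 -> odd_set z = finset.set0 ->
  exists k (b : bool), z = set_vec ((-1) ^+ b * 2) [set k]%SET.
Proof.
move=> z4 zev; have ev i : (2 %| z i)%Z.
  by have := finset.in_set0 i; rewrite -zev inE => /negbFE.
have [k zk] : exists k, z k != 0.
  apply/existsP; apply: contraT; rewrite negb_exists => /forallP z00.
  by move: z4; rewrite big1 // => i _; have := z00 i; rewrite negbK => /eqP->; rewrite mul0r.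
move: z4; rewrite (bigD1 k) //=; set S := \sum_(i | _) _ => z4.
have S0 : 0 <= S by apply: sumr_ge0 => i _; rewrite -expr2 sqr_ge0.
have [zk2 S_0] : (z k = 2 \/ z k = -2) /\ S = 0.
  have := ev k; move: (z k) zk z4 => a a0 z4 /dvdzP[c aE]; nia.
exists k, (z k == -2); apply/ffunP => i; rewrite ffunE inE.
have [->|ik] := eqVneq i k; first by case: zk2 => ->.
rewrite mulr0; apply/eqP; have /eqP := S_0; rewrite psumr_eq0 => [/allP/(_ i)|j _].
  by rewrite mem_index_enum ik /= mulf_eq0 orbb; apply.
by rewrite -expr2 sqr_ge0.
Qed.

Lemma card_odd_set z : #|odd_set z|%:Z <= \sum_i z i * z i.
Proof.
rewrite -sum1_card (big_morph Posz PoszD erefl) big_mkcond; apply: ler_sum => i _.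
by rewrite inE; case: ifP => zi; move: (z i) zi => a; nia.
Qed.

End SignedPermutations.

Section LeechIsometries.
Context {R : realType} {Omega : finType}.
Local Notation V := (euclid R Omega).
Local Notation zvec := {ffun Omega -> int}.
Variable G : {vspace {ffun Omega -> ('F_2)^o}}.
Hypothesis Omega24 : #|Omega| = 24%N.
Hypothesis golayG : extended_golay G.
Variable w : seq Omega.
Hypothesis wG : golay_labelling G w.
Variable g : nat.
Variable z0 : Omega.
Local Notation cw := (codeword G).
Local Notation L := (leech R G).
Local Notation ivec := (@ivec R Omega).
Local Notation lcond := (leech_cond G).
Local Notation t := (golay_tensor (R := R) w g).
Local Notation axis a j := (set_vec a [set j]%SET).
Implicit Types (z u v : zvec) (A C D : {set Omega}) (s : {perm Omega}) (f h : {linear V -> V}).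

Lemma leech_cond_axis j : lcond (axis 8 j).
Proof.
split=> [i|C _]; first by rewrite sum_set_vecT cards1 ffunE; case: (i \in _).
by rewrite sum_set_vec; move: #|_| => m; lia.
Qed.

Lemma leech_cond_pair i j : i != j -> lcond (set_vec 4 [set i; j]%SET).
Proof.
move=> ij; split=> [k|C _]; first by rewrite sum_set_vecT cards2 ij ffunE; case: (k \in _).
by rewrite sum_set_vec; move: #|_| => m; lia.
Qed.

(** Let y and r be the images of 8 nu_i and 4 nu_i + 4 nu_x0.  Twice r is y plus
    the image of 8 nu_x0, and y is orthogonal to that image, so r has an entry 4 or
    -4; hence r is even and y is divisible by 4.  The squares of the entries of y/4
    add up to 4, while the set of its odd entries is a codeword: it is empty, so
    y/4 is twice a signed basis vector. *)
Lemma axis_images f i j (b : bool) x0 : isometry f -> (forall x, L x -> L (f x)) ->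
  f (ivec (axis 8 x0)) = ivec (axis ((-1) ^+ b * 8) j) ->
  exists k (c : bool), f (ivec (axis 8 i)) = ivec (axis ((-1) ^+ c * 8) k).
Proof.
move=> fI fL fx0; have [->|ix0] := eqVneq i x0; first by exists j, b.
have Lf z : lcond z -> exists2 z', f (ivec z) = ivec z' & lcond z'.
  by move=> /(leechE Omega24 golayG wG)/fL/(leech_sub Omega24 golayG).
have [y yE cy] := Lf _ (leech_cond_axis i).
have [r rE cr] := Lf _ (leech_cond_pair ix0).
have ry k : 2 * r k = y k + axis ((-1) ^+ b * 8) j k.
  have : [ffun k => 2 * r k] = y + axis ((-1) ^+ b * 8) j.
    apply: (@ivec_inj R); rewrite -ivecZ ivecD -rE -yE -fx0 -linearZ -linearD; congr (f _).
    rewrite ivecZ -ivecD; congr ivec; apply/ffunP => l; rewrite !ffunE !inE.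
    have [->|_] := eqVneq l i; last by case: (l == x0).
    by rewrite (negPf ix0).
  by move/ffunP/(_ k); rewrite !ffunE.
have sum_axis (v : zvec) a l : \sum_k v k * axis a l k = v l * a.
  rewrite (bigD1 l) //= big1 => [|k kl]; last by rewrite ffunE inE (negPf kl) !mulr0.
  by rewrite ffunE inE eqxx addr0 mulr1.
have yj : y j = 0.
  have := isometry_ivec fI yE fx0; rewrite !sum_axis ffunE inE eq_sym (negPf ix0) mulr0 mul0r.
  by case: (b) => /=; move: (y j) => a; lia.
have r2 k : (2 %| r k)%Z.
  rewrite -(subrK (r j) (r k)) rpredD //; first exact: leech_cond_parity cr.
  by have := ry j; rewrite yj ffunE inE eqxx; case: (b) => /=; move: (r j); lia.
pose u : zvec := [ffun k => (r k %/ 2)%Z].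
have ru k : r k = 2 * u k by rewrite ffunE mulrC divzK.
pose x : zvec := u - axis ((-1) ^+ b * 2) j.
have xE' k : x k = u k - (-1) ^+ b * 2 * (k \in [set j]%SET)%:Z by rewrite !ffunE.
have yx k : y k = 4 * x k.
  have := ry k; rewrite ru xE' [axis _ _ k]ffunE => e.
  have -> : y k = 2 * (2 * u k) - (-1) ^+ b * 8 * (k \in [set j]%SET)%:Z by rewrite e; ring.
  by ring.
have x4 : \sum_k x k * x k = 4.
  have := isometry_ivec fI yE yE; rewrite sum_axis ffunE inE eqxx.
  rewrite (eq_bigr (fun k => 16 * (x k * x k))) => [|k _]; last by rewrite yx; ring.
  by rewrite -mulr_sumr -[Posz true]/(1 : int); move: (\sum_k _) => S; lia.
have ux : odd_set x = odd_set u.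
  apply/setP => k; rewrite [LHS]inE [RHS]inE xE'.
  by move: (u k) => a; case: (b); case: (k \in _) => /=; lia.
have xev : odd_set x = finset.set0.
  apply: (codeword_short golayG); first by rewrite ux; apply: (leech_cond_word Omega24 golayG cr (b := 0)) => k; rewrite add0r ru.
  by have := card_odd_set x; rewrite x4; lia.
have [k [c xE]] := axis_square x4 xev; exists k, c; rewrite yE; congr ivec.
by apply/ffunP => l; rewrite yx xE !ffunE; ring.
Qed.

Lemma ivec_nu i : ivec (axis 8 i) = Num.sqrt 8 *: nu i.
Proof.
rewrite ivec_axis; congr (_ *: _); apply: (mulfI (sqrt8_neq0 (R := R))).
by rewrite mulrA mulfV ?sqrt8_neq0 // mul1r -expr2 sqr_sqrtr ?ler0n.
Qed.

(** The permutation and the sign set are recovered from the congruences of the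
    images of 2 nu_C and of nu_Omega - 4 nu_i. *)
Theorem leech_signed_perm f j (b : bool) x0 : isometry f -> (forall x, L x -> L (f x)) ->
  f (ivec (axis 8 x0)) = ivec (axis ((-1) ^+ b * 8) j) ->
  exists s D, [/\ s \in M24 G, cw D & f =1 sign_map D \o perm_euclid s].
Proof.
move=> fI fL fx0; have fS i : exists k (c : bool), f (nu i) = (-1) ^+ c *: nu k.
  have [k [c e]] := axis_images i fI fL fx0; exists k, c.
  apply: (scalerI (sqrt8_neq0 (R := R))); have <- : f (Num.sqrt 8 *: nu i) = Num.sqrt 8 *: f (nu i) by exact: linearZ.
  rewrite -ivec_nu e scalerA [Num.sqrt 8 * _]mulrC -scalerA -ivec_nu !ivec_axis scalerA.
  by rewrite intrM rmorphXn rmorphN1 mulrCA.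
have [s [D fE]] := signed_perm fI fS.
have Lf z : lcond z -> lcond [ffun i => (-1) ^+ (i \in D) * z (s^-1%g i)].
  move=> /(leechE Omega24 golayG wG)/fL; rewrite fE /= perm_euclid_ivec sign_map_ivec.
  by move/(leechE Omega24 golayG wG); congr (lcond _); apply/ffunP => i; rewrite !ffunE.
exists s, D; split=> //.
  apply/M24P => // C GC; have c' := Lf _ (leech_cond_codeword Omega24 golayG GC).
  have <- : odd_set [ffun i => (-1) ^+ (i \in D) * (s^-1%g i \in C)%:Z] = s @: C.
    apply/setP => i; rewrite inE ffunE -{3}(permKV s i) mem_imset; last exact: perm_inj.
    by case: (_ \in D); case: (_ \in C).
  apply: (leech_cond_word Omega24 golayG c' (b := 0)) => i; rewrite !ffunE.
  by ring.
have c' := Lf _ (leech_cond_gen Omega24 golayG z0).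
pose u : zvec := [ffun i => if i \in D then 2 * (s^-1%g i == z0)%:Z - 1 else - 2 * (s^-1%g i == z0)%:Z].
have <- : odd_set u = D.
  apply/setP => i; rewrite inE ffunE; case: ifP => _; case: (_ == z0) => //.
apply: (leech_cond_word Omega24 golayG c' (b := 1)) => i; rewrite ffunE leech_genE [u i]ffunE.
by case: ifP => _ /=; ring.
Qed.

(** The vector sqrt 8 nu_0 has norm 8 in the lattice.  Its image by f descends to an axis by
    some h fixing t, so h f is a sign change on a codeword after an element of
    M24; it fixes t, and therefore so does f. *)
Theorem O_Leech_tensor f : O_Leech R G f -> extmap f t = t.
Proof.
move=> [fI fL]; have fL' x : L x -> L (f x) by rewrite -{2}fL => Lx; exists x.
have /fL'/(leech_sub Omega24 golayG)[v vE cv] : L (ivec (axis 8 z0)).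
  by apply/(leechE Omega24 golayG wG); exact: leech_cond_axis.
have v64 : \sum_i v i * v i = 64.
  rewrite (isometry_ivec fI vE vE) (bigD1 z0) //= big1 => [|i iz]; last by rewrite !ffunE inE (negPf iz).
  by rewrite !ffunE inE eqxx.
have [u [h hg hv] [j [b uE]]] := reach_axis (R := R) Omega24 golayG wG g z0 cv v64.
have [hI hL ht [h' hK]] := hg.
have hfI : isometry (h \o f) by apply: isometry_comp.
have hfL x : L x -> L ((h \o f) x) by move=> /fL'/hL.
have hf0 : (h \o f) (ivec (axis 8 z0)) = ivec (axis ((-1) ^+ b * 8) j).
  by rewrite /= vE hv uE; congr ivec; apply/ffunP => i; rewrite !ffunE inE.
have [s [D [sG GD hfE]]] := leech_signed_perm hfI hfL hf0.
have st := M24_tensor (R := R) Omega24 golayG wG g z0 sG.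
have Dt := sign_tensor (R := R) Omega24 golayG wG g GD.
apply: (can_inj (@extmapK R Omega g _ _ hK)).
move: t ht st Dt => x hx sx Dx.
by rewrite hx extmap_comp (extmap_eq x hfE) -extmap_comp sx.
Qed.

Lemma O_Leech_of f h : isometry f -> (forall x, L x -> L (f x)) -> (forall x, L x -> L (h x)) ->
  cancel h f -> O_Leech R G f.
Proof.
move=> fI fL hL hK; split=> //; apply/seteqP; split=> [_ [x Lx <-]|x Lx]; first exact: fL.
by exists (h x); [exact: hL | exact: hK].
Qed.

Lemma O_Leech_sign A : cw A -> O_Leech R G (sign_map A).
Proof.
move=> GA; have [hI hL _ _] := good_sign (R := R) Omega24 golayG wG g GA.
exact: (O_Leech_of hI hL hL (sign_mapK A)).
Qed.

Lemma O_Leech_perm s : s \in M24 G -> O_Leech R G (perm_euclid s).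
Proof.
move=> sG; apply: (O_Leech_of (h := perm_euclid s^-1%g)).
- exact: isometry_perm.
- exact: (perm_leech Omega24 golayG wG).
- by apply: (perm_leech Omega24 golayG wG); rewrite M24_groupV.
- by move=> x; apply/ffunP => i; rewrite !ffunE invgK permKV.
Qed.

End LeechIsometries.

(** * Alternating tensors and rational spans *)

Section Alternating.
Context {R : realType} {Omega : finType} {g : nat}.
Local Notation V := (euclid R Omega).
Local Notation tens := (tensors R Omega g).
Local Notation idx := {ffun 'I_g -> Omega}.
Implicit Types (x y : tens) (i : idx).

Definition alternating x : Prop :=
  forall (s : 'S_g) i, x (reindex_idx s i) = (-1) ^+ s * (x i : R).

Lemma alternating_wedge (v : 'I_g -> V) : alternating (wedge v).
Proof.
move=> s i; rewrite !ffunE; set M := \matrix_(a, b) (v a (i b) : R).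
have -> : \matrix_(a, b) (v a (reindex_idx s i b) : R) = col_perm s M.
  by apply/matrixP => a b; rewrite !mxE ffunE.
by rewrite col_permE det_mulmx det_perm odd_permV mulrC.
Qed.

Lemma alternating_neq0 x i : alternating x -> x i != 0 -> injective i.
Proof.
move=> xA xi a b iab; apply/eqP; apply: contraNT xi => ab.
have := xA (tperm a b) i; rewrite odd_tperm ab expr1 mulN1r.
have -> : reindex_idx (tperm a b) i = i.
  by apply/ffunP => c; rewrite ffunE; case: tpermP => [->|->|].
by move/eqP; rewrite -subr_eq0 opprK -mulr2n mulrn_eq0.
Qed.

Lemma reindex_exists i i' : injective i -> injective i' ->
  [set i a | a in 'I_g]%SET = [set i' a | a in 'I_g]%SET -> exists s : 'S_g, i' = reindex_idx s i.
Proof.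
move=> iI i'I ii'; have ex a : exists b, i b = i' a.
  have : i' a \in [set i a | a in 'I_g]%SET by rewrite ii' imset_f.
  by case/imsetP => b _ ->; exists b.
have [f fE] := choice ex; have fI : injective f by move=> a b fab; apply: i'I; rewrite -!fE fab.
by exists (perm fI); apply/ffunP => a; rewrite ffunE permE fE.
Qed.

Lemma beta_reindex i (s : 'S_g) : injective i -> beta R i (reindex_idx s i) = (-1) ^+ s :> R.
Proof.
move=> iI; rewrite alternating_wedge ffunE (_ : \matrix_(_, _) _ = 1%:M) ?det1 ?mulr1 //.
by apply/matrixP => a b; rewrite !mxE nuE (inj_eq iI) eq_sym.
Qed.

Lemma beta_eq0 (c : 'I_g -> Omega) i b : (forall a, c a != i b) -> beta R c i = 0 :> R.
Proof.
move=> cb; rewrite ffunE /determinant big1 // => s _; rewrite (bigD1 (s^-1%g b)) //= mxE nuE permKV.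
by rewrite eq_sym (negPf (cb _)) mul0r mulr0.
Qed.

Lemma extmap_signE A x i : extmap (sign_map A) x i = (-1) ^+ (\sum_a (i a \in A)) * (x i : R).
Proof.
rewrite ffunE (bigD1 i) //= [X in _ + X]big1 ?addr0 => [|j ji].
  rewrite expr_sum; congr (_ * _); apply: eq_bigr => a _.
  by rewrite sign_map_nu !ffunE eqxx /GRing.scale /= mulr1.
have [a ja] : exists a, i a != j a.
  apply/existsP; apply: contraNT ji; rewrite negb_exists => /forallP ij.
  by apply/eqP/ffunP => a; apply/esym/eqP; have := ij a; rewrite negbK.
by rewrite (bigD1 a) //= sign_map_nu !ffunE (negPf ja) /GRing.scale /= mulr0 !mul0r.
Qed.

Lemma extmap_permE (s : {perm Omega}) x i : extmap (perm_euclid s) x i = x [ffun a => s^-1%g (i a)] :> R.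
Proof.
rewrite ffunE (bigD1 [ffun a => s^-1%g (i a)]) //= [X in _ + X]big1 ?addr0 => [|j ji].
  by rewrite big1 ?mul1r // => a _; rewrite perm_euclid_nu !ffunE permKV eqxx.
have [a ja] : exists a, i a != s (j a).
  apply/existsP; apply: contraNT ji; rewrite negb_exists => /forallP ij.
  by apply/eqP/ffunP => a; rewrite ffunE; have := ij a; rewrite negbK => /eqP->; rewrite permK.
by rewrite (bigD1 a) //= perm_euclid_nu !ffunE (negPf ja) !mul0r.
Qed.

Lemma wedgeZ (c : R) (v : 'I_g -> V) : wedge (fun a => c *: v a) = c ^+ g *: wedge v.
Proof.
apply/ffunP => i; rewrite !ffunE /GRing.scale /= -detZ; congr (\det _).
by apply/matrixP => a b; rewrite !mxE ffunE.
Qed.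

End Alternating.

Section RationalSpans.
Context {R : realType} {U : lmodType R}.
Implicit Types (A H : set U) (x y : U).

Lemma rat_span_subspace A : rat_subspace (rat_span A).
Proof.
split=> [H [[H0 _] _]|q x y Ax Ay H HA]; first exact: H0.
by have [[_ HD] _] := HA; apply: HD; [exact: Ax | exact: Ay].
Qed.

Lemma mem_rat_span A x : A x -> rat_span A x.
Proof. by move=> Ax H [_]; apply. Qed.

Lemma rat_span_min A H : rat_subspace H -> A `<=` H -> rat_span A `<=` H.
Proof. by move=> HS AH x; apply. Qed.

Lemma rat_subspaceZ H (q : rat) x : rat_subspace H -> H x -> H (ratr q *: x).
Proof. by move=> [H0 HD] Hx; rewrite -[_ *: _]addr0; exact: HD. Qed.

Lemma rat_subspace_sum H (I : Type) (r : seq I) (F : I -> U) (q : I -> rat) : rat_subspace H ->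
  (forall i, H (F i)) -> H (\sum_(i <- r) ratr (q i) *: F i).
Proof.
move=> [H0 HD] HF; elim: r => [|i r IH]; first by rewrite big_nil.
by rewrite big_cons; exact: HD.
Qed.

End RationalSpans.

Section Invariants.
Context {R : realType} {Omega : finType}.
Local Notation V := (euclid R Omega).
Variable G : {vspace {ffun Omega -> ('F_2)^o}}.
Hypothesis Omega24 : #|Omega| = 24%N.
Hypothesis golayG : extended_golay G.
Variable g : nat.
Hypothesis g_even : ~~ odd g.
Local Notation tens := (tensors R Omega g).
Local Notation idx := {ffun 'I_g -> Omega}.
Local Notation cw := (codeword G).
Local Notation L := (leech R G).
Local Notation "'im' i" := ([set i a | a in 'I_g]%SET) (at level 10).
Implicit Types (x y : tens) (i : idx).

Lemma sqrt8_pow : (Num.sqrt 8)^-1 ^+ g = ratr (8^-1 ^+ g./2) :> R.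
Proof.
rewrite -[g in LHS]odd_double_half (negPf g_even) add0n -mul2n exprM exprVn sqr_sqrtr ?ler0n //.
by rewrite rmorphXn fmorphV rmorph_nat.
Qed.

(** A coordinate of a wedge of g lattice vectors is an integer determinant divided
    by sqrt 8 ^ g, which is rational because g is even. *)
Lemma ext_leech_facts x : ext_leech R G g x ->
  alternating x /\ forall i, exists q : rat, x i = ratr q.
Proof.
apply: (rat_span_min (H := fun x => alternating x /\ forall i, exists q : rat, x i = ratr q)).
  split; first by split=> [s i|i]; [rewrite !ffunE mulr0 | exists 0; rewrite ffunE rmorph0].
  move=> q y z [yA yQ] [zA zQ]; split=> [s i|i].
    by rewrite !ffunE /GRing.scale /= yA zA mulrDr mulrCA.
  have [a ya] := yQ i; have [b zb] := zQ i; exists (q * a + b).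
  by rewrite !ffunE ya zb rmorphD rmorphM.
move=> _ [v vL <-]; split=> [|i]; first exact: alternating_wedge.
have ex k : exists z, v k = ivec z by have [z -> _] := leech_sub Omega24 golayG (vL k); exists z.
have [z zE] := choice ex.
exists (8^-1 ^+ g./2 * (\det (\matrix_(a, b) z a (i b)))%:~R).
rewrite rmorphM /= -sqrt8_pow ffunE ratr_int.
rewrite -det_map_mx -detZ; congr (\det _).
by apply/matrixP => a b; rewrite !mxE zE ffunE.
Qed.

Definition code_invariant x : Prop := [/\ alternating x,
  forall C, cw C -> extmap (sign_map C) x = x & forall s, s \in M24 G -> extmap (perm_euclid s) x = x].

Lemma code_invariant_comb (c : R) x y : code_invariant x -> code_invariant y -> code_invariant (x - c *: y).
Proof.
move=> [xA xS xM] [yA yS yM]; split=> [s i|C GC|s sG].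
- by rewrite !ffunE /GRing.scale /= xA yA mulrBr mulrCA.
- by rewrite linearB linearZ /= xS ?yS.
- by rewrite linearB linearZ /= xM ?yM.
Qed.

(** Invariance under the sign change on D forces an even intersection with D; by
    self-duality the support of a nonzero coordinate is a codeword. *)
Lemma code_invariant_support x i : code_invariant x -> x i != 0 -> injective i /\ cw (im i).
Proof.
move=> [xA xS _] xi; have iI := alternating_neq0 xA xi; split=> //.
apply: (self_dual Omega24 golayG) => D GD.
have := congr1 (fun y : tens => y i) (xS D GD); rewrite extmap_signE -[X in _ = X]mul1r.
move/(mulIf xi); rewrite -signr_odd.
have -> : (\sum_a (i a \in D))%N = #|im i :&: D|.
  transitivity (\sum_(k in im i) (k \in D))%N.
    by rewrite big_imset; [apply: eq_bigl => a | exact: in2W].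
  rewrite -sum1_card big_mkcond [RHS]big_mkcond; apply: eq_bigr => k _.
  by rewrite [in RHS]inE; case: (_ \in im i); case: (_ \in D).
by case: odd => //= /eqP; rewrite expr1 eq_sym -addr_eq0 -mulr2n pnatr_eq0.
Qed.

End Invariants.

(** * The invariant line *)

(** One codeword of each weight, found exactly once in the list of words, so that the
    corresponding coordinate of t is a single sign. *)
Lemma rep_words_ok : all (fun n => has (fun k => (count id k == n)%N && (count (pred1 k) golay_words == 1)%N) golay_reps)
  [:: 0; 8; 12; 16; 24]%N.
Proof. by vm_compute. Qed.

Lemma sum_sign_single (S : pzRingType) (l : seq (bool * bitseq)) : size l = 1%N ->
  exists b : bool, \sum_(p <- l) (-1) ^+ p.1 = (-1) ^+ b :> S.
Proof. by case: l => [|p [|]] // _; exists p.1; rewrite big_seq1. Qed.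

Section Line.
Context {R : realType} {Omega : finType}.
Local Notation V := (euclid R Omega).
Variable G : {vspace {ffun Omega -> ('F_2)^o}}.
Hypothesis Omega24 : #|Omega| = 24%N.
Hypothesis golayG : extended_golay G.
Variable w : seq Omega.
Hypothesis wG : golay_labelling G w.
Variable g : nat.
Hypothesis gG : g \in [:: 0; 8; 12; 16; 24]%N.
Variable z0 : Omega.
Local Notation tens := (tensors R Omega g).
Local Notation idx := {ffun 'I_g -> Omega}.
Local Notation cw := (codeword G).
Local Notation L := (leech R G).
Local Notation ivec := (@ivec R Omega).
Local Notation t := (golay_tensor (R := R) w g).
Local Notation code_invariant := (@code_invariant R Omega G g).
Local Notation "'im' i" := ([set i a | a in 'I_g]%SET) (at level 10).
Implicit Types (x y : tens) (i : idx).
Let lw : labelling w. Proof. by case: wG. Qed.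

Let g_even : ~~ odd g.
Proof. by move: gG; rewrite !inE => /or4P[|||/orP[]] /eqP->. Qed.

Lemma card_im i : injective i -> #|im i| = g.
Proof. by move=> iI; rewrite card_imset // card_ord. Qed.

Lemma code_invariant_perm x s i : code_invariant x -> s \in M24 G -> x [ffun a => s (i a)] = x i.
Proof.
move=> [_ _ xM] sG; rewrite -{1}(xM s sG) extmap_permE; congr (x _).
by apply/ffunP => a; rewrite !ffunE permK.
Qed.

(** M24 is transitive on the codewords of weight g, so two coordinates supported
    on codewords are related by a sign that is the same for all invariants. *)
Lemma code_invariant_transport i i' : injective i -> injective i' -> cw (im i) -> cw (im i') ->
  exists b : bool, forall x, code_invariant x -> x i' = (-1) ^+ b * (x i : R).
Proof.
move=> iI i'I Gi Gi'; have [|s sG si] := M24_transitive (R := R) Omega24 golayG wG g Gi Gi'.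
  by rewrite !card_im.
have sI : injective [ffun a => s (i a)] by move=> a b; rewrite !ffunE => /perm_inj/iI.
have [|p pE] := reindex_exists sI i'I.
  rewrite -si -imset_comp; apply: eq_imset => a; rewrite ffunE //.
exists (odd_perm p) => x xI; rewrite pE; have [xA _ _] := xI.
by rewrite xA (code_invariant_perm _ xI sG).
Qed.

Lemma code_invariant_eq0 x i : code_invariant x -> injective i -> cw (im i) -> x i = 0 -> x = 0.
Proof.
move=> xI iI Gi xi; apply/ffunP => i'; rewrite ffunE; apply/eqP; apply: contraT => xi'.
have [i'I Gi'] := code_invariant_support Omega24 golayG xI xi'.
have [b bE] := code_invariant_transport iI i'I Gi Gi'.
by move: xi'; rewrite bE // xi mulr0 eqxx.
Qed.

Lemma ext_leech_wedge_seq (k : bitseq) : ext_leech R G g (wedge_seq g (mask k [seq nu z | z <- w])).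
Proof.
have [H0 HD] := rat_span_subspace [set wedge v | v in [set v | forall k : 'I_g, L (v k)]].
rewrite /wedge_seq; case: eqP => // sg.
pose l (a : 'I_g) := nth z0 (mask k w) a.
have -> : wedge (fun a : 'I_g => nth 0 (mask k [seq nu z | z <- w]) a) =
    ratr (8^-1 ^+ g./2) *: wedge (fun a : 'I_g => ivec (set_vec 8 [set l a]%SET)).
  rewrite -(sqrt8_pow (R := R) g_even) -wedgeZ; congr wedge; apply/funext => a.
  rewrite ivec_nu scalerA mulVf ?sqrt8_neq0 // scale1r -map_mask (nth_map z0) //.
  by rewrite -(size_map (nu (R := R))) map_mask sg.
apply: (rat_subspaceZ _ (conj H0 HD)).
apply: (@mem_rat_span R _ [set wedge v | v in [set v | forall k : 'I_g, L (v k)]]).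
exists (fun a : 'I_g => ivec (set_vec 8 [set l a]%SET)) => //.
by move=> a; apply/(leechE Omega24 golayG wG); exact: leech_cond_axis.
Qed.

Lemma ext_leech_tensor : ext_leech R G g t.
Proof.
rewrite (golay_tensorE Omega24 wG).
rewrite (eq_bigr (fun p : bool * bitseq => ratr ((-1) ^+ p.1) *: wedge_seq g (mask p.2 [seq nu z | z <- w]))).
  by apply: (@rat_subspace_sum R _ (ext_leech R G g)); [exact: rat_span_subspace | move=> p; exact: ext_leech_wedge_seq].
by move=> p _; rewrite rmorphXn rmorphN1.
Qed.

Lemma tensor_invariant : ext_leech_invariants R G g t.
Proof. by split; [exact: ext_leech_tensor | move=> f; exact: O_Leech_tensor]. Qed.

Lemma invariant_code_invariant x : ext_leech_invariants R G g x -> code_invariant x.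
Proof.
move=> [xL xI]; have [xA _] := ext_leech_facts Omega24 golayG g_even xL; split=> // [C GC|s sG].
  by apply: xI; exact: (O_Leech_sign Omega24 golayG wG g GC).
by apply: xI; exact: (O_Leech_perm Omega24 golayG wG sG).
Qed.

Lemma tensor_coord : exists i, [/\ injective i, cw (im i) & exists b : bool, t i = (-1) ^+ b].
Proof.
have /hasP[k _ /andP[/eqP kg /eqP k1]] := allP rep_words_ok g gG.
have kW : k \in golay_words by rewrite -has_pred1 has_count k1.
have [sk Gk] := golay_word_codeword Omega24 wG kW; have [uw sw] := lw.
have skw : size (mask k w) = g by rewrite size_mask ?sk ?sw.
pose i : idx := [ffun a : 'I_g => nth z0 (mask k w) a].
have iI : injective i.
  move=> a b; rewrite !ffunE => /eqP; rewrite nth_uniq ?skw ?mask_uniq // => /eqP; exact: val_inj.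
have imi : im i = key_set w k.
  apply/eqP; rewrite finset.eqEcard card_im // (card_key_set Omega24 wG) // kg leqnn andbT.
  by apply/fintype.subsetP => _ /imsetP[a _ ->]; rewrite ffunE inE mem_nth ?skw.
exists i; split; rewrite ?imi //.
have tE : t i = \sum_(p <- signed_words | p.2 == k) (-1) ^+ p.1 :> R.
  rewrite (golay_tensorE Omega24 wG) sum_ffunE [RHS]big_mkcond; apply: eq_big_seq => p pW.
  have [sp Gp] := golay_word_codeword Omega24 wG (map_f snd pW).
  rewrite ffunE /GRing.scale /= /wedge_seq.
  have nuE' q : size (mask q w) = g ->
      wedge (fun a : 'I_g => nth 0 (mask q [seq nu z | z <- w]) a) = beta R (fun a : 'I_g => nth z0 (mask q w) a).
    move=> sq; rewrite /beta; congr wedge; apply/funext => a.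
    by rewrite -map_mask (nth_map z0) // sq.
  have [->|pk] := eqVneq p.2 k.
    rewrite -map_mask size_map skw eqxx map_mask nuE' //.
    have -> : (fun a : 'I_g => nth z0 (mask k w) a) = i by apply/funext => a; rewrite ffunE.
    have := beta_reindex (R := R) 1%g iI; rewrite odd_perm1.
    have -> : reindex_idx 1%g i = i by apply/ffunP => a; rewrite ffunE perm1.
    by move=> ->; rewrite mulr1.
  rewrite -map_mask size_map map_mask; case: eqP => [sp'|_]; last by rewrite ffunE mulr0.
  rewrite nuE' //; have [b ib] : exists b, i b \notin key_set w p.2.
    apply/existsP; rewrite -negb_forall; apply: contra pk => /forallP sub.
    apply/eqP/(key_set_inj Omega24 wG sp sk)/esym/eqP; rewrite finset.eqEcard -imi card_im // (card_key_set Omega24 wG) //.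
    rewrite -(size_mask (m := p.2) (s := w)) ?sp ?sw // sp' leqnn andbT.
    by apply/fintype.subsetP => _ /imsetP[a _ ->].
  rewrite (beta_eq0 (b := b)) ?mulr0 // => a; apply: contraNneq ib => <-.
  by rewrite inE mem_nth ?sp'.
rewrite tE -big_filter.
by apply: sum_sign_single; rewrite size_filter -(count_map snd (pred1 k)) k1.
Qed.

Lemma tensor_sign i : injective i -> cw (im i) -> exists b : bool, t i = (-1) ^+ b.
Proof.
have [i0 [i0I Gi0 [b0 t0]]] := tensor_coord; move=> iI Gi.
have [b bE] := code_invariant_transport i0I iI Gi0 Gi.
have ti := bE _ (invariant_code_invariant tensor_invariant).
by exists (b (+) b0); rewrite (etrans ti (f_equal _ t0)) signr_addb.
Qed.

(** An invariant vanishing at one coordinate supported on a codeword vanishes;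
    hence x is its coordinate there, which is rational, times t. *)
Lemma invariants_line (b : bool) : ext_leech_invariants R G g = rat_span [set (-1) ^+ b *: t].
Proof.
have tI := tensor_invariant; have tC := invariant_code_invariant tI; have tco := tensor_coord.
move: t tI tC tco => y tI tC [i [iI Gi [c tc]]].
have HS : rat_subspace (ext_leech_invariants R G g).
  have [E0 ED] := rat_span_subspace [set wedge v | v in [set v | forall k : 'I_g, L (v k)]].
  split; first by split=> // f _; exact: linear0.
  move=> q x x' [xE xI] [yE yI]; split; first exact: ED.
  by move=> f fO; rewrite linearD linearZ /= xI ?yI.
apply/seteqP; split=> [x xH|]; last first.
  apply: rat_span_min => // _ ->; have := rat_subspaceZ ((-1) ^+ b) HS tI.
  by rewrite rmorphXn rmorphN1.
have [q xq] : exists q : rat, x i = ratr q.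
  by have [xE _] := xH; have [_ xQ] := ext_leech_facts Omega24 golayG g_even xE; exact: xQ.
have xE : x = ((-1) ^+ c * (x i : R)) *: y.
  apply/eqP; rewrite -subr_eq0; apply/eqP.
  have cI := code_invariant_comb ((-1) ^+ c * (x i : R)) (invariant_code_invariant xH) tC.
  apply: (code_invariant_eq0 cI iI Gi).
  by rewrite !ffunE /GRing.scale /= tc mulrAC -signr_addb addbb mul1r subrr.
have -> : x = ratr ((-1) ^+ (c (+) b) * q) *: ((-1) ^+ b *: y).
  rewrite {1}xE scalerA xq rmorphM /= rmorphXn rmorphN1; congr (_ *: _).
  by rewrite signr_addb mulrAC -!mulrA signrMK.
by apply: (rat_subspaceZ _ (rat_span_subspace _)); exact: mem_rat_span.
Qed.

Lemma stab_image C h : h \in stabM24 G C -> h @: C = C.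
Proof. by rewrite inE => /andP[_ /astabs_setact]. Qed.

(** Images of C under M24 correspond to the cosets of its stabilizer. *)
Lemma transversal_image C T u : coset_representatives G C T -> u \in M24 G ->
  exists2 s, s \in T & s @: C = u @: C.
Proof.
case/and3P => _ _ /forall_inP TT uG.
have /cards1P[s sE] := TT _ (imset_f (rcoset (stabM24 G C)) uG).
have : s \in T :&: (stabM24 G C :* u)%g by rewrite -rcosetE sE finset.set11.
rewrite inE => /andP[sT /rcosetP[h hC sh]]; exists s => //.
rewrite sh -{2}(stab_image hC) -imset_comp; apply: eq_imset => x; exact: permM.
Qed.

Lemma transversal_inj C T s s' : coset_representatives G C T -> s \in T -> s' \in T ->
  s @: C = s' @: C -> s = s'.
Proof.
case/and3P => _ /fintype.subsetP TM /forall_inP TT sT s'T ss'.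
have /cards1P[u uE] := TT _ (imset_f (rcoset (stabM24 G C)) (TM _ s'T)).
have mem_u r : r \in T -> r \in (stabM24 G C :* s')%g -> r = u.
  by move=> rT rC; apply/set1P; rewrite -uE inE rT rcosetE.
have stabI h : h \in M24 G -> h @: C = C -> h \in stabM24 G C.
  move=> hG hC; rewrite finset.in_setI hG; apply/(astabsP (to := 'P%act)) => x.
  by rewrite /= apermE -{1}hC mem_imset //; exact: perm_inj.
have s'u : s' = u.
  by apply: mem_u => //; apply/rcosetP; exists 1%g; rewrite ?mul1g.
rewrite s'u; apply: mem_u => //; apply/rcosetP; exists (s * s'^-1)%g; last by rewrite mulgKV.
apply: stabI; first by rewrite M24_groupM ?M24_groupV ?TM.
have -> : (s * s'^-1)%g @: C = s'^-1%g @: (s @: C).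
  by rewrite -imset_comp; apply: eq_imset => x; exact: permM.
by rewrite ss' -imset_comp -[RHS]imset_id; apply: eq_imset => x /=; rewrite permK.
Qed.

(** The coordinate of sigma_C at i has at most one nonzero term, that of the coset
    carrying C onto the image of i; comparing signs, it is t(c) t(i). *)
Lemma sigma_tensor C (c : 'I_g -> Omega) (T : {set {perm Omega}}) : cw C -> numbering C c ->
  coset_representatives G C T -> exists b : bool, sigma R c T = (-1) ^+ b *: t.
Proof.
move=> GC [cI cC] TT; pose i0 : idx := [ffun a => c a].
have i0I : injective i0 by move=> a b; rewrite !ffunE => /cI.
have imi0 : im i0 = C by rewrite -cC; apply: eq_imset => a; rewrite ffunE.
have [b bE] := tensor_sign i0I (etrans (f_equal (codeword G) imi0) GC).
have tC := invariant_code_invariant tensor_invariant; move: t bE tC => y bE tC.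
exists b; apply/ffunP => i; rewrite sum_ffunE [RHS]ffunE /GRing.scale /=.
pose si (s : {perm Omega}) : idx := [ffun a => s (i0 a)].
have siI s : injective (si s) by move=> a d; rewrite !ffunE => /perm_inj/cI.
have siE s : extmap (perm_euclid s) (beta R c) = beta R (si s).
  by rewrite extmap_wedge; congr wedge; apply/funext => a /=; rewrite perm_euclid_nu !ffunE.
have imsi s : im (si s) = s @: C.
  by rewrite -imi0 -imset_comp; apply: eq_imset => a; rewrite ffunE.
have term s : s \in M24 G -> extmap (perm_euclid s) (beta R c) i =
    if im i == s @: C then (-1) ^+ b * (y i : R) else 0.
  move=> sG; rewrite siE -imsi; case: eqP => [isi|isi].
    have iI : injective i.
      by apply: in2T; apply/imset_injP; rewrite isi card_im // card_ord.
    have [p ->] := reindex_exists (siI s) iI (esym isi).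
    have [tA _ _] := tC; rewrite beta_reindex // tA (code_invariant_perm i0 tC sG) bE.
    by rewrite mulrCA -signr_addb addbb mulr1.
  apply/eqP; apply: contraT => si0; case: isi.
  have iI := alternating_neq0 (alternating_wedge _) si0.
  apply/eqP; rewrite finset.eqEcard !card_im // leqnn andbT.
  apply/fintype.subsetP => _ /imsetP[d _ ->]; apply: contraNT si0 => sid.
  by rewrite (beta_eq0 (b := d)) // => a; apply: contraNneq sid => <-; exact: imset_f.
have TM s : s \in T -> s \in M24 G by move=> sT; case/and3P: TT => _ /fintype.subsetP/(_ s sT).
rewrite (eq_bigr _ (fun s sT => term s (TM s sT))).
case: (pickP (fun s => (s \in T) && (im i == s @: C))) => [s /andP[sT si_]|none].
  rewrite (bigD1 s) //= si_ big1 ?addr0 // => s' /andP[s'T ss'].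
  case: eqP => // is'; case/eqP: ss'; apply: (transversal_inj TT) => //.
  by rewrite -is' (eqP si_).
rewrite big1 => [|s sT]; last by have := none s; rewrite sT /= => ->.
apply/esym/eqP; rewrite mulf_eq0 signr_eq0 /=; apply: contraT => ti.
have [iI Gi] := code_invariant_support Omega24 golayG tC ti.
have [|u uG uC] := M24_transitive (R := R) Omega24 golayG wG g GC Gi.
  by rewrite card_im // -imi0 card_im.
have [s sT sC] := transversal_image TT uG.
by have := none s; rewrite sT sC uC eqxx.
Qed.

End Line.

Theorem proposition1p4 (R : realType) (Omega : finType)
    (G : {vspace {ffun Omega -> ('F_2)^o}})
    (hOmega : #|Omega| = 24%N) (hG : extended_golay G)
    (g : nat) (hg : g \in [:: 0; 8; 12; 16; 24]%N) :
  rat_line (ext_leech_invariants R G g) /\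
  forall C : {set Omega}, codeword G C -> #|C| = g ->
  forall c : 'I_g -> Omega, numbering C c ->
  forall T : {set {perm Omega}}, coset_representatives G C T ->
    ext_leech_invariants R G g = rat_span [set sigma R c T].
Proof.
have [w wG] := golay_labelling_exists hOmega hG.
have [z0 _] : exists z0 : Omega, true.
  by move: hOmega; rewrite cardT; case: (enum Omega) => [|z0 ?] //; exists z0.
split=> [|C GC _ c cC T TT].
  have [i [_ _ [b tb]]] := tensor_coord (R := R) hOmega wG hg z0.
  exists (golay_tensor w g); last first.
    by rewrite (invariants_line (R := R) hOmega hG wG hg z0 false) expr0 scale1r.
  move: (golay_tensor w g) tb => y yb.
  by apply/eqP => y0; have /eqP := yb; rewrite y0 ffunE eq_sym signr_eq0.
have [b ->] := sigma_tensor (R := R) hOmega hG wG hg z0 GC cC TT.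
exact: invariants_line.
Qed.
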